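(* For any $1\le \ell\le k+2$, $p\in[1,\infty)$ and $\boldsymbol{u}\in (L^1(\hat K))^2$ such that $\operatorname{div}\boldsymbol{u}\in W^{\ell,p}(\hat K)$, it holds $$\|\operatorname{div}(\boldsymbol{u}-\hat{\boldsymbol{\mathcal I}}_{ABF}\boldsymbol{u})\|_{L^p(\hat K)}\lesssim \sum_{|\boldsymbol{\alpha}|=\ell}\|\partial_x^{\alpha_1}\partial_y^{\alpha_2}\operatorname{div}\boldsymbol{u}\|_{L^p(\hat K)},$$ and for $1\le s\le k+1$ $$\|\operatorname{div}(\boldsymbol{u}-\hat{\boldsymbol{\mathcal I}}_{ABF}\boldsymbol{u})\|_{L^p(\hat K)}\lesssim \|\partial_x^{s}\operatorname{div}\boldsymbol{u}\|_{L^p(\hat K)}+\|\partial_y^{s}\operatorname{div}\boldsymbol{u}\|_{L^p(\hat K)},$$ where $\hat{\boldsymbol{\mathcal I}}_{ABF}$ is the Arnold-Boffi-Falk interpolation operator of order $k$ on $\hat K$.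
   Context: $\hat K=[0,1]^2$ is the reference square with boundary $\partial\hat K$ and unit normal $\boldsymbol{n}$; $k$ is a nonnegative integer, $\ell$ and $s$ are integers, and $\boldsymbol{\alpha}=(\alpha_1,\alpha_2)$ is a multiindex with $|\boldsymbol{\alpha}|=\alpha_1+\alpha_2$. $\mathcal Q_{r,t}(\hat K)$ is the space of polynomials on $\hat K$ of degree at most $r$ in $x$ and at most $t$ in $y$ (trivial if $r$ or $t$ is negative). For a face (edge) $\hat F$ of $\hat K$, $\mathcal P_k(\hat F)$ is the space of polynomials of total degree at most $k$ on $\hat F$. $L^p$ is the Lebesgue space and $W^{\ell,p}$ the corresponding Sobolev space of (weak) derivatives up to order $\ell$. $A\lesssim B$ means that there is a generic constant $C>0$ (not depending on $\boldsymbol{u}$) with $A\le C\cdot B$. The Arnold-Boffi-Falk space is $ABF_k(\hat K)=\mathcal Q_{k+2,k}(\hat K)\times\mathcal Q_{k,k+2}(\hat K)$. The interpolation operator $\hat{\boldsymbol{\mathcal I}}_{ABF}:(C(\hat K))^2\to ABF_k(\hat K)$ is given for any $\boldsymbol{v}\in (C(\hat K))^2$ by $$\int_{\hat F}\big((\hat{\boldsymbol{\mathcal I}}_{ABF}\boldsymbol{v}-\boldsymbol{v})\cdot\boldsymbol{n}\big)\,q=0\quad\text{for all } q\in\mathcal P_k(\hat F)\text{ and all faces }\hat F\subset\partial\hat K,$$ $$\int_{\hat K}(\hat{\boldsymbol{\mathcal I}}_{ABF}\boldsymbol{v}-\boldsymbol{v})\cdot\boldsymbol{q}=0\quad\text{for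 all }\boldsymbol{q}\in\mathcal Q_{k-1,k}(\hat K)\times\mathcal Q_{k,k-1}(\hat K),$$ $$\int_{\hat K}\operatorname{div}(\hat{\boldsymbol{\mathcal I}}_{ABF}\boldsymbol{v}-\boldsymbol{v})\,x^iy^{k+1}=0\quad\text{for all } i\in\{0,\dots,k\},$$ $$\int_{\hat K}\operatorname{div}(\hat{\boldsymbol{\mathcal I}}_{ABF}\boldsymbol{v}-\boldsymbol{v})\,x^{k+1}y^{j}=0\quad\text{for all } j\in\{0,\dots,k\}.$$ *)

(* Defs.v *)
From HB Require Import structures.
From mathcomp Require Export all_boot all_order all_algebra.
From mathcomp Require Export all_classical all_reals all_analysis.
Export Order.TTheory GRing.Theory Num.Theory.
Export numFieldNormedType.Exports.

Set Implicit Arguments.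
Unset Strict Implicit.
Unset Printing Implicit Defensive.

Local Open Scope classical_set_scope.
Local Open Scope ring_scope.

Section ReferenceSquare.
Context {R : realType}.
Local Notation plane := (R * R)%type.

Definition Khat : set plane := `[0, 1] `*` `[0, 1].
Definition Khat_int : set plane := `]0, 1[ `*` `]0, 1[.

Definition leb2 := ((@lebesgue_measure R) \x (@lebesgue_measure R))%E.

Definition intK (f : plane -> R) : R := Rintegral leb2 Khat f.

Definition normLp (p : R) (f : plane -> R) : \bar R :=
  Lnorm leb2 p%:E (EFin \o (f \_ Khat)).

Definition memLp (p : R) (f : plane -> R) : Prop :=
  measurable_fun Khat f /\ (normLp p f < +oo)%E.

Definition memL1_vec (u : plane -> plane) : Prop :=
  leb2.-integrable Khat (EFin \o (fst \o u)) /\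
  leb2.-integrable Khat (EFin \o (snd \o u)).

Definition memL1loc (f : plane -> R) : Prop :=
  measurable_fun Khat f /\
  forall C : set plane, compact C -> C `<=` Khat_int ->
    leb2.-integrable C (EFin \o f).

Definition dx (f : plane -> R) : plane -> R :=
  fun z => derive1 (fun t : R => f (t, z.2)) z.1.
Definition dy (f : plane -> R) : plane -> R :=
  fun z => derive1 (fun t : R => f (z.1, t)) z.2.

Definition dot (v w : plane) : R := v.1 * w.1 + v.2 * w.2.
Definition grad (f : plane -> R) : plane -> plane := fun z => (dx f z, dy f z).
Definition diverg (w : plane -> plane) : plane -> R :=
  fun z => dx (fst \o w) z + dy (snd \o w) z.

Fixpoint Ck (n : nat) (f : plane -> R) : Prop :=
  continuous f /\
  if n is m.+1 then
    [/\ forall z : plane, derivable (fun t : R => f (t, z.2)) z.1 1,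
        forall z : plane, derivable (fun t : R => f (z.1, t)) z.2 1,
        Ck m (dx f) & Ck m (dy f)]
  else True.

Definition smooth (f : plane -> R) : Prop := forall n, Ck n f.

(* The space C_c^oo of the open square. *)
Definition test_fun (phi : plane -> R) : Prop :=
  [/\ smooth phi, compact (closure [set z | phi z != 0])
    & closure [set z | phi z != 0] `<=` Khat_int].

Definition weak_deriv (a b : nat) (f g : plane -> R) : Prop :=
  [/\ memL1loc f, memL1loc g &
    forall phi, test_fun phi ->
      intK (fun z => f z * iter a dx (iter b dy phi) z) =
      (-1) ^+ (a + b) * intK (fun z => g z * phi z)].

Definition weak_div (u : plane -> plane) (d : plane -> R) : Prop :=
  memL1loc d /\
  forall phi, test_fun phi ->
    intK (fun z => dot (u z) (grad phi z)) = - intK (fun z => d z * phi z).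

Definition sobolev (l : nat) (p : R) (f : plane -> R) : Prop :=
  memLp p f /\
  forall a b : nat, (a + b <= l)%N ->
    exists g, memLp p g /\ weak_deriv a b f g.

(* Exponents are bounded strictly: [Qpoly m n] is Q_{m-1,n-1}, so that the
   spaces with a negative index are [Qpoly 0 n] and [Qpoly m 0], both trivial. *)
Definition Qpoly (m n : nat) : set (plane -> R) :=
  [set f | exists c : 'M[R]_(m, n),
     forall z, f z = \sum_(i < m) \sum_(j < n) c i j * z.1 ^+ i * z.2 ^+ j].

Definition Qvec (m n m' n' : nat) : set (plane -> plane) :=
  [set w | Qpoly m n (fst \o w) /\ Qpoly m' n' (snd \o w)].

Definition ABF (k : nat) : set (plane -> plane) :=
  Qvec k.+3 k.+1 k.+1 k.+3.

Inductive face := Left | Right | Bottom | Top.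

Definition face_pt (F : face) (t : R) : plane :=
  match F with
  | Left => (0, t) | Right => (1, t) | Bottom => (t, 0) | Top => (t, 1)
  end.

Definition normal (F : face) : plane :=
  match F with
  | Left => (-1, 0) | Right => (1, 0) | Bottom => (0, -1) | Top => (0, 1)
  end.

(* int_F (v . n) q, with q given in the arclength parameter of F. *)
Definition flux (v : plane -> plane) (F : face) (q : R -> R) : R :=
  Rintegral lebesgue_measure `[0, 1]
    (fun t : R => dot (v (face_pt F t)) (normal F) * q t).

(* Normal trace of an integrable field u with integrable weak divergence d, as a
   linear functional on each face: the boundary term of Green's formula.  It
   need not be unique, because the corners can be shared out differently among
   the faces. *)
Definition green_trace (u : plane -> plane) (d : plane -> R)
    (tr : face -> (R -> R) -> R) : Prop :=
  (forall F (a : R) (q r : R -> R),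
     tr F (fun t => a * q t + r t) = a * tr F q + tr F r) /\
  forall phi, smooth phi ->
    intK (fun z => dot (u z) (grad phi z)) + intK (fun z => d z * phi z) =
    tr Left (phi \o face_pt Left) + tr Right (phi \o face_pt Right) +
    tr Bottom (phi \o face_pt Bottom) + tr Top (phi \o face_pt Top).

(* The face moments of u . n entering the interpolation conditions: the face
   integrals if u is continuous on the closed square, and in general those of
   a normal trace, as u . n has no pointwise meaning on the boundary. *)
Definition face_moments (u : plane -> plane) (d : plane -> R)
    (tr : face -> (R -> R) -> R) : Prop :=
  ({within Khat, continuous u} /\ tr = flux u) \/ green_trace u d tr.

(* w is an Arnold-Boffi-Falk interpolant of order k of the field u with weak
   divergence d.  The conditions determine w once tr is fixed, in particular if
   u is continuous and tr its flux; as a relation, this definition does not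
   presuppose unisolvence. *)
Definition ABF_interpolant (k : nat) (u : plane -> plane) (d : plane -> R)
    (w : plane -> plane) : Prop :=
  ABF k w /\
  exists2 tr, face_moments u d tr &
  [/\ forall F (q : {poly R}), (size q <= k.+1)%N ->
        flux w F (horner q) - tr F (horner q) = 0,
      forall q, Qvec k k.+1 k.+1 k q ->
        intK (fun z => dot (w z - u z) (q z)) = 0,
      forall i : nat, (i <= k)%N ->
        intK (fun z => (diverg w z - d z) * (z.1 ^+ i * z.2 ^+ k.+1)) = 0
    & forall j : nat, (j <= k)%N ->
        intK (fun z => (diverg w z - d z) * (z.1 ^+ k.+1 * z.2 ^+ j)) = 0].

End ReferenceSquare.

(* Main.v *)
(** Let [P] be the span of the monomials [x^i y^j] with [i, j <= k+1], the pair
    [(k+1, k+1)] excluded.  The divergence of an interpolant [w] lies in [P], and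
    Green's formula turns the face and interior conditions into the equality of the
    moments of [div w] and [d] against [x^i y^j], [i, j <= k]; the two remaining
    conditions are the missing moments.  Hence [div w] is the L^2 projection of
    [d] onto [P].  Inverting a Gram matrix shows that this projection is bounded in
    L^p, so that the error is controlled by [d - q] for every [q] in [P].

    To choose [q], take test functions [om_i], [i < s], biorthogonal to the powers
    [x^j] on [0, 1], and let [Pi f = sum_i (int f om_i) x^i].  As [1 - Pi^*] maps
    test functions to test functions with vanishing moments, which are [s]-th
    derivatives, [f - Pi f] is, up to sign, [(1 - Pi) T f^(s)] with [T] the Taylor
    kernel; thus [Pi] applied in [x] and then in [y] approximates [d] with an error
    bounded by [d_x^s d] and [d_y^s d].  For the estimate with all derivatives of
    order [l], the terms with [i + j >= l] are dropped: [om_i] is the [i]-th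
    derivative of a test function, so that their coefficients are integrals of
    derivatives of order [l].  Weak derivatives are only ever tested on tensor
    products [a(x) b(y)]. *)

Require Import Defs.
From mathcomp Require Import measurable_realfun lra.

Set Implicit Arguments.
Unset Strict Implicit.
Unset Printing Implicit Defensive.

Local Open Scope classical_set_scope.
Local Open Scope ring_scope.

(** * Smooth functions and test functions of one variable *)

(** The ranges of [l] and [s] reflect the monomial missing from [P]. Degrees below [s] in each
    variable separately avoid the pair (k+1, k+1) for s <= k+1, but not for s = k+2; a total degree
    below [l] avoids it up to l = k+2.

    The field is merely integrable, so its normal trace need be neither a function nor unique. Only
    the difference of two Green identities with the same face moments is formed, and the traces
    cancel there.

    Even the linearity of a projection in one variable then holds only almost everywhere. Identities
    between operators are therefore obtained by duality: both sides are tested on products a(x)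
    b(y), and a fundamental lemma turns this into equality almost everywhere. Products suffice
    because the measurable rectangles generate the product sigma-algebra and are stable under
    intersection.

    Every constant comes from a bounded kernel or the inverse of a Gram matrix, on a square of
    measure 1 where the L^1 norm is below the L^p norm. It is fixed before the field is chosen, and
    no compactness argument in L^p occurs. *)

Section Smooth1.
Local Open Scope classical_set_scope.
Context {R : realType}.
Implicit Types f g : R -> R.

Fixpoint diffn (n : nat) f : Prop :=
  if n is m.+1 then (forall x, derivable f x 1) /\ diffn m f^`() else True.

Definition smooth1 f := forall n, diffn n f.

Lemma smooth1P f : smooth1 f <-> (forall x, derivable f x 1) /\ smooth1 f^`().
Proof.
split=> [sf|[df sf] [|n]//].
by split=> [|n]; [have [] := sf 1%N|have [] := sf n.+1].
Qed.

Lemma smooth1_derivable f x : smooth1 f -> derivable f x 1.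
Proof. by move=> /smooth1P[]. Qed.

Lemma smooth1_derive1 f : smooth1 f -> smooth1 f^`().
Proof. by move=> /smooth1P[]. Qed.

Lemma smooth1_derive1n n f : smooth1 f -> smooth1 f^`(n).
Proof. by move=> sf; elim: n => // n ih; rewrite derive1nS; exact: smooth1_derive1. Qed.

Lemma smooth1_continuous f : smooth1 f -> continuous f.
Proof.
move=> sf x; apply: differentiable_continuous.
exact/derivable1_diffP/smooth1_derivable.
Qed.

(** Smoothness follows from membership in any class of differentiable functions closed under
    derivation, so no formula for higher derivatives is required. It serves for polynomials and for
    the family [flat]. *)
Lemma smooth1_coind (S : set (R -> R)) :
    (forall f, S f -> (forall x, derivable f x 1) /\ S f^`()) ->
  forall f, S f -> smooth1 f.
Proof. by move=> cS f Sf n; elim: n f Sf => //= n ih f /cS[? /ih]. Qed.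

Lemma derive1D f g : (forall x, derivable f x 1) -> (forall x, derivable g x 1) ->
  (f \+ g)^`() = f^`() \+ g^`().
Proof.
by move=> df dg; apply/funext => x; rewrite derive1E deriveD// -!derive1E.
Qed.

Lemma derive1M f g : (forall x, derivable f x 1) -> (forall x, derivable g x 1) ->
  (f \* g)^`() = (f^`() \* g) \+ (f \* g^`()).
Proof.
move=> df dg; apply/funext => x; rewrite derive1E deriveM// -!derive1E /=.
by rewrite addrC; congr (_ + _); exact: mulrC.
Qed.

Lemma diffnS n f : diffn n.+1 f -> diffn n f.
Proof. by elim: n f => // n ih f [df /ih]. Qed.

Lemma diffnD n f g : diffn n f -> diffn n g -> diffn n (f \+ g).
Proof.
elim: n f g => // n ih f g [df sf] [dg sg]; split=> [x|].
  exact: derivableD.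
by rewrite derive1D//; exact: ih.
Qed.

Lemma diffnM n f g : diffn n f -> diffn n g -> diffn n (f \* g).
Proof.
elim: n f g => // n ih f g fn gn; have [df sf] := fn; have [dg sg] := gn.
split=> [x|]; first exact: derivableM.
by rewrite derive1M//; apply: diffnD; apply: ih => //; exact: diffnS.
Qed.

Lemma smooth1D f g : smooth1 f -> smooth1 g -> smooth1 (f \+ g).
Proof. by move=> sf sg n; exact: diffnD. Qed.

Lemma smooth1M f g : smooth1 f -> smooth1 g -> smooth1 (f \* g).
Proof. by move=> sf sg n; exact: diffnM. Qed.

Lemma smooth1_horner (p : {poly R}) : smooth1 (horner p).
Proof.
apply: (@smooth1_coind [set f | exists q : {poly R}, f = horner q]); last by exists p.
move=> _ [q ->]; split; first by move=> x; exact: derivable_horner.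
by exists q^`()%R; rewrite -derivE.
Qed.

Lemma smooth1_cst (c : R) : smooth1 (fun=> c).
Proof.
rewrite (_ : (fun=> c) = horner c%:P); first exact: smooth1_horner.
by apply/funext => x; rewrite hornerC.
Qed.

Lemma smooth1_exp n : smooth1 (fun x => x ^+ n).
Proof.
rewrite (_ : (fun _ => _) = horner 'X^n); first exact: smooth1_horner.
by apply/funext => x; rewrite hornerXn.
Qed.

Lemma is_derive_affine (c d x : R) : is_derive x (1 : R) (fun x => c * x + d) c.
Proof.
rewrite (_ : (fun _ => _) = horner (c *: 'X + d%:P)).
  apply: DeriveDef; first exact: derivable_horner.
  rewrite -derive1E -derivE derivD derivZ derivX derivC addr0.
  by rewrite hornerE hornerE mulr1.
by apply/funext => t; rewrite !hornerE.
Qed.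

Lemma derive1_affine f (c d : R) : (forall x, derivable f x 1) ->
  (forall x, derivable (fun x => f (c * x + d)) x 1) /\
  (fun x => f (c * x + d))^`() = (fun x => c * derive1 f (c * x + d)).
Proof.
move=> df; have h x : is_derive x (1 : R) (f \o (fun x => c * x + d))
    (c * derive1 f (c * x + d)).
  rewrite mulrC -[X in is_derive _ _ _ X]/(_ *: c).
  apply: is_derive1_comp; first by rewrite derive1E; exact: derivableP.
  exact: is_derive_affine.
split=> [x|]; first by have := h x => ?; exact: ex_derive.
by apply/funext => x; rewrite derive1E; have := h x => ?; rewrite derive_val.
Qed.

Lemma smooth1_affine f (c d : R) : smooth1 f -> smooth1 (fun x => f (c * x + d)).
Proof.
move=> sf n; elim: n f sf => // n ih f sf.
have [h1 h2] := derive1_affine c d (fun x => smooth1_derivable (x := x) sf).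
split=> //; rewrite h2.
apply: (@diffnM n (fun=> c)); first exact: smooth1_cst.
by apply: ih; exact: smooth1_derive1.
Qed.

Lemma smooth1_sum (I : Type) (r : seq I) (F : I -> R -> R) :
  (forall i, smooth1 (F i)) -> smooth1 (fun x => \sum_(i <- r) F i x).
Proof.
move=> sF; elim: r => [|i r ih].
  rewrite (_ : (fun _ => _) = cst 0); first exact: smooth1_cst.
  by apply/funext => x; rewrite big_nil.
rewrite (_ : (fun _ => _) = F i \+ (fun x => \sum_(i <- r) F i x)).
  exact: smooth1D.
by apply/funext => x; rewrite big_cons.
Qed.

End Smooth1.

(** * Smooth compactly supported bumps built from exp(-1/x) *)

Section Flat.
Local Open Scope classical_set_scope.
Context {R : realType}.
Implicit Types p : {poly R}.

(** Comparison with a single term of the exponential series gives u^n <= n! exp(u), and this is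
    summed with the absolute values of the coefficients. *)
Lemma horner_le_expR p : exists C, forall u : R, 0 <= u -> `|p.[u]| <= C * expR u.
Proof.
exists (\sum_(i < size p) `|p`_i| * (i`!)%:R) => u u0.
rewrite horner_coef (le_trans (ler_norm_sum _ _ _))// mulr_suml ler_sum// => i _.
rewrite normrM -mulrA ler_wpM2l// ger0_norm ?exprn_ge0//.
case: (nat_of_ord i) => [|n].
  by rewrite expr0 mul1r; apply: (le_trans _ (expR_ge1Dx _)); rewrite lerDl.
rewrite mulrC -ler_pdivrMr ?ltr0n ?fact_gt0//.
by apply: (le_trans _ (expR_ge1Dxn n u0)); rewrite lerDr.
Qed.

(** The polynomial in 1/x is kept as a parameter because the family is then closed under derivation,
    as [smooth1_coind] demands; exp(-1/x) alone is not. *)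
Definition flat p (x : R) := if 0 < x then p.[x^-1] * expR (- x^-1) else 0.

(** The factor ['X^2] brings in the 1/x^2 that has to be absorbed before the exponential bound is
    applied at u = 1/x. A quadratic bound is exactly what yields the derivative [0] at the
    origin. *)
Lemma flat_le_sqr p : exists C, forall x : R, `|flat p x| <= C * x ^+ 2.
Proof.
have [C hC] := horner_le_expR ('X^2 * p).
exists C => x; rewrite /flat; case: ltP => x0.
  have xi : 0 <= x^-1 by rewrite invr_ge0 ltW.
  have := hC _ xi; rewrite hornerM hornerXn !normrM.
  rewrite [`|expR _|]ger0_norm ?expR_ge0// => H.
  rewrite expRN ler_pdivrMr ?expR_gt0//.
  rewrite [C * _]mulrC -mulrA -ler_pdivrMl ?exprn_gt0//.
  by move: H; rewrite [`|x^-1|]ger0_norm// -exprVn expr2.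
rewrite normr0; suff C0 : 0 <= C by rewrite mulr_ge0// sqr_ge0.
by have := hC 0 (lexx _); rewrite expR0 mulr1; exact: le_trans.
Qed.

Lemma is_derive_cvg (f : R -> R) (x l : R) :
  h^-1 * (f (h + x) - f x) @[h --> 0^'] --> l -> is_derive x (1 : R) f l.
Proof.
move=> fl; set g := fun h : R => h^-1 *: ((f \o shift x) (h *: (1 : R)) - f x).
have gl : g @ 0^' --> l.
  rewrite (_ : g = (fun h => h^-1 * (f (h + x) - f x)))//.
  by apply/funext => h; rewrite /g /= /GRing.scale/= mulr1.
by apply: DeriveDef; [apply/cvg_ex; exists l|exact/cvg_lim].
Qed.

Lemma is_derive_sqr_bound (f : R -> R) (C : R) : (forall x, `|f x| <= C * x ^+ 2) ->
  is_derive (0 : R) (1 : R) f 0.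
Proof.
move=> hf; have f0 : f 0 = 0.
  by apply/eqP; rewrite -normr_le0 (le_trans (hf 0))// expr0n mulr0.
have C0 : 0 <= C.
  by have := hf 1; rewrite expr1n mulr1; exact: le_trans.
apply: is_derive_cvg; apply/cvgrPdist_le => /= e e0; near=> h.
rewrite sub0r normrN f0 subr0 addr0 normrM normfV.
have [->|h0] := eqVneq h 0; first by rewrite f0 normr0 mulr0 ltW.
rewrite mulrC ler_pdivrMr ?normr_gt0//.
rewrite (le_trans (hf h))// -real_normK ?num_real// expr2 mulrA ler_wpM2r//.
have : `|h| <= e / (C + 1).
  by near: h; apply: dnbhs0_le; rewrite divr_gt0// ltr_wpDl.
rewrite ler_pdivlMr ?ltr_wpDl// mulrDr mulr1 [C * _]mulrC.
by apply: le_trans; rewrite lerDl.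
Unshelve. all: by end_near. Qed.

(** For positive [x] the chain rule in u = 1/x contributes the factor -u^2, and the product rule the
    combination p' - p. At the gluing point the quadratic bound takes over. *)
Lemma is_derive_flat p x : is_derive x (1 : R) (flat p) (flat ('X^2 * (p - p^`()%R)) x).
Proof.
have [x0|x0|->] := ltgtP x 0.
- rewrite {2}/flat ltNge (ltW x0)/=.
  apply: (@near_eq_is_derive _ _ _ (cst 0)).
  near=> y; rewrite /flat ltNge (_ : y <= 0)//; apply/ltW.
  by near: y; exact: lt_nbhsl.
- rewrite {2}/flat x0.
  have xi : is_derive x (1 : R) (fun y : R => y^-1) (- x^-1 ^+ 2).
    apply: DeriveDef; first by apply: derivableV => //; rewrite gt_eqF.
    rewrite deriveV ?gt_eqF//= derive_id /GRing.scale/= mulr1 exprVn//.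
  have xe : is_derive (x^-1) (1 : R) (fun u => expR (-1 * u + 0)) (- expR (- x^-1)).
    have [h1 h2] := @derive1_affine _ expR (-1) 0 (@derivable_expR R).
    apply: DeriveDef; first exact: h1.
    by rewrite -derive1E h2 derive1E derive_val mulN1r addr0 mulN1r.
  have pe : is_derive (x^-1) (1 : R) (horner p \* (fun u => expR (-1 * u + 0)))
     (p.[x^-1] * - expR (- x^-1) + expR (- x^-1) * p^`()%R.[x^-1]).
    have := is_deriveM (is_derive_poly p x^-1) xe.
    by rewrite mulN1r addr0.
  have := is_derive1_comp pe xi.
  rewrite (_ : _ * - _ = ('X^2 * (p - p^`()%R)).[x^-1] * expR (- x^-1)).
    apply: near_eq_is_derive; near=> y.
    rewrite /flat (_ : 0 < y) /= ?mulN1r ?addr0//.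
    by near: y; exact: lt_nbhsr.
  by rewrite hornerM hornerXn hornerD hornerN; lra.
- rewrite {2}/flat ltxx; have [C hC] := flat_le_sqr p.
  exact: is_derive_sqr_bound hC.
Unshelve. all: by end_near. Qed.

Lemma smooth1_flat p : smooth1 (flat p).
Proof.
apply: (@smooth1_coind _ [set f | exists q : {poly R}, f = flat q]); last by exists p.
move=> _ [q ->]; split; first by move=> x; have := is_derive_flat q x; case.
exists ('X^2 * (q - q^`()%R)); apply/funext => x.
by rewrite derive1E; have := is_derive_flat q x => -[].
Qed.

Definition bump (a b x : R) := flat 1 (x - a) * flat 1 (b - x).

Lemma flat1E x : flat 1 x = if 0 < x then expR (- x^-1) else 0.
Proof. by rewrite /flat hornerE mul1r. Qed.

Lemma flat_gt0 x : (0 < flat 1 x) = (0 < x).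
Proof. by rewrite flat1E; case: ifP => // _; rewrite ?ltxx// expR_gt0. Qed.

Lemma flat_ge0 x : 0 <= flat 1 x.
Proof. by rewrite flat1E; case: ifP => // _; exact: expR_ge0. Qed.

Lemma flat_eq0 x : x <= 0 -> flat 1 x = 0.
Proof. by rewrite /flat; case: ltP. Qed.

Lemma smooth1_bump a b : smooth1 (bump a b).
Proof.
apply: (@smooth1M _ (fun x => flat 1 (x - a)) (fun x => flat 1 (b - x))).
  rewrite (_ : (fun _ => _) = (fun x => flat 1 (1 * x + - a))).
    exact: smooth1_affine (smooth1_flat _).
  by apply/funext => x; rewrite mul1r.
rewrite (_ : (fun _ => _) = (fun x => flat 1 (-1 * x + b))).
  exact: smooth1_affine (smooth1_flat _).
by apply/funext => x; rewrite mulN1r addrC.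
Qed.

Lemma bump_ge0 a b x : 0 <= bump a b x.
Proof. by rewrite mulr_ge0// flat_ge0. Qed.

Lemma bump_gt0 a b x : a < x < b -> 0 < bump a b x.
Proof. by move=> /andP[ax xb]; rewrite mulr_gt0// flat_gt0 subr_gt0. Qed.

Lemma bump_eq0 a b x : (x <= a) || (b <= x) -> bump a b x = 0.
Proof.
by case/orP => h; rewrite /bump; [rewrite (flat_eq0 (x := x - a)) ?mul0r|
  rewrite (flat_eq0 (x := b - x)) ?mulr0]; rewrite // subr_le0.
Qed.

End Flat.

(** * Integrable functions and bounded multipliers on a measurable set *)

Section Rint.
Local Open Scope classical_set_scope.
Context d (T : measurableType d) (R : realType) (mu : {measure set T -> \bar R}).
Variables (D : set T) (mD : measurable D).
Implicit Types f g : T -> R.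

Definition rint f := mu.-integrable D (EFin \o f).

(** These are the multipliers that preserve [rint]; on a set of finite measure they are integrable
    themselves. Kernels, test functions and polynomials all enter in this form. *)
Definition bdm f := measurable_fun D f /\ exists M, forall x, D x -> `|f x| <= M.

Lemma rint_measurable f : rint f -> measurable_fun D f.
Proof. by move=> /integrableP[/measurable_EFinP]. Qed.

Lemma rintD f g : rint f -> rint g -> rint (f \+ g).
Proof.
by move=> fi gi; have := integrableD mD fi gi; rewrite /rint; congr integrable.
Qed.

Lemma rintB f g : rint f -> rint g -> rint (f \- g).
Proof.
move=> fi gi; have := integrableB mD fi gi; rewrite /rint; congr integrable.
Qed.

Lemma rintZ c f : rint f -> rint (fun x => c * f x).
Proof. by move=> fi; exact: (integrableZl mD c fi). Qed.

Lemma bounded_globally f (M : R) : (forall x, D x -> `|f x| <= M) -> [bounded f x | x in D].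
Proof.
move=> hM; exists M; split; first exact: num_real.
by move=> y My x Dx /=; rewrite (le_trans (hM x Dx))// ltW.
Qed.

Lemma rintM f g : rint f -> bdm g -> rint (f \* g).
Proof.
move=> fi [mg [M hM]]; have bg : [bounded g x | x in D].
  exact: bounded_globally hM.
by have := integrableMl mD fi mg bg; rewrite /rint; congr integrable.
Qed.

Lemma rint_sum (I : Type) (r : seq I) (F : I -> T -> R) :
  (forall i, rint (F i)) -> rint (fun x => \sum_(i <- r) F i x).
Proof.
move=> Fi; rewrite /rint (_ : _ \o _ = (fun x => (\sum_(i <- r) (F i x)%:E)%E)).
  by apply: integrable_sum => // i _; exact: Fi.
by apply/funext => x; rewrite /= sumEFin.
Qed.

Lemma Rintegral_sum (I : Type) (r : seq I) (F : I -> T -> R) :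
  (forall i, rint (F i)) ->
  \int[mu]_(x in D) (\sum_(i <- r) F i x) = \sum_(i <- r) \int[mu]_(x in D) F i x.
Proof.
move=> Fi; elim: r => [|i r ih].
  rewrite big_nil; under eq_Rintegral do rewrite big_nil.
  by rewrite Rintegral_cst// mul0r.
rewrite big_cons -ih -RintegralD//; [|exact: Fi|exact: rint_sum].
by apply: eq_Rintegral => x _; rewrite big_cons.
Qed.

Lemma rint_bdm f : (mu D < +oo)%E -> bdm f -> rint f.
Proof.
move=> Dfin [mf [M hM]]; apply: measurable_bounded_integrable => //.
exact: bounded_globally hM.
Qed.

Lemma bdm_cst (c : R) : bdm (fun=> c).
Proof. by split=> //; exists `|c|. Qed.

Lemma bdmD f g : bdm f -> bdm g -> bdm (f \+ g).
Proof.
move=> [mf [M hM]] [mg [N hN]]; split; first exact: measurable_funD.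
exists (M + N) => x Dx; rewrite (le_trans (ler_normD _ _))// lerD//; [exact: hM|exact: hN].
Qed.

Lemma bdmM f g : bdm f -> bdm g -> bdm (f \* g).
Proof.
move=> [mf [M hM]] [mg [N hN]]; split; first exact: measurable_funM.
exists (M * N) => x Dx; rewrite normrM ler_pM//; [exact: hM|exact: hN].
Qed.

Lemma bdm_sum (I : Type) (r : seq I) (F : I -> T -> R) :
  (forall i, bdm (F i)) -> bdm (fun x => \sum_(i <- r) F i x).
Proof.
move=> bF; elim: r => [|i r ih].
  rewrite (_ : (fun _ => _) = (fun=> 0)); first exact: bdm_cst.
  by apply/funext => x; rewrite big_nil.
rewrite (_ : (fun _ => _) = F i \+ (fun x => \sum_(i <- r) F i x)).
  exact: bdmD.
by apply/funext => x; rewrite big_cons.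
Qed.

Lemma Rintegral_dominated (F : nat -> T -> R) f g :
  (forall n, measurable_fun D (F n)) -> rint g ->
  (forall n x, D x -> `|F n x| <= g x) ->
  (forall x, D x -> F n x @[n --> \oo] --> f x) ->
  \int[mu]_(x in D) F n x @[n --> \oo] --> \int[mu]_(x in D) f x.
Proof.
move=> mF gi Fg Ff.
have mf : measurable_fun D f by apply: (measurable_fun_cvg mF) => x Dx; exact: Ff.
have [fi _] := @dominated_convergence _ _ _ mu D mD (fun n => EFin \o F n)
  (EFin \o f) (EFin \o g) (fun n => (measurable_EFinP _ _).2 (mF n))
  ((measurable_EFinP _ _).2 mf)
  (aeW _ (fun x Dx => cvg_EFin (f := fun n => (F n x)%:E) (nearW _ (fun=> erefl)) (Ff x Dx))) gi
  (aeW _ (fun x n Dx => Fg n x Dx)).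
rewrite -(fineK (integrable_fin_num mD fi)).
by move=> /fine_cvg.
Qed.

End Rint.

(** * Integration by parts and iterated antiderivatives on [0, 1] *)

Section UnitInterval.
Local Open Scope classical_set_scope.
Context {R : realType}.
Implicit Types f g F G e V : R -> R.
Local Notation mu := (@lebesgue_measure R).
Local Notation I01 := (`[0, 1]%classic : set R).

Definition I1 f : R := \int[mu]_(x in I01) f x.

Lemma lebesgue_I01 : mu I01 = 1%E.
Proof. by rewrite lebesgue_measure_itv /= lte01 oppr0 adde0. Qed.

Lemma bdm_continuous (a b : R) f : {within `[a, b], continuous f} -> bdm `[a, b] f.
Proof.
move=> cf; split; first exact: subspace_continuous_measurable_fun.
have [M [_ hM]] := compact_bounded (continuous_compact cf (segment_compact (a:=a) (b:=b))).
exists (M + 1) => x abx; apply: (hM (M + 1)); first by rewrite ltrDl.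
by exists x.
Qed.

Lemma rint_continuous (a b : R) f : {within `[a, b], continuous f} -> rint mu `[a, b] f.
Proof. by move=> cf; apply: continuous_compact_integrable => //; exact: segment_compact. Qed.

Lemma continuous_within f (A : set R) : continuous f -> {within A, continuous f}.
Proof. by move=> cf; apply: continuous_subspaceT. Qed.

Lemma continuous_mul f g : continuous f -> continuous g ->
  continuous (fun x => f x * g x).
Proof. by move=> cf cg x; apply: (@continuousM _ _ f g); [exact: cf|exact: cg]. Qed.

Lemma within_continuousM (a b : R) f g : {within `[a, b], continuous f} ->
  {within `[a, b], continuous g} -> {within `[a, b], continuous (f \* g)}.
Proof. by move=> cf cg x; apply: continuousM; [exact: cf|exact: cg]. Qed.

Lemma bdm_smooth1 (a b : R) f : smooth1 f -> bdm `[a, b] f.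
Proof. by move=> sf; apply/bdm_continuous/continuous_within/smooth1_continuous. Qed.

Lemma rint_smooth1 (a b : R) f : smooth1 f -> rint mu `[a, b] f.
Proof. by move=> sf; apply/rint_continuous/continuous_within/smooth1_continuous. Qed.

Lemma is_derive_LR F f (a b : R) : (forall x, is_derive x (1 : R) F (f x)) ->
  derivable_oo_LRcontinuous F a b /\ derive1 F =1 f.
Proof.
move=> Ff; have cF : continuous F.
  by move=> x; apply: differentiable_continuous; apply/derivable1_diffP; case: (Ff x).
split; last by move=> x; rewrite derive1E; case: (Ff x).
split; first by move=> x _; case: (Ff x).
- exact/cvg_at_right_filter/cF.
- exact/cvg_at_left_filter/cF.
Qed.

Lemma ibp F G f g (a b : R) : a <= b ->
  (forall x, is_derive x (1 : R) F (f x)) -> continuous f ->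
  (forall x, is_derive x (1 : R) G (g x)) -> continuous g ->
  \int[mu]_(x in `[a, b]) (F x * g x) =
  (F b * G b - F a * G a) - \int[mu]_(x in `[a, b]) (f x * G x).
Proof.
rewrite le_eqVlt => /predU1P[<-|ab] Ff cf Gg cg.
  by rewrite set_itv1 !Rintegral_set1 !subrr.
have [F1 F2] := is_derive_LR a b Ff; have [G1 G2] := is_derive_LR a b Gg.
apply: (@Rintegration_by_parts _ F G f g) => //;
  first [exact: continuous_within|by move=> x _; first [exact: F2|exact: G2]].
Qed.

Definition vanishes_off (a b : R) f := forall x, (x <= a) || (b <= x) -> f x = 0.

Definition test1 f := smooth1 f /\
  exists a b, [/\ 0 < a, a <= b, b < 1 & vanishes_off a b f].

(** For negative [x] the interval is empty and the value is [0], which is the right one for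
    integrands vanishing to the left of a positive point. *)
Definition prim e (x : R) := \int[mu]_(t in `[0, x]) e t.

Lemma prim0 e : prim e 0 = 0.
Proof. by rewrite /prim set_itv1 Rintegral_set1. Qed.

Lemma prim_left e a b : vanishes_off a b e -> forall x, x <= a -> prim e x = 0.
Proof.
move=> e0 x xa; rewrite /prim (@eq_Rintegral _ _ _ _ _ (fun=> 0)).
  by rewrite Rintegral_cst// mul0r.
move=> t /set_mem/=; rewrite in_itv/= => /andP[_ tx].
by rewrite e0// (le_trans tx xa).
Qed.

Lemma prim_addl e (a b : R) : 0 <= a -> a <= b -> rint mu `[0, b] e ->
  prim e b = prim e a + \int[mu]_(t in `]a, b]) e t.
Proof.
move=> a0 ab ei; rewrite -(Rintegral_itvB ei) ?bnd_simp//.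
by rewrite addrC subrK.
Qed.

Lemma prim_right e a b : 0 <= b -> continuous e -> vanishes_off a b e ->
  forall x, b <= x -> prim e x = prim e b.
Proof.
move=> b0 ce e0 x bx; rewrite (@prim_addl _ b)//; last first.
  exact/rint_continuous/continuous_within.
rewrite (@eq_Rintegral _ _ _ _ _ (fun=> 0)).
  by rewrite Rintegral_cst// mul0r addr0.
move=> t /set_mem/=; rewrite in_itv/= => /andP[bt _].
by rewrite e0// (ltW bt) orbT.
Qed.

Lemma is_derive_prim e a b : 0 < a -> continuous e -> vanishes_off a b e ->
  forall x, is_derive x (1 : R) (prim e) (e x).
Proof.
move=> a0 ce e0 x; have [x0|x0] := ltP 0 x.
  have x1 : x < x + 1 by rewrite ltrDl.
  have [] := @continuous_FTC1 _ e (BLeft 0) x (x + 1) x1.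
  - exact/rint_continuous/continuous_within.
  - by [].
  - exact: ce.
  move=> h1 h2; apply: DeriveDef; first exact: h1.
  by rewrite -derive1E; exact: h2.
have xa : x < a by exact: le_lt_trans x0 a0.
rewrite e0 ?(ltW xa)//.
have h0 : is_derive x (1 : R) (cst (0 : R)) (0 : R) := is_derive_cst _ _ _.
apply: near_eq_is_derive h0; near=> y.
rewrite (prim_left e0)//; apply: ltW; near: y; exact: lt_nbhsl.
Unshelve. all: by end_near. Qed.

Lemma smooth1_prim e a b : 0 < a -> smooth1 e -> vanishes_off a b e -> smooth1 (prim e).
Proof.
move=> a0 se e0; have ce := smooth1_continuous se.
have h := is_derive_prim a0 ce e0.
apply/smooth1P; split; first by move=> x; case: (h x).
by rewrite (_ : derive1 _ = e)//; apply/funext => x; rewrite derive1E; case: (h x).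
Qed.

Lemma derive1_prim e a b : 0 < a -> continuous e -> vanishes_off a b e ->
  derive1 (prim e) = e.
Proof.
move=> a0 ce e0; apply/funext => x; rewrite derive1E.
by case: (is_derive_prim a0 ce e0 x).
Qed.

(** The vanishing integral is what makes the primitive return to [0] on the right of the support. *)
Lemma test1_prim e : test1 e -> I1 e = 0 -> test1 (prim e).
Proof.
move=> [se [a [b [a0 ab b1 e0]]]] Ie; split; first exact: smooth1_prim e0.
exists a, b; split=> // x /orP[xa|bx]; first exact: prim_left e0 _ _.
have b0 : 0 <= b by rewrite (le_trans (ltW a0)).
have ce := smooth1_continuous se.
rewrite (prim_right b0 ce e0)// -(prim_right b0 ce e0 (ltW b1))//.
Qed.

Lemma is_derive_expn_div (n : nat) (x : R) :
  is_derive x (1 : R) (fun x => x ^+ n.+1 / n.+1%:R) (x ^+ n).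
Proof.
pose q : {poly R} := n.+1%:R^-1 *: 'X^(n.+1).
rewrite (_ : (fun _ => _) = horner q); last first.
  by apply/funext => y; rewrite hornerZ hornerXn mulrC.
rewrite (_ : x ^+ n = (deriv q).[x]); first exact: is_derive_poly.
rewrite derivZ derivXn hornerZ hornerMn hornerXn mulrnAr -mulrnAl -[n.+1%:R^-1 *+ _]mulr_natr.
by rewrite mulVf ?pnatr_eq0// mul1r.
Qed.

Lemma is_derive_taylor_kernel (n : nat) (t x : R) :
  is_derive x (1 : R) (fun x => - ((t - x) ^+ n.+1 / (n.+1)`!%:R)) ((t - x) ^+ n / n`!%:R).
Proof.
pose q : {poly R} := - ((n.+1)`!%:R^-1 *: (t%:P - 'X) ^+ n.+1).
rewrite (_ : (fun _ => _) = horner q); last first.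
  by apply/funext => y; rewrite hornerN hornerZ horner_exp !hornerE mulrC.
rewrite (_ : _ / _ = (deriv q).[x]); first exact: is_derive_poly.
rewrite derivN derivZ deriv_exp derivB derivC derivX sub0r mulN1r mulNrn scalerN opprK.
rewrite hornerZ hornerMn horner_exp !hornerE.
rewrite factS natrM invfM mulrnAr -mulrnAl -mulrnAl -[n.+1%:R^-1 *+ _]mulr_natr.
by rewrite mulVf ?pnatr_eq0// mul1r mulrC.
Qed.

(** Integration by parts against x^(j+1)/(j+1). The boundary terms vanish because the primitive is
    [0] at both ends. *)
Lemma prim_moment e (j : nat) : continuous e -> smooth1 (prim e) ->
  derive1 (prim e) = e -> I1 e = 0 ->
  I1 (fun x => x ^+ j.+1 * e x) = 0 -> I1 (fun x => x ^+ j * prim e x) = 0.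
Proof.
move=> ce sJ dJ Ie me.
have dJ' x : is_derive x (1 : R) (prim e) (e x).
  by apply: DeriveDef; [exact: smooth1_derivable|rewrite -derive1E dJ].
have cp : continuous (fun x : R => x ^+ j) by exact/smooth1_continuous/smooth1_exp.
have := ibp ler01 (is_derive_expn_div j) cp dJ' ce.
rewrite prim0 mulr0 subr0 (_ : prim e 1 = 0)// mulr0 sub0r.
move=> /eqP; rewrite eq_sym eqr_oppLR => /eqP; rewrite -/(I1 _) => ->.
rewrite (_ : (fun _ => _) = (fun x : R => j.+1%:R^-1 * (x ^+ j.+1 * e x))).
  rewrite RintegralZl//; first by rewrite -/(I1 _) me mulr0 oppr0.
  apply/rint_continuous/continuous_within/continuous_mul => //.
  exact/smooth1_continuous/smooth1_exp.
by apply/funext => x; rewrite mulrA [_^-1 * _]mulrC.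
Qed.

(** Each antiderivation uses up one vanishing moment, so [s.+1] moments permit [s.+1]
    antiderivations without leaving the test functions. The closed form is Cauchy's formula for
    repeated integration; through it [A] is later recognized as the adjoint Taylor operator applied
    to [e]. *)
Lemma derive_preimage (s : nat) e : test1 e ->
  (forall j, (j <= s)%N -> I1 (fun x => x ^+ j * e x) = 0) ->
  exists A, [/\ test1 A, iter s.+1 (@derive1 R R) A = e &
    forall t, 0 <= t -> A t = \int[mu]_(x in `[0, t]) ((t - x) ^+ s / s`!%:R * e x)].
Proof.
elim: s e => [|s ih] e te me.
  have Ie : I1 e = 0.
    rewrite -(me 0%N)//; apply: eq_Rintegral => x _; by rewrite expr0 mul1r.
  have [se [a [b [a0 ab b1 e0]]]] := te.
  exists (prim e); split; first exact: test1_prim.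
    exact: (derive1_prim a0 (smooth1_continuous se) e0).
  move=> t _; apply: eq_Rintegral => x _; by rewrite expr0 divr1 mul1r.
have Ie : I1 e = 0.
  rewrite -(me 0%N)//; apply: eq_Rintegral => x _; by rewrite expr0 mul1r.
have tE := test1_prim te Ie.
have [se [a [b [a0 ab b1 e0]]]] := te; have ce := smooth1_continuous se.
have dE := derive1_prim a0 ce e0.
have [|A [tA dA AE]] := ih (prim e) tE.
  move=> j js; apply: prim_moment => //; first by case: tE.
  exact: me.
exists A; split=> //; first by rewrite iterS dA dE.
move=> t t0; rewrite AE//.
have dJ' x : is_derive x (1 : R) (prim e) (e x) by exact: is_derive_prim e0 x.
have cp : continuous (fun x : R => (t - x) ^+ s / s`!%:R).
  apply: continuous_mul; last by move=> x; exact: cvg_cst.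
  have := smooth1_continuous (smooth1_affine (-1) t (smooth1_exp (R := R) s)).
  rewrite (_ : (fun x0 => _) = (fun x0 => (t - x0) ^+ s))//.
  by apply/funext => y; rewrite mulN1r addrC.
(* Both boundary terms vanish: the kernel is [0] at [x = t] and [prim e] is [0] at [0]. *)
have := ibp t0 (is_derive_taylor_kernel s t) cp dJ' ce.
rewrite prim0 mulr0 subr0 subrr expr0n mul0r oppr0 mul0r sub0r.
move=> /eqP; rewrite eq_sym eqr_oppLR => /eqP ->.
rewrite -mulN1r -RintegralZl//.
  apply: eq_Rintegral => x _; by rewrite !mulNr mul1r opprK.
apply/rint_continuous/continuous_within/continuous_mul => //.
move=> x; apply: differentiable_continuous; apply/derivable1_diffP.
by case: (is_derive_taylor_kernel s t x).
Qed.

End UnitInterval.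

(** * Smooth cutoffs that converge to the indicator of an interval *)

Section Cutoff.
Local Open Scope classical_set_scope.
Context {R : realType}.
Implicit Types f g F G e V : R -> R.
Local Notation mu := (@lebesgue_measure R).
Local Notation I01 := (`[0, 1]%classic : set R).

(** The primitive of [f] lies between [0] and the total integral [0], so it is constant on the
    interval and its derivative [f x] vanishes. *)
Lemma continuous_ge0_I1_eq0 f : continuous f -> (forall x, 0 <= x <= 1 -> 0 <= f x) ->
  I1 f = 0 -> forall x, 0 < x < 1 -> f x = 0.
Proof.
move=> cf f0 If x /andP[x0 x1].
have fi (b : R) : rint mu `[0, b] f by exact/rint_continuous/continuous_within.
have P0 y : 0 <= y -> y <= 1 -> prim f y = 0.
  move=> y0 y1; apply/eqP; rewrite eq_le; apply/andP; split; last first.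
    apply: Rintegral_ge0 => t /=; rewrite in_itv/= => /andP[t0 ty].
    by rewrite f0// t0 (le_trans ty).
  rewrite -[leRHS]If -[I1 f]/(prim f 1) (prim_addl y0 y1)// lerDl.
  apply: Rintegral_ge0 => t /=; rewrite in_itv/= => /andP[t0 ty].
  by rewrite f0// ty (le_trans y0)// ltW.
have [||_ h] := @continuous_FTC1 _ f (BLeft 0) x 1 x1 (fi 1); [by []|exact: cf|].
rewrite -h derive1E (_ : (fun _ => _) = prim f)//.
rewrite (@near_eq_derive _ _ _ (prim f) (cst 0)); first by rewrite derive_cst.
near=> y; rewrite P0//.
  by apply/ltW; near: y; exact: lt_nbhsr.
by apply/ltW; near: y; exact: lt_nbhsl.
Unshelve. all: by end_near. Qed.

Lemma I1_bump_gt0 (c d : R) : 0 <= c -> c < d -> d <= 1 -> 0 < I1 (bump c d).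
Proof.
move=> c0 cd d1; rewrite lt_neqAle; apply/andP; split; last first.
  by apply: Rintegral_ge0 => x _; exact: bump_ge0.
apply/eqP => /esym h.
have cb : continuous (bump c d) by exact/smooth1_continuous/smooth1_bump.
have := @continuous_ge0_I1_eq0 _ cb (fun x _ => bump_ge0 c d x) h ((c + d) / 2).
have h1 : c < (c + d) / 2 < d by rewrite !midf_lt.
have /andP[h2 h3] := h1.
rewrite (le_lt_trans c0 h2) (lt_le_trans h3 d1) => /(_ isT) h4.
by have := bump_gt0 h1; rewrite h4 ltxx.
Qed.

Definition nbump (c d x : R) := (I1 (bump c d))^-1 * bump c d x.

Lemma smooth1_nbump c d : smooth1 (nbump c d).
Proof. by apply: (@smooth1M _ (fun=> _)); [exact: smooth1_cst|exact: smooth1_bump]. Qed.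

Lemma nbump_off c d : vanishes_off c d (nbump c d).
Proof. by move=> x h; rewrite /nbump bump_eq0// mulr0. Qed.

Lemma I1Z (c : R) f : rint mu I01 f -> I1 (fun x => c * f x) = c * I1 f.
Proof. by move=> fi; rewrite /I1 RintegralZl. Qed.

Section Nbump.
Variables (c d : R).
Hypotheses (c0 : 0 < c) (cd : c < d) (d1 : d <= 1).

Let b0 : 0 < I1 (bump c d).
Proof. by apply: I1_bump_gt0 => //; exact: ltW. Qed.

Lemma nbump_ge0 x : 0 <= nbump c d x.
Proof. by rewrite mulr_ge0 ?bump_ge0// invr_ge0 ltW. Qed.

Lemma I1_nbump : I1 (nbump c d) = 1.
Proof.
rewrite I1Z ?mulVf ?gt_eqF//.
exact/rint_smooth1/smooth1_bump.
Qed.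

Lemma prim_nbump_right x : d <= x -> prim (nbump c d) x = 1.
Proof.
move=> dx; have cn := smooth1_continuous (smooth1_nbump c d).
have d0 : 0 <= d by rewrite ltW// (lt_trans c0).
rewrite (prim_right d0 cn (@nbump_off c d) dx).
rewrite -(prim_right d0 cn (@nbump_off c d) d1); exact: I1_nbump.
Qed.

Lemma prim_nbump_01 x : 0 <= prim (nbump c d) x <= 1.
Proof.
apply/andP; split; first by apply: Rintegral_ge0 => t _; exact: nbump_ge0.
have [xc|cx] := leP x c; first by rewrite (prim_left (@nbump_off c d) xc).
have [dx|xd] := leP d x; first by rewrite prim_nbump_right.
have x0 := ltW (lt_trans c0 cx).
rewrite -(prim_nbump_right (lexx d)) (prim_addl x0 (ltW xd)).
  by rewrite lerDl; apply: Rintegral_ge0 => t _; exact: nbump_ge0.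
exact/rint_smooth1/smooth1_nbump.
Qed.

(** [nbump c d] is a probability density concentrated on [c, d], hence an average of [V] deviates
    from [v] by no more than [V] does there. *)
Lemma nbump_mean V (v eps : R) : {within I01, continuous V} ->
  (forall x, c <= x <= d -> `|V x - v| <= eps) ->
  `|I1 (fun x => V x * nbump c d x) - v| <= eps.
Proof.
move=> cV hV.
have ni : rint mu I01 (nbump c d) by exact/rint_smooth1/smooth1_nbump.
have Vni : rint mu I01 (fun x => V x * nbump c d x).
  by apply/rint_continuous/within_continuousM => //;
    exact/continuous_within/smooth1_continuous/smooth1_nbump.
have vE : I1 (fun x => v * nbump c d x) = v by rewrite I1Z// I1_nbump mulr1.
rewrite -[X in _ - X]vE /I1 -RintegralB//; last exact: rintZ.
have Bi : rint mu I01 (fun x => V x * nbump c d x - v * nbump c d x).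
  by apply: (rintB _ Vni) => //; exact: rintZ.
rewrite (le_trans (le_normr_Rintegral _ Bi))//.
have epsE : I1 (fun x => eps * nbump c d x) = eps by rewrite I1Z// I1_nbump mulr1.
rewrite -[leRHS]epsE; apply: le_Rintegral => //; [exact: integrable_norm|exact: rintZ|].
move=> x _; rewrite -mulrBl normrM (ger0_norm (nbump_ge0 x)).
have [/andP[cx xd]|] := boolP (c <= x <= d).
  by rewrite ler_wpM2r ?nbump_ge0// hV// cx.
rewrite negb_and -!ltNge => /orP[h|h].
  by rewrite nbump_off ?mulr0// ltW.
by rewrite nbump_off ?mulr0// (ltW h) orbT.
Qed.

End Nbump.

Lemma derive1_prim_nbump c d : 0 < c -> derive1 (prim (nbump c d)) = nbump c d.
Proof.
move=> c0; exact: (derive1_prim c0 (smooth1_continuous (smooth1_nbump c d)) (@nbump_off c d)).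
Qed.

Lemma smooth1_prim_nbump c d : 0 < c -> smooth1 (prim (nbump c d)).
Proof. by move=> c0; exact: smooth1_prim c0 (smooth1_nbump c d) (@nbump_off c d). Qed.

(** [eta n] is a smooth step near [a] minus a smooth step near [b]. Its derivative is a difference
    of two bumps of unit mass that concentrate at [a] and [b], whence the last limit, the source of
    all boundary terms. *)
Lemma cutoff_seq (a b : R) : 0 <= a -> a < b -> b <= 1 ->
  exists eta : nat -> R -> R, [/\ forall n, test1 (eta n),
    forall n x, 0 <= eta n x <= 1,
    forall x, eta n x @[n --> \oo] --> ((if a < x < b then 1 else 0) : R) &
    forall V, {within I01, continuous V} ->
      I1 (fun x => V x * derive1 (eta n) x) @[n --> \oo] --> V a - V b].
Proof.
move=> a0 ab b1.
(* The shift by 3 keeps the width below a third of b - a, so that the ascent ends at [c2 n] before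
   the descent starts at [c3 n]. *)
pose h n : R := (b - a) / n.+3%:R.
have h0 n : 0 < h n by rewrite divr_gt0// subr_gt0.
have hc : h n @[n --> \oo] --> 0.
  rewrite -(mulr0 (b - a)); apply: cvgM; first exact: cvg_cst.
  by apply/gtr0_cvgV0; [near=> n; rewrite ltr0n|
    apply: (cvg_comp (addn 3) _ (cvg_addnl 3)); exact: cvgr_idn].
have hle n : h n <= (b - a) / 3.
  by rewrite ler_pM2l ?subr_gt0// lef_pV2 ?posrE ?ltr0n// ler_nat.
pose c1 n := a + h n / 2; pose c2 n := a + h n.
pose c3 n := b - h n; pose c4 n := b - h n / 2.
have c10 n : 0 < c1 n by have := h0 n; rewrite /c1; lra.
have c12 n : c1 n < c2 n by have := h0 n; rewrite /c1 /c2; lra.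
have c23 n : c2 n < c3 n by have := hle n; have := h0 n; rewrite /c2 /c3; lra.
have c34 n : c3 n < c4 n by have := h0 n; rewrite /c3 /c4; lra.
have c41 n : c4 n < 1 by have := h0 n; rewrite /c4; lra.
have c30 n : 0 < c3 n by rewrite (lt_trans (c10 n))// (lt_trans (c12 n)).
have c21 n : c2 n <= 1 by rewrite ltW// (lt_trans (c23 n))// (lt_trans (c34 n)).
pose eta n x := prim (nbump (c1 n) (c2 n)) x - prim (nbump (c3 n) (c4 n)) x.
have etaE n x : eta n x = if x <= c3 n then prim (nbump (c1 n) (c2 n)) x
   else 1 - prim (nbump (c3 n) (c4 n)) x.
  rewrite /eta; case: leP => [xc|cx].
    by rewrite (prim_left (@nbump_off _ _ ) xc) subr0.
  by rewrite prim_nbump_right// ltW// (lt_trans (c23 n)).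
have eta01 n x : 0 <= eta n x <= 1.
  rewrite etaE; case: ifP => _; first exact: prim_nbump_01.
  by have /andP[? ?] := prim_nbump_01 (c30 n) (c34 n) (ltW (c41 n)) x; apply/andP; split; lra.
have deta n : derive1 (eta n) = nbump (c1 n) (c2 n) \- nbump (c3 n) (c4 n).
  apply/funext => x; rewrite derive1E deriveB; last 2 first.
  - exact/smooth1_derivable/smooth1_prim_nbump.
  - exact/smooth1_derivable/smooth1_prim_nbump.
  have dn c d : 0 < c -> 'D_1 (prim (nbump c d)) x = nbump c d x.
    by move=> c0; rewrite -derive1E derive1_prim_nbump.
  exact: (congr2 (fun s t => s - t) (dn _ _ (c10 n)) (dn _ _ (c30 n))).
exists eta; split => //.
- move=> n; split.
    rewrite (_ : eta n = prim (nbump (c1 n) (c2 n)) \+ ((fun=> -1) \* prim (nbump (c3 n) (c4 n)))).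
      apply: smooth1D; first exact: smooth1_prim_nbump.
      by apply: smooth1M; [exact: smooth1_cst|exact: smooth1_prim_nbump].
    by apply/funext => x; rewrite /eta /= mulN1r.
  exists (c1 n), (c4 n); split=> //.
    by rewrite ltW// (lt_trans (c12 n))// (lt_trans (c23 n)).
  move=> x /orP[xc|cx].
    rewrite /eta (prim_left (@nbump_off _ _ ) xc) (prim_left (@nbump_off _ _ )) ?subr0//.
    by rewrite (le_trans xc)// ltW// (lt_trans (c12 n)).
  rewrite /eta !prim_nbump_right ?subrr//; first exact: ltW.
  by rewrite (le_trans _ cx)// ltW// (lt_trans (c23 n)).
- move=> x; case: ifP => [/andP[ax xb]|].
    apply: cvg_near_cst; near=> n.
    have hx : h n < Num.min (x - a) (b - x).
      by near: n; apply: (cvgr_lt _ hc); rewrite lt_min !subr_gt0 ax.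
    move: hx; rewrite lt_min => /andP[h1 h2].
    rewrite etaE ifT; last by rewrite /c3; lra.
    by rewrite prim_nbump_right//; rewrite /c2; lra.
  move=> /negbT; rewrite negb_and -!leNgt => /orP[xa|bx].
    apply: cvg_near_cst; near=> n.
    have xc : x <= c1 n by rewrite (le_trans xa)// /c1; have := h0 n; lra.
    rewrite /eta (prim_left (@nbump_off _ _ ) xc) (prim_left (@nbump_off _ _ )) ?subr0//.
    by rewrite (le_trans xc)// ltW// (lt_trans (c12 n)).
  apply: cvg_near_cst; near=> n.
  have cx : c4 n <= x by rewrite (le_trans _ bx)// /c4; have := h0 n; lra.
  rewrite /eta !prim_nbump_right ?subrr//; first exact: ltW.
  by rewrite (le_trans _ cx)// ltW// (lt_trans (c23 n)).
- move=> V cV.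
  rewrite (_ : (fun n => _) = (fun n => I1 (fun x => V x * nbump (c1 n) (c2 n) x) -
      I1 (fun x => V x * nbump (c3 n) (c4 n) x))); last first.
    apply/funext => n; rewrite deta /I1 -RintegralB//.
    + by apply: eq_Rintegral => x _; rewrite /= mulrBr.
    + by apply/rint_continuous/within_continuousM => //;
        exact/continuous_within/smooth1_continuous/smooth1_nbump.
    + by apply/rint_continuous/within_continuousM => //;
        exact/continuous_within/smooth1_continuous/smooth1_nbump.
  have Vat (v : R) : 0 <= v <= 1 -> forall e : R, 0 < e -> exists2 del, 0 < del &
      forall x, 0 <= x <= 1 -> `|x - v| <= del -> `|V x - V v| <= e.
    move=> v01 e e0; have /subspace_continuousP/(_ v) := cV.
    rewrite /= in_itv/= => /(_ v01)/cvgrPdist_le/(_ _ e0).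
    rewrite near_withinE /= => -[del /= del0 hdel]; exists (del / 2); first exact: divr_gt0.
    move=> x x01 xv; rewrite distrC; apply: hdel; last by rewrite /= in_itv.
    by rewrite /ball/= distrC (le_lt_trans xv)//; lra.
  apply: cvgB.
    apply/cvgrPdist_le => e e0.
    have [|del del0 hdel] := Vat a _ _ e0; first by rewrite a0 (le_trans (ltW ab)).
    near=> n; rewrite distrC; apply: nbump_mean => // x /andP[cx xc].
    have hn : h n <= del by near: n; exact: (cvgr_le _ hc).
    have := h0 n; move: cx xc; rewrite /c1 /c2 => cx xc hn0; have := hle n => hn1.
    apply: hdel; first by apply/andP; split; lra.
    by rewrite ger0_norm; lra.
  apply/cvgrPdist_le => e e0.
  have [|del del0 hdel] := Vat b _ _ e0; first by rewrite b1 (le_trans a0)// ltW.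
  near=> n; rewrite distrC; apply: nbump_mean => //; first exact: ltW.
  move=> x /andP[cx xc].
  have hn : h n <= del by near: n; exact: (cvgr_le _ hc).
  have := h0 n; move: cx xc; rewrite /c3 /c4 => cx xc hn0; have := hle n => hn1.
  apply: hdel; first by apply/andP; split; lra.
  by rewrite ler0_norm; lra.
Unshelve. all: by end_near. Qed.

End Cutoff.

(** Operators and estimates in [y] are obtained from those in [x] by conjugation with this
    exchange. *)
Definition swapxy {T : Type} (z : T * T) : T * T := (z.2, z.1).

(** * Integration on the reference square *)

Section FubiniK.
Local Open Scope classical_set_scope.
Context {R : realType}.
Local Notation mu := (@lebesgue_measure R).
Local Notation MR := (measurableTypeR R).
Local Notation I01 := (`[0, 1]%classic : set MR).

Local Notation plane := (MR * MR)%type.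
Implicit Types F : plane -> R.

Lemma measurable_Khat : measurable (@Khat R : set plane).
Proof. exact: measurableX. Qed.
Hint Resolve measurable_Khat : core.

Lemma leb2_Khat : leb2 (@Khat R) = 1%E.
have h : leb2 (@Khat R) = (mu I01 * mu I01)%E.
  exact: (@product_measure1E _ _ _ _ R mu mu I01 I01 (measurable_itv _) (measurable_itv _)).
by rewrite h !lebesgue_I01 mule1.
Qed.

Lemma in_Khat (x y : R) : ((x, y) \in (@Khat R)) = (x \in I01) && (y \in I01).
Proof. by rewrite in_setX. Qed.

Lemma swap_Khat (z : plane) : Khat (swapxy z) <-> Khat z.
Proof. by case: z => x y; split=> -[]. Qed.

Lemma measurable_restrictK (F : plane -> \bar R) : measurable_fun (@Khat R : set plane) F ->
  measurable_fun setT (F \_ (@Khat R)).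
Proof. by move/(measurable_restrictT F measurable_Khat). Qed.

Lemma ge0_integralK12 (F : plane -> \bar R) : measurable_fun (@Khat R : set plane) F ->
  (forall z, Khat z -> (0 <= F z)%E) ->
  (\int[leb2]_(z in Khat) F z = \int[mu]_(x in I01) \int[mu]_(y in I01) F (x, y))%E.
Proof.
move=> mF F0; rewrite integral_mkcond.
rewrite (@fubini_tonelli1 _ _ _ _ _ mu mu (F \_ Khat)); last 2 first.
- exact: measurable_restrictK.
- by move=> z; rewrite patchE; case: ifPn => // /set_mem/F0.
rewrite [RHS]integral_mkcond; apply: eq_integral => x _.
rewrite /fubini_F patchE; case: ifPn => xI.
  rewrite [RHS]integral_mkcond; apply: eq_integral => y _.
  by rewrite !patchE in_Khat xI.
by rewrite integral0_eq// => y _; rewrite patchE in_Khat (negbTE xI).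
Qed.

Lemma ge0_integralK21 (F : plane -> \bar R) : measurable_fun (@Khat R : set plane) F ->
  (forall z, Khat z -> (0 <= F z)%E) ->
  (\int[leb2]_(z in Khat) F z = \int[mu]_(y in I01) \int[mu]_(x in I01) F (x, y))%E.
Proof.
move=> mF F0; rewrite integral_mkcond.
rewrite (@fubini_tonelli2 _ _ _ _ _ mu mu (F \_ Khat)); last 2 first.
- exact: measurable_restrictK.
- by move=> z; rewrite patchE; case: ifPn => // /set_mem/F0.
rewrite [RHS]integral_mkcond; apply: eq_integral => y _.
rewrite /fubini_G patchE; case: ifPn => yI.
  rewrite [RHS]integral_mkcond; apply: eq_integral => x _.
  by rewrite !patchE in_Khat yI andbT.
by rewrite integral0_eq// => x _; rewrite patchE in_Khat (negbTE yI) andbF.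
Qed.

Lemma measurable_swapK (rT : Type) d' (T' : measurableType d') (F : plane -> T') :
  measurable_fun (@Khat R : set plane) F -> measurable_fun (@Khat R : set plane) (F \o swapxy).
Proof.
move=> mF; apply: (measurable_comp measurable_Khat _ mF).
  by move=> _ [z /swap_Khat ? <-].
by apply: measurable_funTS; exact: measurable_swap.
Qed.

Lemma ge0_integral_swap (F : plane -> \bar R) : measurable_fun (@Khat R : set plane) F ->
  (forall z, Khat z -> (0 <= F z)%E) ->
  (\int[leb2]_(z in Khat) F (swapxy z) = \int[leb2]_(z in Khat) F z)%E.
Proof.
move=> mF F0; rewrite [RHS]ge0_integralK21// ge0_integralK12//.
  by apply: (measurable_swapK R mF).
by move=> z /swap_Khat; exact: F0.
Qed.

(** Fubini's theorem delivers inner integrals that are finite only almost everywhere. On the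
    exceptional null set [fine] substitutes [0], which leaves the outer integral unchanged. *)
Lemma fine_I1 (H : MR -> \bar R) : mu.-integrable setT (H \_ I01) ->
  rint mu I01 (fine \o H) /\ fine (\int[mu]_x (H \_ I01) x)%E = I1 (fine \o H).
Proof.
have mI : @measurable _ MR I01 by exact: measurable_itv.
move=> Hi'; have Hi := (@integrable_mkcond _ _ R mu I01 H mI).2 Hi'.
have mH := measurable_int _ Hi.
have mfH : measurable_fun I01 (EFin \o (fine \o H)).
  by apply/measurable_EFinP; exact: measurableT_comp.
have ae : ae_eq mu I01 H (EFin \o (fine \o H)).
  have := integrable_ae mI Hi; apply: filterS => x h xI.
  by rewrite /= fineK// h.
split; last by rewrite -integral_mkcond /I1 /Rintegral; congr fine; exact: ae_eq_integral.
apply/integrableP; split=> //.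
have /integrableP[_] := Hi; apply: le_lt_trans; rewrite le_eqVlt; apply/orP; left.
apply/eqP/esym/ae_eq_integral => //; [exact: measurableT_comp|exact: measurableT_comp|].
by move: ae; apply: filterS => x h xI; rewrite /= h.
Qed.

Lemma fubiniK F : rint leb2 Khat F ->
  [/\ rint mu I01 (fun x => I1 (fun y => F (x, y))),
      rint mu I01 (fun y => I1 (fun x => F (x, y))),
      intK F = I1 (fun x => I1 (fun y => F (x, y))) &
      intK F = I1 (fun y => I1 (fun x => F (x, y)))].
Proof.
move=> Fi; have Fi' : leb2.-integrable setT (EFin \o (F \_ Khat)).
  rewrite (_ : _ \o _ = (EFin \o F) \_ Khat); first exact: (integrable_mkcond _ measurable_Khat).1 Fi.
  by rewrite restrict_EFin.
have FE (x : MR) : (fubini_F mu (EFin \o (F \_ Khat)) x =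
    ((fun x => \int[mu]_(y in I01) (F (x, y))%:E) \_ I01) x)%E.
  rewrite /fubini_F patchE; case: ifPn => xI.
    rewrite [RHS]integral_mkcond; apply: eq_integral => y _.
    by rewrite /= !patchE in_Khat xI/=; case: ifP.
  by rewrite integral0_eq// => y _; rewrite /= patchE in_Khat (negbTE xI).
have GE (y : MR) : (fubini_G mu (EFin \o (F \_ Khat)) y =
    ((fun y => \int[mu]_(x in I01) (F (x, y))%:E) \_ I01) y)%E.
  rewrite /fubini_G patchE; case: ifPn => yI.
    rewrite [RHS]integral_mkcond; apply: eq_integral => x _.
    by rewrite /= !patchE in_Khat yI andbT/=; case: ifP.
  by rewrite integral0_eq// => x _; rewrite /= patchE in_Khat (negbTE yI) andbF.
have F1 := integrable_fubini_F Fi'; have F2 := integral12_prod_meas1 Fi'.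
have mF' := measurable_int _ Fi'.
(* The modulus of this partial integral is dominated by the partial integral of the modulus, whose
   integral is finite by Tonelli's theorem. *)
have G1 : mu.-integrable setT (fubini_G mu (EFin \o (F \_ Khat))).
  apply/integrableP; split; first exact: (measurable_fubini_G Fi').
  have := (integrable21ltyP mu mu mF').1 Fi'; apply: le_lt_trans.
  apply: ge0_le_integral => //.
  - by apply: measurableT_comp => //; exact: (measurable_fubini_G Fi').
  - have mA : measurable_fun setT (abse \o (EFin \o (F \_ Khat)) : plane -> \bar R).
      exact: measurableT_comp (@abse_measurable R setT) mF'.
    exact: (@measurable_fun_fubini_tonelli_G _ _ _ _ _ mu (abse \o (EFin \o (F \_ Khat)))
       mA (fun=> abse_ge0 _)).
  - move=> y _; apply: le_abse_integral => //.
    exact: (measurable_fun_pair1 y mF').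
have G2 := integral21_prod_meas1 Fi'.
set HF := (fun x : MR => \int[mu]_(y in I01) (F (x, y))%:E)%E in FE.
set HG := (fun y : MR => \int[mu]_(x in I01) (F (x, y))%:E)%E in GE.
have F1' : mu.-integrable setT (HF \_ I01).
  by rewrite (_ : _ \_ _ = fubini_F mu (EFin \o (F \_ Khat)))//; apply/funext => x; rewrite FE.
have G1' : mu.-integrable setT (HG \_ I01).
  by rewrite (_ : _ \_ _ = fubini_G mu (EFin \o (F \_ Khat)))//; apply/funext => x; rewrite GE.
have F2' : (\int[mu]_x (HF \_ I01) x = \int[leb2]_z (EFin \o (F \_ Khat)) z)%E.
  by rewrite -[RHS]F2; apply: eq_integral => x _; rewrite -FE.
have G2' : (\int[mu]_x (HG \_ I01) x = \int[leb2]_z (EFin \o (F \_ Khat)) z)%E.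
  by rewrite -[RHS]G2; apply: eq_integral => x _; rewrite -GE.
have [F3 F4] := fine_I1 F1'; have [G3 G4] := fine_I1 G1'.
have E : intK F = fine (\int[leb2]_z (EFin \o (F \_ Khat)) z)%E.
  by rewrite /intK Rintegral_mkcond.
split; [exact: F3|exact: G3|rewrite E -F2'; exact: F4|rewrite E -G2'; exact: G4].
Qed.

Lemma ae_rintK F : rint leb2 Khat F ->
  {ae mu, forall y, I01 y -> rint mu I01 (fun x => F (x, y))}.
Proof.
move=> Fi; have Fi' : leb2.-integrable setT (EFin \o (F \_ Khat)).
  rewrite (_ : _ \o _ = (EFin \o F) \_ Khat); first exact: (integrable_mkcond _ measurable_Khat).1 Fi.
  by rewrite restrict_EFin.
apply: filterS (ae_integrable2 Fi') => y h yI.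
apply/integrable_mkcond => //; move: h; congr (integrable mu setT).
apply/funext => x; rewrite /= !patchE in_Khat (mem_set yI) andbT.
by case: ifP.
Qed.

Lemma rint_swap F : rint leb2 Khat F -> rint leb2 Khat (F \o swapxy).
Proof.
move=> /integrableP[mF iF]; apply/integrableP; split.
  exact: (measurable_swapK R mF).
have mA : measurable_fun (@Khat R : set plane) (abse \o (EFin \o F)) by exact: measurableT_comp.
by move: iF; have <- := ge0_integral_swap mA (fun z _ => abse_ge0 _).
Qed.

Lemma intK_swap F : rint leb2 Khat F -> intK (F \o swapxy) = intK F.
Proof.
move=> Fi; have [_ _ _ ->] := fubiniK Fi.
by have [_ _ -> _] := fubiniK (rint_swap Fi).
Qed.

End FubiniK.
#[export] Hint Resolve measurable_Khat : core.

(** * Estimates for L^p norms over a measurable set *)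

Section Lp.
Local Open Scope classical_set_scope.
Context d (T : measurableType d) (R : realType) (mu : {measure set T -> \bar R}).
Variables (D : set T) (mD : measurable D) (p : R) (hp : 1 <= p).
Implicit Types f g : T -> R.

Let p0 : 0 < p. Proof. exact: lt_le_trans hp. Qed.

Lemma measurable_powRn f : measurable_fun D f ->
  measurable_fun D (fun x => (`|f x| `^ p)%:E).
Proof.
move=> mf; apply/measurable_EFinP/(measurableT_comp (measurable_powR p)).
exact: measurableT_comp.
Qed.

Lemma LnormE (r : R) f : 0 < r -> Lnorm mu r%:E (EFin \o (f \_ D)) =
  ((\int[mu]_(x in D) (`|f x| `^ r)%:E) `^ (r^-1))%E.
Proof.
move=> r0; rewrite unlock /Lnorm; apply: (congr1 (fun t => t `^ r^-1)%E).
rewrite [RHS]integral_mkcond; apply: eq_integral => x _.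
rewrite /= !patchE; case: ifPn => // _.
by rewrite normr0 powR0// gt_eqF.
Qed.

Lemma poweR_invK (x : \bar R) : (0 <= x)%E -> ((x `^ (p^-1)) `^ p = x)%E.
Proof. by move=> x0; rewrite -poweRrM mulVf ?poweRe1// gt_eqF. Qed.

Lemma poweRK_inv (x : \bar R) : (0 <= x)%E -> ((x `^ p) `^ (p^-1) = x)%E.
Proof. by move=> x0; rewrite -poweRrM mulfV ?poweRe1// gt_eqF. Qed.

Lemma le_poweR (x y : \bar R) (r : R) : 0 <= r -> (0 <= x)%E -> (x <= y)%E ->
  (x `^ r <= y `^ r)%E.
Proof.
move=> r0 x0 xy; apply: gt0_ler_poweR => //; rewrite ?in_itv/= ?leey ?andbT//.
exact: le_trans xy.
Qed.

Lemma integral_powRn_ge0 f : (0 <= \int[mu]_(x in D) (`|f x| `^ p)%:E)%E.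
Proof. by apply: integral_ge0 => x _; rewrite lee_fin powR_ge0. Qed.

(** Hölder's inequality against the constant 1 on a set of measure 1. The case p = 1 is separate
    because the conjugate exponent p/(p-1) is then not finite. *)
Lemma integral_norm_le_Lp f : mu D = 1%E -> measurable_fun D f ->
  (\int[mu]_(x in D) `|f x|%:E <= (\int[mu]_(x in D) (`|f x| `^ p)%:E) `^ (p^-1))%E.
Proof.
move=> muD mf; move: hp; rewrite le_eqVlt => /predU1P[<-|p1].
  rewrite invr1 poweRe1; last by apply: integral_ge0 => x _; rewrite lee_fin powR_ge0.
  rewrite le_eqVlt; apply/orP; left; apply/eqP; apply: eq_integral => x _.
  by rewrite powRr1.
pose q := p / (p - 1).
have q0 : 0 < q by rewrite divr_gt0// subr_gt0.
have pq : p^-1 + q^-1 = 1.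
  rewrite /q invf_div -{1}(mul1r p^-1) -mulrDl addrC subrK mulfV// gt_eqF//.
have mfD := (measurable_restrictT f mD).1 mf.
have m1D : measurable_fun [set: T] ((cst 1 : T -> R) \_ D).
  exact: (measurable_restrictT _ mD).1 (measurable_cst _).
have := hoelder mu mfD m1D p0 q0 pq.
rewrite !LnormE// /cst normr1 powR1 integral_cst// muD mule1 poweR1r mule1.
apply: le_trans; rewrite Lnorm1 integral_mkcond le_eqVlt; apply/orP; left.
apply/eqP; apply: eq_integral => x _; rewrite /= !patchE.
by case: ifPn => _; rewrite ?mulr1// mul0r normr0.
Qed.

Lemma le_Lnorm f g (M : R) : 0 <= M ->
  (\int[mu]_(x in D) (`|f x| `^ p)%:E <= (M `^ p)%:E * \int[mu]_(x in D) (`|g x| `^ p)%:E)%E ->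
  (Lnorm mu p%:E (EFin \o (f \_ D)) <= M%:E * Lnorm mu p%:E (EFin \o (g \_ D)))%E.
Proof.
move=> M0 h; rewrite !LnormE//.
rewrite -[M%:E](@poweRK_inv)// poweR_EFin -poweRM ?lee_fin ?powR_ge0 ?integral_powRn_ge0//.
by apply: le_poweR => //; [rewrite invr_ge0 ltW|exact: integral_powRn_ge0].
Qed.

Lemma le_Lnorm_pointwise f g (M : R) : 0 <= M ->
  measurable_fun D f -> measurable_fun D g -> (forall x, D x -> `|f x| <= M * `|g x|) ->
  (Lnorm mu p%:E (EFin \o (f \_ D)) <= M%:E * Lnorm mu p%:E (EFin \o (g \_ D)))%E.
Proof.
move=> M0 mf mg fg; apply: le_Lnorm => //.
rewrite -ge0_integralZl//; [|exact: measurable_powRn|].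
- apply: ge0_le_integral => //.
  + exact: measurable_powRn.
  + by apply: measurable_funeM; exact: measurable_powRn.
  + move=> x Dx; rewrite -EFinM lee_fin -powRM// ge0_ler_powR ?nnegrE ?mulr_ge0//; first exact: ltW.
    exact: fg.
- by rewrite lee_fin powR_ge0.
Qed.

Lemma Lnorm_ae f g : measurable_fun D f -> measurable_fun D g ->
  {ae mu, forall x, D x -> f x = g x} ->
  Lnorm mu p%:E (EFin \o (f \_ D)) = Lnorm mu p%:E (EFin \o (g \_ D)).
Proof.
move=> mf mg fg.
rewrite (LnormE f p0) (LnormE g p0); apply: (congr1 (fun t => t `^ p^-1)%E).
apply: ae_eq_integral => //; [exact: measurable_powRn|exact: measurable_powRn|].
by move: fg; apply: filterS => x h /h ->.
Qed.

Lemma Lnorm_triangle f g : measurable_fun D f -> measurable_fun D g ->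
  (Lnorm mu p%:E (EFin \o ((f \+ g)%R \_ D)) <=
   Lnorm mu p%:E (EFin \o (f \_ D)) + Lnorm mu p%:E (EFin \o (g \_ D)))%E.
Proof.
move=> mf mg; rewrite (_ : (f \+ g) \_ D = f \_ D \+ g \_ D).
  by apply: minkowski_EFin => //; apply: (measurable_restrictT _ mD).1.
by apply/funext => x; rewrite /= !patchE; case: ifP => //; rewrite addr0.
Qed.

Lemma rint_Lp f : mu D = 1%E -> measurable_fun D f ->
  (Lnorm mu p%:E (EFin \o (f \_ D)) < +oo)%E -> rint mu D f.
Proof.
move=> muD mf fp; apply/integrableP; split; first exact/measurable_EFinP.
by rewrite (le_lt_trans (integral_norm_le_Lp muD mf))// -LnormE.
Qed.

End Lp.

(** * Integral operators acting on the first variable, and their adjoints *)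

Section IntegralOperator.
Local Open Scope classical_set_scope.
Context {R : realType}.
Local Notation mu := (@lebesgue_measure R).
Local Notation MR := (measurableTypeR R).
Local Notation I01 := (`[0, 1]%classic : set MR).
Local Notation plane := (MR * MR)%type.
Local Notation K := (@Khat R : set plane).
Implicit Types (F G f g kappa : plane -> R) (a b : R -> R).

Lemma measurable_I01 : measurable I01.
Proof. exact: measurable_itv. Qed.
Hint Resolve measurable_I01 : core.

Lemma measurable_normEFin d (T : measurableType d) (D : set T) (f : T -> R) :
  measurable_fun D f -> measurable_fun D (fun x => `|f x|%:E).
Proof. by move=> mf; apply/measurable_EFinP; exact: measurableT_comp. Qed.

Lemma lebesgue_MI01 : mu I01 = 1%E.
Proof. exact: lebesgue_I01. Qed.

Lemma lebesgue_MI01_lty : (mu I01 < +oo)%E.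
Proof. by rewrite lebesgue_MI01 ltry. Qed.

Lemma integral_I01_cst (c : \bar R) : (\int[mu]_(x in I01) c = c)%E.
Proof.
transitivity (c * mu I01)%E; first exact: (integral_cst mu measurable_I01 c).
by rewrite lebesgue_MI01 mule1.
Qed.

Lemma I1_cst (c : R) : I1 (fun=> c) = c.
Proof. exact: (congr1 fine (integral_I01_cst c%:E)). Qed.

Lemma leb2_Khat_lty : (leb2 K < +oo)%E.
Proof. by rewrite leb2_Khat ltry. Qed.

Lemma measurable_fstK (f : MR -> R) : measurable_fun I01 f -> measurable_fun K (fun z => f z.1).
Proof.
move=> mf; apply: (@measurable_comp _ _ _ _ _ _ I01 f _ (@fst MR MR)) => //.
  by move=> _ [z [? ?] <-].
by apply: measurable_funTS; exact: measurable_fst.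
Qed.

Lemma measurable_sndK (f : MR -> R) : measurable_fun I01 f -> measurable_fun K (fun z => f z.2).
Proof.
move=> mf; apply: (@measurable_comp _ _ _ _ _ _ I01 f _ (@snd MR MR)) => //.
  by move=> _ [z [? ?] <-].
by apply: measurable_funTS; exact: measurable_snd.
Qed.

Lemma measurable_sliceK1 F (y : R) : measurable_fun K F -> I01 y ->
  measurable_fun I01 (fun x : MR => F (x, y)).
Proof.
move=> mF yI; have mF' := (measurable_restrictT F (measurable_Khat (R := R))).1 mF.
have := measurable_funTS (D := I01) (measurable_fun_pair1 y mF').
apply: eq_measurable_fun => x xI; rewrite patchE in_Khat xI.
by rewrite (mem_set yI).
Qed.

Lemma measurable_sliceK2 F (x : R) : measurable_fun K F -> I01 x ->
  measurable_fun I01 (fun y : MR => F (x, y)).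
Proof.
move=> mF xI; have mF' := (measurable_restrictT F (measurable_Khat (R := R))).1 mF.
have := measurable_funTS (D := I01) (measurable_fun_pair2 x mF').
apply: eq_measurable_fun => y yI; rewrite patchE in_Khat yI.
by rewrite (mem_set xI).
Qed.

Lemma bdm_fstK (f : MR -> R) : bdm I01 f -> bdm K (fun z => f z.1).
Proof.
move=> [mf [M hM]]; split; first exact: measurable_fstK.
by exists M => z [z1 _]; exact: hM.
Qed.

Lemma bdm_sndK (f : MR -> R) : bdm I01 f -> bdm K (fun z => f z.2).
Proof.
move=> [mf [M hM]]; split; first exact: measurable_sndK.
by exists M => z [_ z2]; exact: hM.
Qed.

Lemma bdm_sliceK1 F (y : R) : bdm K F -> I01 y -> bdm I01 (fun x : MR => F (x, y)).
Proof.
move=> [mF [M hM]] yI; split; first exact: measurable_sliceK1.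
by exists M => x xI; apply: hM; split.
Qed.

Lemma bdm_sliceK2 F (x : R) : bdm K F -> I01 x -> bdm I01 (fun y : MR => F (x, y)).
Proof.
move=> [mF [M hM]] xI; split; first exact: measurable_sliceK2.
by exists M => y yI; apply: hM; split.
Qed.

Lemma rint_bdmI (f : MR -> R) : bdm I01 f -> rint mu I01 f.
Proof. by apply: rint_bdm => //; exact: lebesgue_MI01_lty. Qed.

Lemma rint_bdmK F : bdm K F -> rint leb2 K F.
Proof. by apply: rint_bdm => //; exact: leb2_Khat_lty. Qed.

Lemma rint_fstK (f : MR -> R) : rint mu I01 f -> rint leb2 K (fun z => f z.1).
Proof.
move=> fi; have mf := rint_measurable fi; apply/integrableP; split.
  by apply/measurable_EFinP; exact: measurable_fstK.
rewrite ge0_integralK12//.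
  rewrite (eq_integral (fun x => (`|f x|%:E))); last first.
    by move=> x _; exact: (integral_I01_cst (`|f x|%:E)%E).
  by have /integrableP[] := fi.
by apply: measurableT_comp => //; apply/measurable_EFinP; exact: measurable_fstK.
Qed.

Lemma ae_I1 (f g : MR -> R) : rint mu I01 f -> rint mu I01 g ->
  {ae mu, forall x, I01 x -> f x = g x} -> I1 f = I1 g.
Proof.
move=> fi gi fg; congr fine; apply: ae_eq_integral => //.
- exact: measurable_int fi.
- exact: measurable_int gi.
- by move: fg; apply: filterS => x h /h ->.
Qed.

Lemma measurable_integralK1 (F : plane -> \bar R) : measurable_fun K F ->
  (forall z, (0 <= F z)%E) -> measurable_fun I01 (fun y : MR => \int[mu]_(t in I01) F (t, y))%E.
Proof.
move=> mF F0.
have mF' := (measurable_restrictT F (measurable_Khat (R := R))).1 mF.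
have F0' z : (0 <= (F \_ K) z)%E by rewrite patchE; case: ifP.
have := measurable_funTS (D := I01) (@measurable_fun_fubini_tonelli_G _ _ _ _ _ mu _ mF' F0').
apply: eq_measurable_fun => y yI; rewrite /fubini_G [RHS]integral_mkcond.
by apply: eq_integral => t _; rewrite !patchE in_Khat yI andbT.
Qed.

(** The first argument of [kappa] is the variable of integration and the second the output variable;
    the second coordinate of [g] is a mere parameter. *)
Definition iop kappa g (z : plane) : R := I1 (fun t => kappa (t, z.1) * g (t, z.2)).

(** Tonelli's theorem gives measurability of partial integrals for nonnegative integrands, hence the
    split into positive and negative parts. Finiteness of the integrals is not at stake. *)
Lemma measurable_fine_integral d (T : measurableType d) (F : T * MR -> \bar R) :
  measurable_fun setT F -> measurable_fun setT (fun z => fine (\int[mu]_t F (z, t))%E).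
Proof.
move=> mF; apply: measurableT_comp => //.
rewrite (_ : (fun z => _) = (fun z => \int[mu]_t (F^\+ (z, t)) - \int[mu]_t (F^\- (z, t)))%E).
  apply: emeasurable_funB.
    apply: (@measurable_fun_fubini_tonelli_F _ _ _ _ _ mu (F^\+)%E) => //.
    exact: measurable_funepos.
  apply: (@measurable_fun_fubini_tonelli_F _ _ _ _ _ mu (F^\-)%E) => //.
  exact: measurable_funeneg.
apply/funext => z; rewrite [LHS]integralE; congr (_ - _)%E; apply: eq_integral => t _;
  by rewrite ?funeposE ?funenegE.
Qed.

Lemma measurable_iop kappa g : measurable_fun K kappa -> measurable_fun K g ->
  measurable_fun K (iop kappa g).
Proof.
move=> mk mg.
have mk' := (measurable_restrictT kappa (measurable_Khat (R := R))).1 mk.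
have mg' := (measurable_restrictT g (measurable_Khat (R := R))).1 mg.
pose H (w : plane * MR) := ((kappa \_ K) (w.2, w.1.1) * (g \_ K) (w.2, w.1.2))%:E.
have mH : measurable_fun setT H.
  apply/measurable_EFinP/measurable_funM.
    apply: (measurableT_comp mk'); apply: measurable_fun_pair; first exact: measurable_snd.
    by apply: (measurableT_comp measurable_fst); exact: measurable_fst.
  apply: (measurableT_comp mg'); apply: measurable_fun_pair; first exact: measurable_snd.
  by apply: (measurableT_comp measurable_snd); exact: measurable_fst.
have := measurable_funTS (D := K) (measurable_fine_integral mH).
apply: eq_measurable_fun => -[x y]; rewrite in_Khat => /andP[xI yI].
rewrite /iop /I1 Rintegral_mkcond /Rintegral; congr fine; apply: eq_integral => t _.
rewrite /H/= !patchE !in_Khat xI yI !andbT; case: ifP => // _.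
by rewrite mul0r.
Qed.

Section Bound.
Variables (kappa : plane -> R) (M : R).
Hypotheses (mk : measurable_fun K kappa) (kM : forall z, K z -> `|kappa z| <= M).

Let M0 : 0 <= M.
Proof. by apply: le_trans (kM (z := (0, 0)) _) => //; split; rewrite /= in_itv/= lexx ler01. Qed.

Lemma iop_le g z : measurable_fun K g -> K z ->
  (`|iop kappa g z|%:E <= M%:E * \int[mu]_(t in I01) `|g (t, z.2)|%:E)%E.
Proof.
case: z => x y mg [/= xI yI].
have mgy := measurable_sliceK1 mg yI; have mkx := measurable_sliceK1 mk xI.
have mp : measurable_fun I01 (fun t : MR => (kappa (t, x) * g (t, y))%:E).
  exact/measurable_EFinP/measurable_funM.
rewrite -ge0_integralZl//; last first.
  exact: measurable_normEFin.
(* Where the slice integral is infinite, [fine] makes the left side [0] and the inequality persists,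
   so the bound holds at every point of the square. *)
have h : (`|iop kappa g (x, y)|%:E <= `|\int[mu]_(t in I01) (kappa (t, x) * g (t, y))%:E|)%E.
  rewrite /iop /I1 /Rintegral /=.
  by case: (\int[mu]_(t in _) _)%E => [r||]//=; rewrite normr0 leey.
apply: (le_trans h); apply: (le_trans (le_abse_integral _ measurable_I01 mp)).
apply: ge0_le_integral => //.
- exact: measurableT_comp.
- by apply: measurable_funeM; exact: measurable_normEFin.
- move=> t tI; rewrite -EFinM /= lee_fin normrM ler_wpM2r//.
  by apply: kM; split.
Qed.

(** For fixed [y] the operator is at most [M] times the L^1 norm of the slice of [g], hence at most
    [M] times its L^p norm. This bound does not depend on [x], and the integration in [x] is over a
    set of length 1. *)
Lemma integral_iop_le (p : R) g : 1 <= p -> measurable_fun K g ->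
  (\int[leb2]_(z in K) (`|iop kappa g z| `^ p)%:E <=
   (M `^ p)%:E * \int[leb2]_(z in K) (`|g z| `^ p)%:E)%E.
Proof.
move=> p1 mg; have p0 : 0 < p by exact: lt_le_trans p1.
have mi := measurable_iop mk mg.
have ip0 z : (0 <= (`|iop kappa g z| `^ p)%:E)%E by rewrite lee_fin powR_ge0.
have mip := measurable_powRn p mi; have mgp := measurable_powRn p mg.
have mgy y : I01 y -> measurable_fun I01 (fun t : MR => g (t, y)) by exact: measurable_sliceK1.
pose G (y : MR) := (\int[mu]_(t in I01) `|g (t, y)|%:E)%E.
have G0 y : (0 <= G y)%E by exact: integral_ge0.
have mG : measurable_fun I01 G.
  by apply: (@measurable_integralK1 (fun z => `|g z|%:E)) => //; exact: measurable_normEFin.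
have G_le y : I01 y -> (G y `^ p <= \int[mu]_(t in I01) (`|g (t, y)| `^ p)%:E)%E.
  move=> yI; rewrite -[leRHS](poweR_invK p1) ?integral_powRn_ge0//.
  apply: le_poweR => //; first exact: ltW.
  by apply: integral_norm_le_Lp => //; [exact: lebesgue_MI01|exact: mgy].
have mpow (H : MR -> \bar R) : measurable_fun I01 H -> measurable_fun I01 (fun y => H y `^ p)%E.
  by move=> mH; apply: (measurableT_comp (measurable_poweR p) mH).
rewrite ge0_integralK21//.
rewrite [X in (_ <= _ * X)%E]ge0_integralK21//.
apply: (@le_trans _ _ (\int[mu]_(y in I01) ((M `^ p)%:E * (G y `^ p)))%E).
  apply: ge0_le_integral => //.
  - by move=> y _; apply: integral_ge0 => x _; rewrite lee_fin powR_ge0.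
  - exact: (measurable_integralK1 mip ip0).
  - exact: (measurable_funeM _ (mpow _ mG)).
  - move=> y yI; rewrite -[leRHS]integral_I01_cst; apply: ge0_le_integral => //.
    + exact: (measurable_powRn p (measurable_sliceK1 mi yI)).
    + move=> x xI; rewrite -poweR_EFin -[((M `^ p)%:E)%E]poweR_EFin -poweRM ?lee_fin//.
      apply: le_poweR; [exact: ltW|by rewrite lee_fin|].
      exact: (iop_le mg (z := (x, y))).
rewrite ge0_integralZl//; [|exact: mpow|by move=> y _; exact: poweR_ge0|by rewrite lee_fin powR_ge0].
apply: lee_wpmul2l; first by rewrite lee_fin powR_ge0.
apply: ge0_le_integral => //.
- by move=> y _; exact: poweR_ge0.
- exact: mpow.
- exact: (measurable_integralK1 mgp (fun z => _)).
Qed.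

Lemma normLp_iop (p : R) g : 1 <= p -> measurable_fun K g ->
  (normLp p (iop kappa g) <= M%:E * normLp p g)%E.
Proof. by move=> p1 mg; apply: le_Lnorm => //; exact: integral_iop_le. Qed.

Lemma rint_iop g : rint leb2 K g -> rint leb2 K (iop kappa g).
Proof.
move=> gi; have mg := rint_measurable gi.
apply/integrableP; split; first by apply/measurable_EFinP; exact: measurable_iop.
have /integrableP[_ gfin] := gi.
have h (f : plane -> R) : (\int[leb2]_(z in K) `|(EFin \o f) z| =
   \int[leb2]_(z in K) (`|f z| `^ 1)%:E)%E.
  by apply: eq_integral => z _; rewrite powRr1.
rewrite h (le_lt_trans (integral_iop_le (lexx 1) mg))// -h.
by rewrite lte_mul_pinfty// ?lee_fin ?powR_ge0.
Qed.

End Bound.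

(** Fubini's theorem in the pair of [x] and the variable of integration, for almost every frozen
    [y]: those for which the slice of [g] is integrable. *)
Lemma iop_dual kappa g a b : bdm K kappa -> rint leb2 K g -> bdm I01 a -> bdm I01 b ->
  intK (fun z => iop kappa g z * (a z.1 * b z.2)) =
  intK (fun z => g z * (I1 (fun x => kappa (z.1, x) * a x) * b z.2)).
Proof.
move=> bk gi ba bb; have [mk [M kM]] := bk.
have bab : bdm K (fun z => a z.1 * b z.2) by apply: bdmM; [exact: bdm_fstK|exact: bdm_sndK].
have Li : rint leb2 K (fun z => iop kappa g z * (a z.1 * b z.2)).
  by apply: rintM => //; exact: rint_iop kM _ _.
have bA : bdm I01 (fun t : MR => I1 (fun x => kappa (t, x) * a x)).
  have [_ [Ma haM]] := ba.
  have bka : bdm K (fun z => kappa z * a z.2) by apply: bdmM => //; exact: bdm_sndK.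
  have [r1 _ _ _] := fubiniK (rint_bdmK bka).
  split; first exact: rint_measurable r1.
  exists (M * Ma) => t tI.
  have bt : bdm I01 (fun x : MR => kappa (t, x) * a x) by exact: (bdm_sliceK2 bka tI).
  rewrite (le_trans (le_normr_Rintegral _ (rint_bdmI bt)))//.
  apply: (@le_trans _ _ (I1 (fun=> M * Ma))).
    apply: le_Rintegral => //; first exact: integrable_norm (rint_bdmI bt).
      exact: rint_bdmI (bdm_cst _ _).
    by move=> x xI; rewrite normrM ler_pM//; [exact: kM|exact: haM].
  by rewrite I1_cst.
have Ri : rint leb2 K (fun z => g z * (I1 (fun x => kappa (z.1, x) * a x) * b z.2)).
  by apply: rintM => //; apply: bdmM; [exact: (bdm_fstK bA)|exact: bdm_sndK].
have [_ L1 _ ->] := fubiniK Li; have [_ R1 _ ->] := fubiniK Ri.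
apply: ae_I1 => //; have := ae_rintK gi; apply: filterS => y h yI.
have giy := h yI.
(* With [y] frozen, the square now carries the pair [(t, x)], and Fubini's theorem on it exchanges
   the two integrations. *)
have Pi : rint leb2 K (fun z => g (z.1, y) * (kappa z * (a z.2 * b y))).
  apply: rintM => //; first exact: (rint_fstK giy).
  by apply: bdmM => //; apply: bdmM; [exact: bdm_sndK|exact: bdm_cst].
have [_ _ P1 P2] := fubiniK Pi.
transitivity (I1 (fun x => I1 (fun t => g (t, y) * (kappa (t, x) * (a x * b y))))).
  apply: eq_Rintegral => x /set_mem xI; rewrite /iop -RintegralZr//.
    by apply: eq_Rintegral => t _; rewrite /= -mulrA mulrCA.
  rewrite (_ : _ \o _ = EFin \o (fun t => g (t, y) * kappa (t, x))).
    by apply: rintM => //; exact: (bdm_sliceK1 bk xI).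
  by apply/funext => t; rewrite /= mulrC.
rewrite -P2 P1; apply: eq_Rintegral => t /set_mem tI /=.
rewrite -RintegralZr//; last exact: (rint_bdmI (bdmM (bdm_sliceK2 bk tI) ba)).
rewrite -RintegralZl//; last first.
  by apply: rint_bdmI; apply: bdmM; [exact: (bdmM (bdm_sliceK2 bk tI) ba)|exact: bdm_cst].
by apply: eq_Rintegral => x _; congr (_ * _); rewrite mulrA.
Qed.

End IntegralOperator.
#[export] Hint Resolve measurable_I01 : core.

(** * The fundamental lemma for tensor products *)

Section Fundamental.
Local Open Scope classical_set_scope.
Context {R : realType}.
Local Notation mu := (@lebesgue_measure R).
Local Notation MR := (measurableTypeR R).
Local Notation I01 := (`[0, 1]%classic : set MR).
Local Notation plane := (MR * MR)%type.
Local Notation K := (@Khat R : set plane).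
Implicit Types (a b : R -> R).

Lemma bdm_test1 a : test1 a -> bdm I01 a.
Proof. by move=> [sa _]; exact: (bdm_smooth1 0 1 sa). Qed.

Lemma ae_neq (c : R) : {ae mu, forall x : MR, x <> c}.
Proof.
exists [set c]; split; [exact: measurable_set1|exact: lebesgue_measure_set1|].
by move=> x /= /contrapT ->.
Qed.

(** Cutoffs converging to the indicator of ]0, y[ show by dominated convergence that the primitive
    of [f] vanishes. Lebesgue differentiation then recovers [f] almost everywhere. *)
Lemma fundamental1 (f : MR -> R) : rint mu I01 f ->
  (forall a, test1 a -> I1 (fun x => f x * a x) = 0) ->
  {ae mu, forall x, I01 x -> f x = 0}.
Proof.
move=> fi hf; have mf := rint_measurable fi.
pose f0 := f \_ I01.
have f0i : mu.-integrable setT (EFin \o f0).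
  rewrite (_ : _ \o _ = (EFin \o f) \_ I01).
    exact: (integrable_mkcond _ measurable_I01).1 fi.
  by rewrite restrict_EFin.
have prim0 (y : R) : 0 < y -> y <= 1 -> \int[mu]_(t in `[0, y]) f0 t = 0.
  move=> y0 y1.
  have iI : mu.-integrable `]0, y[ (EFin \o f0) by exact: integrableS f0i.
  rewrite -Rintegral_itv_obnd_cbnd; last by exact: integrableS f0i.
  rewrite -Rintegral_itv_bndo_bndc//.
  transitivity (I1 (fun x => f x * (if 0 < x < y then 1 else 0))).
    rewrite Rintegral_mkcond /I1 [RHS]Rintegral_mkcond; apply: eq_Rintegral => t _.
    rewrite !patchE !mem_setE !in_itv/=; case: ifPn => [/andP[t0 ty]|h].
      by rewrite /f0 patchE mem_setE in_itv/= (ltW t0) (ltW (lt_le_trans ty y1)) mulr1.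
    by case: ifP => // _; rewrite mulr0.
  have [eta [te e01 ce _]] := cutoff_seq (lexx 0) y0 y1.
  have : I1 (fun x => f x * eta n x) @[n --> \oo] -->
         I1 (fun x => f x * (if 0 < x < y then 1 else 0)).
    apply: (Rintegral_dominated measurable_I01 (g := fun x => `|f x|)).
    - move=> n; apply: measurable_funM => //; by have [] := bdm_test1 (te n).
    - exact: integrable_norm.
    - move=> n x _; rewrite normrM ler_piMr// ger0_norm; by have /andP[] := e01 n x.
    - by move=> x _; apply: cvgM; [exact: cvg_cst|exact: ce].
  rewrite (_ : (fun n => _) = (fun=> 0)); last by apply/funext => n; exact: hf.
  by move=> /cvg_unique; apply => //; exact: cvg_cst.
have loc : locally_integrable [set: R] f0 by exact: integrable_locally.
have fi0 (D : set MR) : measurable D -> mu.-integrable D (EFin \o f0).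
  by move=> mD; exact: integrableS f0i.
have h1 := @FTC1 _ f0 (BLeft 0) (fun y => fi0 _ (measurable_itv _)) loc.
have h0 := ae_neq 0; have h2 := ae_neq 1.
pose F := fun y : R => \int[mu]_(t in `[0, y]) f0 t.
near=> x => xI.
have x0 : x <> 0 by near: x; exact: ae_neq.
have x1 : x <> 1 by near: x; exact: ae_neq.
have hx : 0 < x -> derivable F x 1 /\ derive1 F x = f0 x by near: x; exact: h1.
have /andP[x0' x1'] : 0 < x < 1.
  by move: xI; rewrite /= in_itv/= !le_eqVlt => /andP[/orP[/eqP/esym//|->] /orP[/eqP//|->]].
have [//|_] := hx _.
rewrite /f0 patchE (mem_set xI) => <-.
rewrite derive1E (@near_eq_derive _ _ _ F (cst 0)); first by rewrite derive_cst.
near=> y; rewrite /F prim0//.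
  by near: y; exact: lt_nbhsr.
by apply/ltW; near: y; exact: lt_nbhsl.
Unshelve. all: by end_near. Qed.

Lemma intK_snd (F : plane -> R) b : rint leb2 K F -> bdm I01 b ->
  intK (fun z => F z * b z.2) = I1 (fun y => I1 (fun x => F (x, y)) * b y).
Proof.
move=> Fi bb; have [_ r1 _ _] := fubiniK Fi.
have Fbi : rint leb2 K (fun z => F z * b z.2) by apply: rintM => //; exact: bdm_sndK.
have [_ r2 _ ->] := fubiniK Fbi; apply: ae_I1 => //; first exact: rintM.
have := ae_rintK Fi; apply: filterS => y h yI.
by rewrite -RintegralZr//; exact: h.
Qed.

Lemma intK_snd_eq0 (F : plane -> R) : rint leb2 K F ->
  (forall b, test1 b -> intK (fun z => F z * b z.2) = 0) ->
  forall b, bdm I01 b -> intK (fun z => F z * b z.2) = 0.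
Proof.
move=> Fi h b bb; have [_ r1 _ _] := fubiniK Fi.
have G0 := fundamental1 r1 (fun b tb => etrans (esym (intK_snd Fi (bdm_test1 tb))) (h b tb)).
rewrite intK_snd// -[RHS](I1_cst 0); apply: ae_I1; first exact: rintM.
  exact: rint_bdmI (bdm_cst _ _).
by move: G0; apply: filterS => y h0 yI; rewrite h0// mul0r.
Qed.

(** The factors are enlarged one at a time: with one factor absorbed into [F], the other is tested
    in one variable only. The exchange of coordinates treats the remaining factor. *)
Lemma intK_tensor_eq0 (F : plane -> R) : rint leb2 K F ->
  (forall a b, test1 a -> test1 b -> intK (fun z => F z * (a z.1 * b z.2)) = 0) ->
  forall a b, bdm I01 a -> bdm I01 b -> intK (fun z => F z * (a z.1 * b z.2)) = 0.
Proof.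
move=> Fi h.
have h1 a b : test1 a -> bdm I01 b -> intK (fun z => F z * (a z.1 * b z.2)) = 0.
  move=> ta bb; rewrite (_ : (fun z => _) = (fun z => (F z * a z.1) * b z.2)); last first.
    by apply/funext => z; rewrite mulrA.
  apply: intK_snd_eq0 bb; first by apply: rintM => //; exact/bdm_fstK/bdm_test1.
  move=> c tc; rewrite -[RHS](h a c ta tc); congr intK.
  by apply/funext => z; rewrite mulrA.
move=> a b ba bb.
have Fai (c : R -> R) : bdm I01 c -> rint leb2 K (fun z => F z * (c z.1 * b z.2)).
  by move=> bc; apply: rintM => //; apply: bdmM; [exact: bdm_fstK|exact: bdm_sndK].
rewrite -(intK_swap (Fai _ ba)).
rewrite (_ : _ \o _ = (fun z : plane => (F (swapxy z) * b z.1) * a z.2)); last first.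
  by apply/funext => z /=; lra.
apply: intK_snd_eq0 ba.
  apply: (@rintM _ _ _ _ _ _ (F \o swapxy)) => //; first exact: rint_swap.
  exact: bdm_fstK.
move=> c tc; rewrite -[RHS](h1 c b tc bb) -(intK_swap (Fai _ (bdm_test1 tc))).
by congr intK; apply/funext => z /=; lra.
Qed.

(** Bounded factors include indicators, so the integral of [F] over every measurable rectangle
    vanishes. Rectangles form a pi-system that generates the product sigma-algebra, and Dynkin's
    theorem extends the vanishing to all measurable sets. *)
Lemma fundamental2 (F : plane -> R) : rint leb2 K F ->
  (forall a b, test1 a -> test1 b -> intK (fun z => F z * (a z.1 * b z.2)) = 0) ->
  {ae leb2, forall z, K z -> F z = 0}.
Proof.
move=> Fi h; have h' := intK_tensor_eq0 Fi h.
pose F0 := F \_ K.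
have F0i : leb2.-integrable setT (EFin \o F0).
  rewrite (_ : _ \o _ = (EFin \o F) \_ K).
    exact: (integrable_mkcond _ (measurable_Khat (R := R))).1 Fi.
  by rewrite restrict_EFin.
have F0S (S : set plane) : measurable S -> leb2.-integrable S (EFin \o F0).
  by move=> mS; exact: integrableS F0i.
pose P (S : set plane) := (\int[leb2]_(z in S) (F0 z)%:E = 0)%E.
have rect (A B : set MR) : measurable A -> measurable B -> P (A `*` B).
  move=> mA mB; have mAB : measurable (A `*` B : set plane) by exact: measurableX.
  have bi (C : set MR) : measurable C -> bdm I01 (\1_C : MR -> R).
    move=> mC; split; first exact: measurable_funTS.
    by exists 1 => x _; rewrite ger0_norm// indicE; case: (_ \in _).
  have := h' _ _ (bi A mA) (bi B mB).
  rewrite /intK Rintegral_mkcond => hAB.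
  rewrite /P -[LHS]fineK; last exact: integrable_fin_num (F0S _ mAB).
  rewrite (_ : fine _ = 0)// -[RHS]hAB -[LHS]/(Rintegral leb2 (A `*` B) F0) Rintegral_mkcond.
  apply: eq_Rintegral => z _; rewrite /F0 !patchE.
  case: z => x y; rewrite in_setX/= !indicE.
  case: (x \in A); case: (y \in B) => /=; rewrite ?mulr1 ?mulr0//; by case: ifP.
have ae0 : ae_eq leb2 setT (EFin \o F0) (cst 0%E).
  apply: integral_ae_eq => // E _ mE; rewrite integral0.
  move: mE; rewrite measurable_prod_measurableType => mE.
  move: E mE; apply: (dynkin_induction (P := P)).
  - exact: measurable_prod_measurableType.
  - move=> _ _ [A mA [B mB <-]] [A' mA' [B' mB' <-]].
    exists (A `&` A'); first exact: measurableI.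
    exists (B `&` B'); first exact: measurableI.
    by rewrite setXI.
  - by rewrite -setXTT; exact: rect.
  - by move=> _ [A mA [B mB <-]]; exact: rect.
  - move=> S mS PS; rewrite /P.
    have := rect setT setT measurableT measurableT.
    rewrite setXTT /P -(setUv S) integral_setU_EFin//.
    + by rewrite PS add0e.
    + exact: measurableC.
    + by rewrite setUv; exact: (rint_measurable F0i).
    + by apply/disj_setPCl.
  - move=> S mS tS PS; rewrite /P integral_bigcup//.
      by apply: eseries0 => n _ _; exact: PS.
    by apply: F0S; exact: bigcup_measurable.
move: ae0; apply: filterS => z + Kz => /(_ I)/=.
by rewrite /F0 patchE (mem_set Kz) => -[].
Qed.

End Fundamental.

(** The hypothesis is the triviality of the left kernel of a square matrix; [N] is the inverse. It
    recovers coefficients linearly from moments, and the sum of its absolute values later bounds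
    them. *)
Lemma gram_dual (R : fieldType) (I : finType) (B : I -> I -> R) :
  (forall c : I -> R, (forall j, \sum_i c i * B i j = 0) -> forall i, c i = 0) ->
  exists N : I -> I -> R, forall (c : I -> R) i,
    c i = \sum_j (\sum_i' c i' * B i' j) * N j i.
Proof.
move=> hB; pose M : 'M[R]_#|I| := \matrix_(i, j) B (enum_val i) (enum_val j).
have Mf : row_free M.
  rewrite -kermx_eq0; apply/rowV0P => v /sub_kermxP vM.
  apply/rowP => i; rewrite mxE.
  rewrite -[i]enum_valK; apply: (hB (fun i => v 0 (enum_rank i))) => j.
  move/matrixP/(_ 0 (enum_rank j)): vM; rewrite !mxE => vM; rewrite -[RHS]vM.
  rewrite (reindex (@enum_val I I)) /=; last exact/onW_bij/enum_val_bij.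
  by apply: eq_bigr => k _; rewrite mxE enum_valK enum_rankK.
have Mu : M \in unitmx by rewrite -row_free_unit.
exists (fun j i => invmx M (enum_rank j) (enum_rank i)) => c i.
pose v : 'rV[R]_#|I| := \row_k c (enum_val k).
have : (v *m M *m invmx M) 0 (enum_rank i) = c i by rewrite mulmxK// mxE enum_rankK.
rewrite mxE => <-; rewrite [RHS](reindex (@enum_val I I)) /=; last exact/onW_bij/enum_val_bij.
apply: eq_bigr => j _; rewrite enum_valK; congr (_ * _).
rewrite mxE [RHS](reindex (@enum_val I I)) /=; last exact/onW_bij/enum_val_bij.
by apply: eq_bigr => k _; rewrite !mxE.
Qed.

(** The [size p] distinct points a + (b-a)/(k+2) lie in the interval, whereas a nonzero polynomial
    has fewer roots than its size. *)
Lemma poly_eq0_itv (R : realFieldType) (p : {poly R}) (a b : R) : a < b ->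
  (forall x, a < x < b -> p.[x] = 0) -> p = 0.
Proof.
move=> ab h; apply/eqP/negPn/negP => p0.
pose r := [seq a + (b - a) / k.+2%:R | k <- iota 0 (size p)].
have ru : uniq r.
  rewrite map_inj_uniq ?iota_uniq// => i j /addrI.
  have ba : b - a != 0 by rewrite gt_eqF// subr_gt0.
  by move=> /(mulfI ba)/invr_inj/eqP; rewrite eqr_nat => /eqP[].
have rr : all (root p) r.
  apply/allP => _ /mapP[k _ ->]; apply/rootP/h.
  have ba : 0 < b - a by rewrite subr_gt0.
  have k2 : (k.+2%:R)^-1 < 1 :> R by rewrite invf_lt1 ?ltr0n// ltr1n.
  have k0 : 0 < (k.+2%:R)^-1 :> R by rewrite invr_gt0 ltr0n.
  have q0 := mulr_gt0 ba k0.
  have q1 : (b - a) / k.+2%:R < b - a by rewrite gtr_pMr.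
  by rewrite ltrDl q0/= addrC -ltrBrDr.
by have := max_poly_roots p0 rr ru; rewrite size_map size_iota ltnn.
Qed.

(** * Test functions biorthogonal to the powers *)

Section Biorthogonal.
Local Open Scope classical_set_scope.
Context {R : realType}.
Local Notation mu := (@lebesgue_measure R).
Local Notation MR := (measurableTypeR R).
Local Notation I01 := (`[0, 1]%classic : set MR).
Implicit Types (a b : R -> R).

Lemma I1_sum (I : Type) (r : seq I) (F : I -> R -> R) : (forall i, rint mu I01 (F i)) ->
  I1 (fun x => \sum_(i <- r) F i x) = \sum_(i <- r) I1 (F i).
Proof. by move=> Fi; exact: (Rintegral_sum measurable_I01). Qed.

Lemma rint_smooth1I a : smooth1 a -> rint mu I01 a.
Proof. by move=> sa; apply: rint_bdmI; exact: (bdm_smooth1 0 1). Qed.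

Lemma test1M a b : test1 a -> smooth1 b -> test1 (a \* b).
Proof.
move=> [sa [c [d [c0 cd d1 a0]]]] sb; split; first exact: smooth1M.
by exists c, d; split=> // x h /=; rewrite a0// mul0r.
Qed.

Lemma sum_expr_eq0 (n : nat) (c : 'I_n -> R) (u v : R) : u < v ->
  (forall x, u < x < v -> \sum_i c i * x ^+ i = 0) -> forall i, c i = 0.
Proof.
move=> uv h i; pose p : {poly R} := \sum_(i < n) c i *: 'X^i.
have p0 : p = 0.
  apply: (poly_eq0_itv uv) => x xuv; rewrite -[RHS](h x xuv) horner_sum.
  by apply: eq_bigr => j _; rewrite hornerZ hornerXn.
have : p`_i = 0 by rewrite p0 coef0.
rewrite coef_sum (bigD1 i)//= coefZ coefXn eqxx mulr1 big1 ?addr0// => j ji.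
by rewrite coefZ coefXn (_ : (_ == _) = false) ?mulr0//; apply/negbTE; rewrite eq_sym.
Qed.

(** Pairing the relations with [c] gives a zero integral of theta P^2, where [P] has the
    coefficients [c]; so [P] vanishes wherever the weight is positive. *)
Lemma weighted_gram_eq0 (n : nat) (theta : R -> R) (u v : R) (c : 'I_n -> R) :
  smooth1 theta -> (forall x, 0 <= theta x) -> 0 <= u -> u < v -> v <= 1 ->
  (forall x, u < x < v -> 0 < theta x) ->
  (forall j : 'I_n, \sum_(i < n) c i * I1 (fun x => theta x * (x ^+ i * x ^+ j)) = 0) ->
  forall i, c i = 0.
Proof.
move=> sth th0 u0 uv v1 thp h.
pose P x := \sum_(i < n) c i * x ^+ i.
have sP : smooth1 P.
  apply: smooth1_sum => i; apply: (@smooth1M _ (fun=> c i)); first exact: smooth1_cst.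
  exact: smooth1_exp.
have si i j : smooth1 (fun x => theta x * (x ^+ i * x ^+ j)).
  apply: (smooth1M sth); apply: (@smooth1M _ (fun x => x ^+ i)); exact: smooth1_exp.
have E : I1 (fun x => theta x * (P x * P x)) = 0.
  transitivity (I1 (fun x => \sum_(j < n) \sum_(i < n) c j * (c i * (theta x * (x ^+ i * x ^+ j))))).
    apply: eq_Rintegral => x _; rewrite /P mulr_sumr mulr_sumr; apply: eq_bigr => j _.
    by rewrite mulr_suml mulr_sumr; apply: eq_bigr => i _; lra.
  rewrite I1_sum; last first.
    by move=> j; apply: (rint_sum measurable_I01) => i; do 2 apply: (rintZ measurable_I01);
      exact: rint_smooth1I.
  rewrite big1// => j _; rewrite I1_sum; last first.
    by move=> i; do 2 apply: (rintZ measurable_I01); exact: rint_smooth1I.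
  rewrite -[RHS](mulr0 (c j)) -[in RHS](h j) mulr_sumr; apply: eq_bigr => i _.
  rewrite I1Z; first by rewrite I1Z//; exact: rint_smooth1I.
  by apply: (rintZ measurable_I01); exact: rint_smooth1I.
have sF : smooth1 (fun x => theta x * (P x * P x)) by apply: smooth1M => //; exact: smooth1M.
have F0 x : 0 <= theta x * (P x * P x) by rewrite mulr_ge0// -expr2 sqr_ge0.
apply: (sum_expr_eq0 uv) => x /andP[ux xv].
have := continuous_ge0_I1_eq0 (smooth1_continuous sF) (fun x _ => F0 x) E (x := x).
rewrite (le_lt_trans u0 ux) (lt_le_trans xv v1) => /(_ isT)/eqP.
rewrite !mulf_eq0 orbb => /orP[/eqP t0|/eqP//].
by have := thp x; rewrite ux xv t0 ltxx => /(_ isT).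
Qed.

(** [om i] is a bump times the polynomial whose coefficients form a column of the inverse of the
    Gram matrix weighted by that bump. The weight supplies the compact support. *)
Lemma biorthogonal (n : nat) : exists om : 'I_n -> R -> R,
  (forall i, test1 (om i)) /\
  forall i j : 'I_n, I1 (fun x => x ^+ j * om i x) = (i == j)%:R.
Proof.
(* Any interval with closure inside ]0, 1[ would serve. *)
pose th : R -> R := bump 4^-1 (3 / 4).
have sth : smooth1 th by exact: smooth1_bump.
have tth : test1 th.
  split=> //; exists 4^-1, (3 / 4); split; [lra|lra|lra|].
  by move=> x; exact: bump_eq0.
pose B (i j : 'I_n) := I1 (fun x => th x * (x ^+ i * x ^+ j)).
have [N hN] : exists N : 'I_n -> 'I_n -> R, forall (c : 'I_n -> R) i,
    c i = \sum_j (\sum_i' c i' * B i' j) * N j i.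
  apply: gram_dual => c; apply: (@weighted_gram_eq0 _ th 4^-1 (3 / 4)) => //; try lra.
  - by move=> x; exact: bump_ge0.
  - by move=> x; exact: bump_gt0.
exists (fun i x => th x * \sum_j N j i * x ^+ j); split.
  move=> i; apply: test1M => //; apply: smooth1_sum => j.
  apply: (@smooth1M _ (fun=> N j i)); [exact: smooth1_cst|exact: smooth1_exp].
move=> i k; transitivity (I1 (fun x => \sum_j N j i * (th x * (x ^+ k * x ^+ j)))).
  apply: eq_Rintegral => x _; rewrite !mulr_sumr; apply: eq_bigr => j _; lra.
have si j : rint mu I01 (fun x => th x * (x ^+ k * x ^+ j)).
  apply: rint_smooth1I; apply: (smooth1M sth).
  by apply: (@smooth1M _ (fun x => x ^+ k)); exact: smooth1_exp.
rewrite I1_sum; last by move=> j; exact: (rintZ measurable_I01).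
(* Recovering the coordinates of the [k]-th unit vector is exactly the biorthogonality relation. *)
have := hN (fun m => (m == k)%:R) i => /= ->.
apply: eq_bigr => j _; rewrite I1Z// mulrC; congr (_ * _).
rewrite (bigD1 k)//= eqxx mul1r big1 ?addr0// => m mk.
by rewrite (negbTE mk) mul0r.
Qed.

End Biorthogonal.

(** * Polynomial approximation under weak derivatives *)

Section Tensor.
Local Open Scope classical_set_scope.
Context {R : realType}.
Implicit Types (a b : R -> R).

Definition tensor a b : R * R -> R := fun z => a z.1 * b z.2.

Lemma continuous_tensor a b : continuous a -> continuous b -> continuous (tensor a b).
Proof.
move=> ca cb z; apply: (@continuousM R (R * R)%type (fun z => a z.1) (fun z => b z.2)).
  by apply: (@continuous_comp _ _ _ fst a); [exact: cvg_fst|exact: ca].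
by apply: (@continuous_comp _ _ _ snd b); [exact: cvg_snd|exact: cb].
Qed.

Lemma dx_tensor a b : (forall x, derivable a x 1) -> dx (tensor a b) = tensor (derive1 a) b.
Proof.
move=> da; apply/funext => -[x y]; rewrite /dx /tensor /=.
by rewrite derive1Mr.
Qed.

Lemma dy_tensor a b : (forall x, derivable b x 1) -> dy (tensor a b) = tensor a (derive1 b).
Proof.
move=> db; apply/funext => -[x y]; rewrite /dy /tensor /=.
by rewrite derive1Ml.
Qed.

Lemma iter_dx_tensor n a b : smooth1 a -> iter n dx (tensor a b) = tensor (iter n (@derive1 R R) a) b.
Proof.
move=> sa; elim: n => //= n ->; rewrite dx_tensor// => x.
exact/smooth1_derivable/smooth1_derive1n.
Qed.

Lemma iter_dy_tensor n a b : smooth1 b -> iter n dy (tensor a b) = tensor a (iter n (@derive1 R R) b).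
Proof.
move=> sb; elim: n => //= n ->; rewrite dy_tensor// => x.
exact/smooth1_derivable/smooth1_derive1n.
Qed.

Lemma smooth_tensor a b : smooth1 a -> smooth1 b -> smooth (tensor a b).
Proof.
move=> sa sb n; elim: n a b sa sb => [|n ih] a b sa sb.
  by split=> //; apply: continuous_tensor; exact: smooth1_continuous.
split; first by apply: continuous_tensor; exact: smooth1_continuous.
split.
- move=> z; apply: (@derivableM _ _ a (fun=> b z.2)); first exact: smooth1_derivable.
  exact: derivable_cst.
- move=> z; apply: (@derivableM _ _ (fun=> a z.1) b); last exact: smooth1_derivable.
  exact: derivable_cst.
- rewrite dx_tensor; last by move=> x; exact: smooth1_derivable.
  by apply: ih => //; exact: smooth1_derive1.
- rewrite dy_tensor; last by move=> x; exact: smooth1_derivable.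
  by apply: ih => //; exact: smooth1_derive1.
Qed.

Lemma test_fun_tensor a b : test1 a -> test1 b -> test_fun (tensor a b).
Proof.
move=> [sa [a1 [a2 [a10 a12 a21 a0]]]] [sb [b1 [b2 [b10 b12 b21 b0]]]].
pose S : set (R * R) := `[a1, a2] `*` `[b1, b2].
have cS : compact S by apply: compact_setX; exact: segment_compact.
have sub : closure [set z | tensor a b z != 0] `<=` S.
  have clS : closed S by apply: compact_closed => //; exact: norm_hausdorff.
  rewrite ((closure_id _).1 clS); apply: closureS => -[x y] /=; rewrite /tensor mulf_eq0 negb_or.
  move=> /andP[ax bx]; split; rewrite /= in_itv/=; apply/andP; split; rewrite leNgt; apply/negP => h.
  - by move: ax; rewrite a0 ?eqxx// ltW.
  - by move: ax; rewrite a0 ?eqxx// (ltW h) orbT.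
  - by move: bx; rewrite b0 ?eqxx// ltW.
  - by move: bx; rewrite b0 ?eqxx// (ltW h) orbT.
split; first exact: smooth_tensor.
  exact: (subclosed_compact (@closed_closure _ _) cS sub).
move=> z /sub[]; rewrite /= !in_itv/= => /andP[h1 h2] /andP[h3 h4].
by split; rewrite /= in_itv/=; apply/andP; split; lra.
Qed.

(** This is what is retained of [weak_deriv]. One-variable antiderivatives can be inserted in either
    factor, and the notion is compatible with the exchange of coordinates. *)
Definition tensor_weak_deriv (m n : nat) (f g : R * R -> R) : Prop :=
  forall a b, test1 a -> test1 b ->
    intK (fun z => f z * (iter m (@derive1 R R) a z.1 * iter n (@derive1 R R) b z.2)) =
    (-1) ^+ (m + n) * intK (fun z => g z * (a z.1 * b z.2)).

Lemma weak_deriv_tensor m n f g : weak_deriv m n f g -> tensor_weak_deriv m n f g.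
Proof.
move=> [_ _ h] a b ta tb; have := h _ (test_fun_tensor ta tb).
have [sa _] := ta; have [sb _] := tb.
by rewrite iter_dy_tensor// iter_dx_tensor.
Qed.

End Tensor.

(** * Projection and Taylor operators in one direction *)

Section Approximation.
Local Open Scope classical_set_scope.
Context {R : realType}.
Local Notation mu := (@lebesgue_measure R).
Local Notation MR := (measurableTypeR R).
Local Notation I01 := (`[0, 1]%classic : set MR).
Local Notation plane := (MR * MR)%type.
Local Notation K := (@Khat R : set plane).
Implicit Types (a b : R -> R) (f g : plane -> R).

Lemma intKD f g : rint leb2 K f -> rint leb2 K g ->
  intK (fun z => f z + g z) = intK f + intK g.
Proof. by move=> fi gi; exact: (RintegralD (measurable_Khat (R := R)) fi gi). Qed.

Lemma intKB f g : rint leb2 K f -> rint leb2 K g ->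
  intK (fun z => f z - g z) = intK f - intK g.
Proof. by move=> fi gi; exact: (RintegralB (measurable_Khat (R := R)) fi gi). Qed.

Lemma intKZ (c : R) f : rint leb2 K f -> intK (fun z => c * f z) = c * intK f.
Proof. by move=> fi; apply: RintegralZl. Qed.

Lemma intK_sum (I : Type) (r : seq I) (F : I -> plane -> R) :
  (forall i, rint leb2 K (F i)) ->
  intK (fun z => \sum_(i <- r) F i z) = \sum_(i <- r) intK (F i).
Proof. by move=> Fi; exact: (Rintegral_sum (measurable_Khat (R := R))). Qed.

Lemma bdm_tensor a b : bdm I01 a -> bdm I01 b -> bdm K (tensor a b).
Proof. by move=> ba bb; apply: (@bdmM _ _ _ _ (fun z : plane => a z.1)); [exact: bdm_fstK|exact: bdm_sndK]. Qed.

Lemma intK_tensor a b : bdm I01 a -> bdm I01 b -> intK (tensor a b) = I1 a * I1 b.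
Proof.
move=> ba bb; have [_ _ _ ->] := fubiniK (rint_bdmK (bdm_tensor ba bb)).
transitivity (I1 (fun y => I1 a * b y)); last by rewrite I1Z//; exact: rint_bdmI.
apply: eq_Rintegral => y _; rewrite /tensor /= mulrC.
rewrite -RintegralZl//; last exact: rint_bdmI.
by apply: eq_Rintegral => x _; rewrite mulrC.
Qed.

Section Direction.
Variables (s' : nat) (om : 'I_s'.+1 -> R -> R).
Hypothesis tom : forall i, test1 (om i).
Hypothesis momE : forall i j : 'I_s'.+1, I1 (fun x => x ^+ j * om i x) = (i == j)%:R.

Definition proj_kernel (z : plane) : R := \sum_i om i z.1 * z.2 ^+ i.

(** In the convention of [iop] this integrates over [x, 1]: up to the sign (-1)^(s'+1) it is the
    antiderivative of order s'+1 in [x] that vanishes at x = 1. Its adjoint integrates over [0, t],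
    which is the closed form of [derive_preimage]. The order of differentiation is s'+1 throughout,
    so that it is positive. *)
Definition taylor_kernel (z : plane) : R :=
  (if z.2 <= z.1 then 1 else 0) * ((z.1 - z.2) ^+ s' / s'`!%:R).

Lemma bdm_expI n : bdm I01 (fun x => x ^+ n).
Proof. exact: (bdm_smooth1 0 1 (smooth1_exp n)). Qed.

Lemma bdm_proj_kernel : bdm K proj_kernel.
Proof.
apply: bdm_sum => i.
exact: (bdm_tensor (bdm_test1 (tom i)) (bdm_expI i)).
Qed.

Lemma bdm_taylor_kernel : bdm K taylor_kernel.
Proof.
have bz1 : bdm I01 (fun x : R => x) by exact: (bdm_expI 1).
have bd : bdm K (fun z => z.1 - z.2).
  have := bdmD (bdm_fstK bz1) (bdm_sndK (bdmM (bdm_cst I01 (-1)) bz1)).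
  by congr bdm; apply/funext => z /=; rewrite mulN1r.
have bdn n : bdm K (fun z => (z.1 - z.2) ^+ n).
  elim: n => [|n ih]; first by under eq_fun do rewrite expr0; exact: bdm_cst.
  by under eq_fun do rewrite exprS; exact: bdmM.
apply: bdmM; last by apply: (bdmM (bdn s')); exact: bdm_cst.
have [md _] := bd.
split; last by exists 1 => z _; case: ifP; rewrite ?normr1 ?normr0.
apply: measurable_fun_if => //; apply: measurable_fun_ler.
  exact: measurable_sndK (proj1 bz1).
exact: measurable_fstK (proj1 bz1).
Qed.

(** The adjoint of the projection with kernel [proj_kernel], acting on the first factor of a test
    function. *)
Definition coproj a (t : R) := \sum_(i < s'.+1) I1 (fun x => x ^+ i * a x) * om i t.

Lemma proj_kernel_dual a t : bdm I01 a ->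
  I1 (fun x => proj_kernel (t, x) * a x) = coproj a t.
Proof.
move=> ba; rewrite /proj_kernel /coproj /=.
transitivity (I1 (fun x => \sum_i om i t * (x ^+ i * a x))).
  by apply: eq_Rintegral => x _; rewrite mulr_suml; apply: eq_bigr => i _; rewrite mulrA.
have ri (i : 'I_s'.+1) : rint mu I01 (fun x => x ^+ i * a x).
  by apply: rint_bdmI; apply: bdmM => //; exact: bdm_expI.
rewrite I1_sum; last by move=> i; exact: (rintZ measurable_I01).
by apply: eq_bigr => i _; rewrite I1Z// mulrC.
Qed.

Lemma smooth1_coproj a : smooth1 (coproj a).
Proof.
apply: smooth1_sum => i; apply: (@smooth1M _ (fun=> _)); first exact: smooth1_cst.
by have [] := tom i.
Qed.

Lemma test1_sub_coproj a : test1 a -> test1 (fun t => a t - coproj a t).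
Proof.
move=> ta; have [sa [a1 [a2 [a10 a12 a21 a0]]]] := ta.
have sB : smooth1 (fun t => a t - coproj a t).
  rewrite (_ : (fun t => _) = a \+ ((fun=> -1) \* coproj a)).
    by apply: smooth1D => //; apply: smooth1M; [exact: smooth1_cst|exact: smooth1_coproj].
  by apply/funext => t /=; rewrite mulN1r.
split=> //.
(* A support interval common to all [om i], enlarged one index at a time. *)
have supp : exists c d, [/\ 0 < c, c <= d, d < 1 & forall i, vanishes_off c d (om i)].
  pose P n := exists c d, [/\ 0 < c, c <= d, d < 1 &
    forall i : 'I_s'.+1, (i < n)%N -> vanishes_off c d (om i)].
  suff : P s'.+1 by move=> [c [d [h1 h2 h3 h]]]; exists c, d; split=> // i; exact: h.
  elim: (s'.+1) => [|n [c [d [c0 cd d1 h]]]].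
    by exists 2^-1, 2^-1; split=> //; lra.
  have [ns|ns] := ltnP n s'.+1; last first.
    by exists c, d; split=> // i _; apply: h; exact: (leq_trans (ltn_ord i)).
  have [_ [c' [d' [c0' cd' d1' h']]]] := tom (Ordinal ns).
  exists (Num.min c c'), (Num.max d d'); split.
  - by rewrite lt_min c0.
  - by rewrite ge_min (le_trans cd)// le_max lexx.
  - by rewrite gt_max d1.
  - move=> i; rewrite ltnS leq_eqVlt => /orP[/eqP ii|ii] x.
      rewrite (_ : i = Ordinal ns); last exact: val_inj.
      by rewrite le_min ge_max => /orP[/andP[_ x1]|/andP[_ x1]]; apply: h'; rewrite x1 ?orbT.
    by rewrite le_min ge_max => /orP[/andP[x1 _]|/andP[x1 _]]; apply: h => //; rewrite x1 ?orbT.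
have [c [d [c0 cd d1 h]]] := supp.
exists (Num.min a1 c), (Num.max a2 d); split.
- by rewrite lt_min c0 a10.
- by rewrite ge_min (le_trans a12)// le_max lexx.
- by rewrite gt_max d1 a21.
- move=> x; rewrite le_min ge_max => hx.
  rewrite a0 ?sub0r; last by case/orP: hx => /andP[-> _]; rewrite ?orbT.
  rewrite /coproj big1 ?oppr0// => i _.
  by rewrite h ?mulr0//; case/orP: hx => /andP[_ ->]; rewrite ?orbT.
Qed.

Lemma moments_sub_coproj a (j : nat) : test1 a -> (j <= s')%N ->
  I1 (fun x => x ^+ j * (a x - coproj a x)) = 0.
Proof.
move=> ta js; have ba := bdm_test1 ta; have be := bdm_expI.
have r1 : rint mu I01 (fun x => x ^+ j * a x) by apply: rint_bdmI; exact: bdmM.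
have r2 i : rint mu I01 (fun x => x ^+ j * om i x).
  by apply: rint_bdmI; apply: bdmM => //; exact: bdm_test1.
transitivity (I1 (fun x => x ^+ j * a x -
    \sum_(i < s'.+1) I1 (fun x => x ^+ i * a x) * (x ^+ j * om i x))).
  apply: eq_Rintegral => x _; rewrite mulrBr /coproj mulr_sumr; congr (_ - _).
  by apply: eq_bigr => i _; lra.
have r3 (i : 'I_s'.+1) : rint mu I01 (fun x => I1 (fun x => x ^+ i * a x) * (x ^+ j * om i x)).
  exact: (rintZ measurable_I01).
rewrite /I1 RintegralB//; last exact: (rint_sum measurable_I01).
rewrite -!/(I1 _) I1_sum//; apply/eqP; rewrite subr_eq0; apply/eqP.
have js' : (j < s'.+1)%N by [].
rewrite (bigD1 (Ordinal js'))//= I1Z// (momE _ (Ordinal js')) eqxx mulr1 big1 ?addr0// => i ij.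
by rewrite I1Z// (momE i (Ordinal js')) (negbTE ij) mulr0.
Qed.

Lemma rint_tensorM f a b : rint leb2 K f -> bdm I01 a -> bdm I01 b ->
  rint leb2 K (fun z => f z * (a z.1 * b z.2)).
Proof. by move=> fi ba bb; apply: (rintM _ fi) => //; exact: bdm_tensor. Qed.

Lemma iop_proj_dual f a b : rint leb2 K f -> bdm I01 a -> bdm I01 b ->
  intK (fun z => iop proj_kernel f z * (a z.1 * b z.2)) =
  intK (fun z => f z * (coproj a z.1 * b z.2)).
Proof.
move=> fi ba bb; rewrite (iop_dual bdm_proj_kernel fi ba bb); congr intK.
by apply/funext => z; rewrite proj_kernel_dual.
Qed.

Lemma rint_iop_proj f : rint leb2 K f -> rint leb2 K (iop proj_kernel f).
Proof. by move=> fi; have [mk [M kM]] := bdm_proj_kernel; exact: rint_iop kM _ fi. Qed.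

Lemma rint_iop_taylor f : rint leb2 K f -> rint leb2 K (iop taylor_kernel f).
Proof. by move=> fi; have [mk [M kM]] := bdm_taylor_kernel; exact: rint_iop kM _ fi. Qed.

Lemma taylor_kernel_dual (e : R -> R) t : continuous e -> 0 <= t <= 1 ->
  I1 (fun x => taylor_kernel (t, x) * e x) =
  \int[mu]_(x in `[0, t]) ((t - x) ^+ s' / s'`!%:R * e x).
Proof.
move=> ce /andP[t0 t1].
rewrite /I1 Rintegral_mkcond [RHS]Rintegral_mkcond; apply: eq_Rintegral => x _.
rewrite !patchE !mem_setE !in_itv/= /taylor_kernel /=.
have [x0|x0] /= := leP 0 x; last by [].
have [xt|tx] := leP x t; first by rewrite (le_trans xt t1) mul1r.
by rewrite !mul0r; case: ifP.
Qed.

(** Tested on a(x) b(y), the complement of the projection passes to [a] on both sides and leaves the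
    test function [a - coproj a]. What remains is the weak derivative relation for an antiderivative
    of that function. *)
Lemma approx_direction f g : rint leb2 K f -> rint leb2 K g ->
  tensor_weak_deriv s'.+1 0 f g ->
  {ae leb2, forall z, K z -> f z - iop proj_kernel f z =
    (-1) ^+ s'.+1 * (iop taylor_kernel g z - iop proj_kernel (iop taylor_kernel g) z)}.
Proof.
move=> fi gi fg; set sg := (-1) ^+ s'.+1; set G := iop taylor_kernel g.
have Gi : rint leb2 K G by exact: rint_iop_taylor.
have fpi := rint_iop_proj fi; have Gpi := rint_iop_proj Gi.
pose F := fun z => f z - iop proj_kernel f z - sg * (G z - iop proj_kernel G z).
have r1 : rint leb2 K (fun z => f z - iop proj_kernel f z) by exact: rintB.
have r2 : rint leb2 K (fun z => G z - iop proj_kernel G z) by exact: rintB.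
have r3 : rint leb2 K (fun z => sg * (G z - iop proj_kernel G z)) by exact: rintZ.
have Fi : rint leb2 K F by exact: rintB.
suff : {ae leb2, forall z, K z -> F z = 0}.
  by apply: filterS => z h Kz; apply/eqP; rewrite -subr_eq0; apply/eqP; exact: h.
apply: fundamental2 => // a b ta tb.
have ba := bdm_test1 ta; have bb := bdm_test1 tb.
have bc : bdm I01 (coproj a) by exact: (bdm_smooth1 0 1 (smooth1_coproj a)).
have te := test1_sub_coproj ta; have be := bdm_test1 te.
have split_dual h : rint leb2 K h ->
    intK (fun z => (h z - iop proj_kernel h z) * (a z.1 * b z.2)) =
    intK (fun z => h z * ((a z.1 - coproj a z.1) * b z.2)).
  move=> hi; have hpi := rint_iop_proj hi.
  transitivity (intK (fun z => h z * (a z.1 * b z.2) - iop proj_kernel h z * (a z.1 * b z.2))).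
    by congr intK; apply/funext => z; rewrite mulrBl.
  rewrite intKB; [|exact: rint_tensorM|exact: rint_tensorM].
  rewrite iop_proj_dual// -intKB; [|exact: rint_tensorM|exact: rint_tensorM].
  by congr intK; apply/funext => z; rewrite mulrBl mulrBr.
transitivity (intK (fun z => (f z - iop proj_kernel f z) * (a z.1 * b z.2) -
    sg * ((G z - iop proj_kernel G z) * (a z.1 * b z.2)))).
  by congr intK; apply/funext => z; rewrite /F mulrBl -(mulrA sg).
rewrite intKB; [|exact: rint_tensorM|by apply: rintZ => //; exact: rint_tensorM].
rewrite intKZ; last exact: rint_tensorM.
rewrite !split_dual//.
(* [A] is a test function whose derivative of order s'+1 is [a - coproj a]. Its closed form is the
   adjoint Taylor operator applied to that function, so the operator can be moved back onto [g]. *)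
have [|A [tA dA AE]] := derive_preimage te (s := s').
  by move=> j js; exact: moments_sub_coproj.
have := fg A b tA tb; rewrite dA addn0 /= -/sg => ->.
rewrite (iop_dual bdm_taylor_kernel gi be bb) -mulrBr.
apply/eqP; rewrite mulf_eq0 subr_eq0; apply/orP; right; apply/eqP.
apply: eq_Rintegral => -[t y] /set_mem [/= tI _]; congr (_ * (_ * _)).
have t01 : 0 <= t <= 1 by move: tI; rewrite /= in_itv.
rewrite AE; last by case/andP: t01.
rewrite taylor_kernel_dual//; exact: (smooth1_continuous (proj1 te)).
Qed.

End Direction.
End Approximation.

Section NormK.
Local Open Scope classical_set_scope.
Context {R : realType}.
Local Notation mu := (@lebesgue_measure R).
Local Notation MR := (measurableTypeR R).
Local Notation I01 := (`[0, 1]%classic : set MR).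
Local Notation plane := (MR * MR)%type.
Local Notation K := (@Khat R : set plane).
Implicit Types (a b : R -> R) (f g : plane -> R).
Variables (p : R) (hp : 1 <= p).

Lemma normLp_ge0 f : (0 <= normLp p f)%E.
Proof. exact: Lnorm_ge0. Qed.

Lemma normLp_le f g (M : R) : 0 <= M -> measurable_fun K f -> measurable_fun K g ->
  (forall z, K z -> `|f z| <= M * `|g z|) -> (normLp p f <= M%:E * normLp p g)%E.
Proof. by move=> M0 mf mg h; apply: le_Lnorm_pointwise. Qed.

Lemma normLp_ae f g : measurable_fun K f -> measurable_fun K g ->
  {ae leb2, forall z, K z -> f z = g z} -> normLp p f = normLp p g.
Proof. by move=> mf mg h; apply: Lnorm_ae. Qed.

Lemma normLpD f g : measurable_fun K f -> measurable_fun K g ->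
  (normLp p (fun z => f z + g z)%R <= normLp p f + normLp p g)%E.
Proof. by move=> mf mg; apply: Lnorm_triangle. Qed.

Lemma normLpB f g : measurable_fun K f -> measurable_fun K g ->
  (normLp p (fun z => f z - g z)%R <= normLp p f + normLp p g)%E.
Proof.
move=> mf mg; have mgN : measurable_fun K (fun z => - g z) by exact: measurableT_comp.
apply: (le_trans (normLpD mf mgN)); apply: leeD => //.
rewrite -[leRHS]mul1e; apply: normLp_le => // z _.
by rewrite normrN mul1r.
Qed.

Lemma normLp_swap f : measurable_fun K f -> normLp p (f \o swapxy) = normLp p f.
Proof.
move=> mf; have p0 : 0 < p by exact: lt_le_trans hp.
have E (g : plane -> R) : normLp p g = ((\int[leb2]_(z in K) (`|g z| `^ p)%:E) `^ (p^-1))%E.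
  exact: LnormE.
rewrite !E; apply: (congr1 (fun t => t `^ p^-1)%E).
apply: (ge0_integral_swap (F := fun z => (`|f z| `^ p)%:E)); first exact: measurable_powRn.
by move=> z _; rewrite lee_fin powR_ge0.
Qed.

Lemma intK_norm_le f : measurable_fun K f ->
  ((intK (fun z => `|f z|))%:E <= normLp p f)%E.
Proof.
move=> mf; have p0 : 0 < p by exact: lt_le_trans hp.
rewrite /normLp LnormE//.
have h : (\int[leb2]_(z in K) `|f z|%:E <= (\int[leb2]_(z in K) (`|f z| `^ p)%:E) `^ (p^-1))%E.
  by apply: integral_norm_le_Lp => //; exact: leb2_Khat.
apply: le_trans h; rewrite /intK /Rintegral; set x := (X in ((fine X)%:E <= _)%E).
have x0 : (0 <= x)%E by exact: integral_ge0.
change ((fine x)%:E <= x)%E; case: x x0 => [r||] //= _; exact: leey.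
Qed.

Lemma rint_normLp f : measurable_fun K f -> (normLp p f < +oo)%E -> rint leb2 K f.
Proof. by move=> mf h; apply: (rint_Lp (measurable_Khat (R := R)) hp leb2_Khat mf). Qed.

Lemma integral_Khat_cst (c : \bar R) : (\int[leb2]_(z in K) c = c)%E.
Proof.
transitivity (c * leb2 K)%E; first exact: (integral_cst leb2 (measurable_Khat (R := R)) c).
by rewrite leb2_Khat mule1.
Qed.

Lemma normLp_cst_le f (M : R) : 0 <= M -> measurable_fun K f ->
  (forall z, K z -> `|f z| <= M) -> (normLp p f <= M%:E)%E.
Proof.
move=> M0 mf h; rewrite -[leRHS]mule1.
have -> : 1%E = normLp p (fun=> 1 : R).
  have p0 : 0 < p by exact: lt_le_trans hp.
  rewrite /normLp LnormE// (_ : (\int[_]_(_ in _) _)%E = 1%E) ?poweR1r//.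
  transitivity (\int[leb2]_(z in K) 1)%E; last exact: integral_Khat_cst.
  by apply: eq_integral => z _; rewrite normr1 powR1.
by apply: normLp_le => // z Kz; rewrite normr1 mulr1; exact: h.
Qed.

End NormK.

Section TwoDirections.
Local Open Scope classical_set_scope.
Context {R : realType}.
Local Notation mu := (@lebesgue_measure R).
Local Notation MR := (measurableTypeR R).
Local Notation I01 := (`[0, 1]%classic : set MR).
Local Notation plane := (MR * MR)%type.
Local Notation K := (@Khat R : set plane).
Implicit Types (a b : R -> R) (f g : plane -> R).
Variables (p : R) (hp : 1 <= p).
Variables (s' : nat) (om : 'I_s'.+1 -> R -> R).
Hypothesis tom : forall i, test1 (om i).
Hypothesis momE : forall i j : 'I_s'.+1, I1 (fun x => x ^+ j * om i x) = (i == j)%:R.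

Local Notation P := (iop (proj_kernel om)).

Lemma normLp_proj : exists2 C : R, 0 <= C &
  forall f, measurable_fun K f -> (normLp p (P f) <= C%:E * normLp p f)%E.
Proof.
have [mk [M kM]] := bdm_proj_kernel tom.
exists M; first by apply: le_trans (kM (0, 0) _) => //; split; rewrite /= in_itv/= lexx ler01.
by move=> f mf; exact: normLp_iop.
Qed.

Lemma normLp_approx_x : exists2 C : R, 0 <= C & forall f g, rint leb2 K f -> rint leb2 K g ->
  tensor_weak_deriv s'.+1 0 f g -> (normLp p (fun z => f z - P f z)%R <= C%:E * normLp p g)%E.
Proof.
have [C C0 hC] := normLp_proj; have [mk [M kM]] := bdm_taylor_kernel (R := R) s'.
have M0 : 0 <= M by apply: le_trans (kM (0, 0) _) => //; split; rewrite /= in_itv/= lexx ler01.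
exists ((1 + C) * M); first by rewrite mulr_ge0// addr_ge0.
move=> f g fi gi fg; have h := approx_direction tom momE fi gi fg.
set G := iop (taylor_kernel s') g in h.
have Gi : rint leb2 K G by exact: rint_iop_taylor.
have GN : (normLp p G <= M%:E * normLp p g)%E by exact: normLp_iop (rint_measurable gi).
have mG := rint_measurable Gi; have PGN := hC _ mG.
have mPG := rint_measurable (rint_iop_proj tom Gi).
have mf := rint_measurable fi; have mPf := rint_measurable (rint_iop_proj tom fi).
move: (P G) (P f) mPf mPG PGN h => PG Pf mPf mPG PGN h.
move: G mG GN PGN h {Gi} => G mG GN PGN h.
have mB : measurable_fun K (fun z => G z - PG z) by exact: measurable_funB.
have msB : measurable_fun K (fun z => (-1) ^+ s'.+1 * (G z - PG z)) by exact: measurable_funM.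
rewrite (normLp_ae hp (measurable_funB mf mPf) msB h).
apply: (@le_trans _ _ (1%:E * normLp p (fun z => G z - PG z)%R)%E).
  apply: normLp_le => // z _.
  by rewrite normrM normrX normrN1 expr1n !mul1r.
rewrite mul1e; apply: (le_trans (normLpB hp mG mPG)).
apply: (@le_trans _ _ ((1 + C)%:E * normLp p G)%E).
  by rewrite EFinD ge0_muleDl ?lee_fin// mul1e leeD.
by rewrite EFinM -muleA lee_wpmul2l ?lee_fin ?addr_ge0.
Qed.

Definition proj_y f : plane -> R := P (f \o swapxy) \o swapxy.

Lemma rint_proj_y f : rint leb2 K f -> rint leb2 K (proj_y f).
Proof. by move=> fi; apply/rint_swap/rint_iop_proj/rint_swap. Qed.

Lemma tensor_weak_deriv_swap m n f g : rint leb2 K f -> rint leb2 K g ->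
  tensor_weak_deriv m n f g -> tensor_weak_deriv n m (f \o swapxy) (g \o swapxy).
Proof.
move=> fi gi h a b ta tb.
have bd c k : test1 c -> bdm I01 (iter k (@derive1 R R) c).
  by move=> [sc _]; apply: (bdm_smooth1 0 1); exact: smooth1_derive1n.
rewrite addnC.
have E h' c e : rint leb2 K h' -> bdm I01 c -> bdm I01 e ->
   intK (fun z => (h' \o swapxy) z * (c z.1 * e z.2)) = intK (fun z => h' z * (e z.1 * c z.2)).
  move=> hi bc be; rewrite -(intK_swap (rint_tensorM hi be bc)); congr intK.
  by apply/funext => z /=; rewrite [e _ * _]mulrC.
rewrite E//; [|exact: bd|exact: bd]; rewrite h// E//; [exact: bdm_test1|exact: bdm_test1].
Qed.

Lemma normLp_approx_y : exists2 C : R, 0 <= C & forall f g, rint leb2 K f -> rint leb2 K g ->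
  tensor_weak_deriv 0 s'.+1 f g -> (normLp p (fun z => f z - proj_y f z)%R <= C%:E * normLp p g)%E.
Proof.
have [C C0 hC] := normLp_approx_x; exists C => // f g fi gi fg.
have := hC _ _ (rint_swap fi) (rint_swap gi) (tensor_weak_deriv_swap fi gi fg).
rewrite (normLp_swap hp (rint_measurable gi)).
rewrite -(normLp_swap hp (f := fun z => f z - proj_y f z)); first by [].
apply: measurable_funB; first exact: rint_measurable fi.
exact: rint_measurable (rint_proj_y fi).
Qed.

(** Pointwise linearity could fail at ordinates where a slice is not integrable and the integral
    takes a default value; duality gives it almost everywhere. *)
Lemma proj_sub_ae f g : rint leb2 K f -> rint leb2 K g ->
  {ae leb2, forall z, K z -> P f z - P g z = P (fun z => f z - g z) z}.
Proof.
move=> fi gi; have fgi : rint leb2 K (fun z => f z - g z) by exact: rintB.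
have fpi := rint_iop_proj tom fi; have gpi := rint_iop_proj tom gi.
have fgpi := rint_iop_proj tom fgi.
pose F := fun z => (P f z - P g z) - P (fun z => f z - g z) z.
have di : rint leb2 K (fun z => P f z - P g z) by exact: rintB.
have Fi : rint leb2 K F by exact: rintB.
suff : {ae leb2, forall z, K z -> F z = 0}.
  by apply: filterS => z h Kz; apply/eqP; rewrite -subr_eq0; apply/eqP; exact: h.
apply: fundamental2 => // a b ta tb; have ba := bdm_test1 ta; have bb := bdm_test1 tb.
have bc : bdm I01 (coproj om a) by exact: (bdm_smooth1 0 1 (smooth1_coproj tom a)).
transitivity (intK (fun z => (P f z * (a z.1 * b z.2) - P g z * (a z.1 * b z.2)) -
    P (fun z => f z - g z) z * (a z.1 * b z.2))).
  by congr intK; apply/funext => z; rewrite /F !mulrBl.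
have r1 := rint_tensorM fpi ba bb; have r2 := rint_tensorM gpi ba bb.
have r3 := rint_tensorM fgpi ba bb.
rewrite intKB//; last exact: rintB.
rewrite intKB// !iop_proj_dual//.
apply/eqP; rewrite subr_eq0; apply/eqP; rewrite -intKB; [|exact: rint_tensorM|exact: rint_tensorM].
by congr intK; apply/funext => z; rewrite mulrBl.
Qed.

Definition proj_poly f (z : plane) : R :=
  \sum_(i < s'.+1) \sum_(j < s'.+1) intK (fun z => f z * (om i z.1 * om j z.2)) * (z.1 ^+ i * z.2 ^+ j).

Lemma bdm_monomial (i j : nat) : bdm K (fun z => z.1 ^+ i * z.2 ^+ j).
Proof. exact: (bdm_tensor (bdm_expI i) (bdm_expI j)). Qed.

Lemma bdm_proj_poly f : bdm K (proj_poly f).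
Proof.
apply: bdm_sum => i; apply: bdm_sum => j; apply: bdmM; first exact: bdm_cst.
exact: bdm_monomial.
Qed.

(** Tested on a(x) b(y), both sides become the same double sum of products of moments of [a] and [b]
    with the coefficients of [proj_poly]. *)
Lemma proj_polyE f : rint leb2 K f ->
  {ae leb2, forall z, K z -> P (proj_y f) z = proj_poly f z}.
Proof.
move=> fi; have Qi := rint_proj_y fi; have PQi := rint_iop_proj tom Qi.
have qi : rint leb2 K (proj_poly f) by exact/rint_bdmK/bdm_proj_poly.
pose F := fun z => P (proj_y f) z - proj_poly f z.
have Fi : rint leb2 K F by exact: rintB.
suff : {ae leb2, forall z, K z -> F z = 0}.
  by apply: filterS => z h Kz; apply/eqP; rewrite -subr_eq0; apply/eqP; exact: h.
apply: fundamental2 => // a b ta tb; have ba := bdm_test1 ta; have bb := bdm_test1 tb.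
have bca : bdm I01 (coproj om a) by exact: (bdm_smooth1 0 1 (smooth1_coproj tom a)).
have bcb : bdm I01 (coproj om b) by exact: (bdm_smooth1 0 1 (smooth1_coproj tom b)).
transitivity (intK (fun z => P (proj_y f) z * (a z.1 * b z.2) - proj_poly f z * (a z.1 * b z.2))).
  by congr intK; apply/funext => z; rewrite mulrBl.
rewrite intKB; [|exact: rint_tensorM|exact: rint_tensorM].
rewrite iop_proj_dual//.
have E h' c e : rint leb2 K h' -> bdm I01 c -> bdm I01 e ->
   intK (fun z => (h' \o swapxy) z * (c z.1 * e z.2)) = intK (fun z => h' z * (e z.1 * c z.2)).
  move=> hi bc be; rewrite -(intK_swap (rint_tensorM hi be bc)); congr intK.
  by apply/funext => z /=; rewrite [e _ * _]mulrC.
rewrite /proj_y E//; last exact/rint_iop_proj/rint_swap.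
rewrite iop_proj_dual//; last exact: rint_swap.
rewrite E//; apply/eqP; rewrite subr_eq0; apply/eqP.
pose m (c : R -> R) (i : nat) := I1 (fun x => x ^+ i * c x).
have bom i : bdm I01 (om i) by exact: bdm_test1.
have roo i j : rint leb2 K (fun z => f z * (om i z.1 * om j z.2)) by exact: rint_tensorM.
transitivity (\sum_(i < s'.+1) \sum_(j < s'.+1) (m a i * m b j) * intK (fun z => f z * (om i z.1 * om j z.2))).
  transitivity (intK (fun z => \sum_(i < s'.+1) \sum_(j < s'.+1) (m a i * m b j) * (f z * (om i z.1 * om j z.2)))).
    congr intK; apply/funext => z; rewrite /coproj mulr_suml mulr_sumr; apply: eq_bigr => i _.
    by rewrite mulr_sumr mulr_sumr; apply: eq_bigr => j _; rewrite /m; lra.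
  rewrite intK_sum; last by move=> i; apply: rint_sum => // j; exact: rintZ.
  apply: eq_bigr => i _; rewrite intK_sum; last by move=> j; exact: rintZ.
  by apply: eq_bigr => j _; rewrite intKZ.
have bmon c (i : nat) : bdm I01 c -> bdm I01 (fun x => x ^+ i * c x).
  by move=> bc; apply: bdmM => //; exact: bdm_expI.
have rmm (i j : nat) : rint leb2 K (tensor (fun x => x ^+ i * a x) (fun x => x ^+ j * b x)).
  by apply/rint_bdmK/bdm_tensor; exact: bmon.
symmetry; transitivity (intK (fun z => \sum_(i < s'.+1) \sum_(j < s'.+1)
    intK (fun z => f z * (om i z.1 * om j z.2)) *
    tensor (fun x => x ^+ i * a x) (fun x => x ^+ j * b x) z)).
  congr intK; apply/funext => z; rewrite /proj_poly mulr_suml; apply: eq_bigr => i _.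
  by rewrite mulr_suml; apply: eq_bigr => j _; rewrite /tensor; lra.
rewrite intK_sum; last by move=> i; apply: rint_sum => // j; exact: rintZ.
apply: eq_bigr => i _; rewrite intK_sum; last by move=> j; exact: rintZ.
apply: eq_bigr => j _; rewrite intKZ// intK_tensor; [|exact: bmon|exact: bmon].
by rewrite mulrC.
Qed.

(** With projections X in [x] and Y in [y], f - XYf = (f - Xf) + X(f - Yf): each term involves one
    pure derivative, and the second costs the norm [C3] of X. *)
Lemma normLp_approx : exists2 C : R, 0 <= C & forall f g1 g2,
  rint leb2 K f -> rint leb2 K g1 -> rint leb2 K g2 ->
  tensor_weak_deriv s'.+1 0 f g1 -> tensor_weak_deriv 0 s'.+1 f g2 ->
  (normLp p (fun z => f z - proj_poly f z)%R <= C%:E * (normLp p g1 + normLp p g2))%E.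
Proof.
have [C1 C10 h1] := normLp_approx_x; have [C2 C20 h2] := normLp_approx_y.
have [C3 C30 h3] := normLp_proj.
exists (C1 + C3 * C2); first by rewrite addr_ge0// mulr_ge0.
move=> f g1 g2 fi g1i g2i fg1 fg2.
have Qi := rint_proj_y fi; have PQi := rint_iop_proj tom Qi.
have Pfi := rint_iop_proj tom fi.
have qi : rint leb2 K (proj_poly f) by exact/rint_bdmK/bdm_proj_poly.
have ri : rint leb2 K (fun z => f z - proj_y f z) by exact: rintB.
have Pri := rint_iop_proj tom ri.
have d1 : rint leb2 K (fun z => f z - P f z) by exact: rintB.
have m1 := rint_measurable d1; have m2 := rint_measurable Pri.
have E : {ae leb2, forall z, K z -> f z - proj_poly f z =
   (f z - P f z) + P (fun z => f z - proj_y f z) z}.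
  have := proj_sub_ae fi Qi; have := proj_polyE fi; apply: filterS2 => z e1 e2 Kz.
  by rewrite -e2// e1//; lra.
rewrite (normLp_ae hp _ _ E); last 2 first.
- by apply: measurable_funB; [exact: rint_measurable fi|exact: rint_measurable qi].
- exact: measurable_funD.
apply: (le_trans (normLpD hp m1 m2)).
have N1 := normLp_ge0 p g1; have N2 := normLp_ge0 p g2.
have hh1 := h1 _ _ fi g1i fg1.
have hh2 : (normLp p (P (fun z => f z - proj_y f z)%R) <= (C3 * C2)%:E * normLp p g2)%E.
  apply: (le_trans (h3 _ (rint_measurable ri))).
  by rewrite EFinM -muleA lee_wpmul2l ?lee_fin//; exact: h2.
apply: (le_trans (leeD hh1 hh2)).
rewrite ge0_muleDr// leeD// lee_wpmul2r// lee_fin ?lerDl ?lerDr// mulr_ge0//.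
Qed.

End TwoDirections.

(** * Truncation to total degree and derivatives of a fixed order *)

Section Isotropic.
Local Open Scope classical_set_scope.
Context {R : realType}.
Local Notation mu := (@lebesgue_measure R).
Local Notation MR := (measurableTypeR R).
Local Notation I01 := (`[0, 1]%classic : set MR).
Local Notation plane := (MR * MR)%type.
Local Notation K := (@Khat R : set plane).
Implicit Types (a b : R -> R) (f g : plane -> R).
Variables (p : R) (hp : 1 <= p).
Variables (s' : nat) (om : 'I_s'.+1 -> R -> R).
Hypothesis tom : forall i, test1 (om i).
Hypothesis momE : forall i j : 'I_s'.+1, I1 (fun x => x ^+ j * om i x) = (i == j)%:R.

Lemma intK_norm_bdm f g (M : R) : rint leb2 K f -> measurable_fun K g ->
  (forall z, K z -> `|g z| <= M) -> `|intK (fun z => f z * g z)| <= M * intK (fun z => `|f z|).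
Proof.
move=> fi mg gM; have bg : bdm K g by split=> //; exists M.
have fgi : rint leb2 K (fun z => f z * g z) by exact: rintM.
apply: (le_trans (le_normr_Rintegral (measurable_Khat (R := R)) fgi)).
have fni : rint leb2 K (fun z => `|f z|) by exact: integrable_norm.
rewrite -intKZ//; apply: le_Rintegral => //.
- exact: integrable_norm.
- exact: rintZ.
- by move=> z Kz; rewrite normrM mulrC ler_wpM2r//; exact: gM.
Qed.

(** Biorthogonality kills the moments of [om i] of every order below [i], which is what [n]
    antiderivations consume. *)
Lemma om_preimage (i : 'I_s'.+1) (n : nat) : (n <= i)%N ->
  exists2 A, test1 A & iter n (@derive1 R R) A = om i.
Proof.
case: n => [|n] ni; first by exists (om i).
have [|A [tA dA _]] := derive_preimage (tom i) (s := n); last by exists A.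
move=> j jn; have js : (j < s'.+1)%N by rewrite (leq_ltn_trans jn)// (ltn_trans ni)//.
rewrite (momE i (Ordinal js)); case: eqP => // /(congr1 val)/= ij.
by move: ni; rewrite ij ltnNge jn.
Qed.

Lemma coef_le (i j : 'I_s'.+1) (m n : nat) : (m <= i)%N -> (n <= j)%N ->
  exists2 C : R, 0 <= C & forall f g, rint leb2 K g -> tensor_weak_deriv m n f g ->
    `|intK (fun z => f z * (om i z.1 * om j z.2))| <= C * intK (fun z => `|g z|).
Proof.
move=> mi nj; have [A tA <-] := om_preimage mi; have [B tB <-] := om_preimage nj.
have [mAB [M hM]] := bdm_tensor (bdm_test1 tA) (bdm_test1 tB).
exists M; first by apply: le_trans (hM (0, 0) _) => //; split; rewrite /= in_itv/= lexx ler01.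
move=> f g gi fg; rewrite fg// normrM normrX normrN1 expr1n mul1r.
exact: intK_norm_bdm.
Qed.

Definition proj_poly_total f (z : plane) : R :=
  \sum_(i < s'.+1) \sum_(j < s'.+1) (if (i + j <= s')%N
     then intK (fun z => f z * (om i z.1 * om j z.2)) else 0) * (z.1 ^+ i * z.2 ^+ j).

Lemma bdm_proj_poly_total f : bdm K (proj_poly_total f).
Proof.
apply: bdm_sum => i; apply: bdm_sum => j; apply: bdmM; first exact: bdm_cst.
exact: bdm_monomial.
Qed.

Lemma monomial_le1 (i j : nat) (z : plane) : K z -> `|z.1 ^+ i * z.2 ^+ j| <= 1.
Proof.
move=> [/=]; rewrite !in_itv/= => /andP[h1 h2] /andP[h3 h4].
by rewrite normrM !normrX mulr_ile1// exprn_ile1// ger0_norm.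
Qed.

Lemma normLp_approx_total : exists2 C : R, 0 <= C & forall f (D : nat -> plane -> R),
  rint leb2 K f -> (forall a : nat, (a <= s'.+1)%N -> rint leb2 K (D a)) ->
  (forall a : nat, (a <= s'.+1)%N -> tensor_weak_deriv a (s'.+1 - a) f (D a)) ->
  (normLp p (fun z => f z - proj_poly_total f z)%R <= C%:E * \sum_(a < s'.+2) normLp p (D a))%E.
Proof.
have [C1 C10 h1] := normLp_approx hp tom momE.
(* For a dropped term the derivative of order (i, s'+1-i) is chosen. It is admissible because s'+1
   <= i+j makes s'+1-i at most [j]; retained terms get the constant [0]. *)
have /choice[C2 hC2] : forall ij : 'I_s'.+1 * 'I_s'.+1, exists C : R, 0 <= C /\
    ((s' < ij.1 + ij.2)%N -> forall f g, rint leb2 K g -> tensor_weak_deriv ij.1 (s'.+1 - ij.1) f g ->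
    `|intK (fun z => f z * (om ij.1 z.1 * om ij.2 z.2))| <= C * intK (fun z => `|g z|)).
  move=> [i j] /=; have [ij|ij] := ltnP s' (i + j); last by exists 0.
  have [||C C0 hC] := @coef_le i j i (s'.+1 - i); [by []|by rewrite leq_subLR|].
  by exists C.
exists (C1 *+ 2 + \sum_ij C2 ij).
  by rewrite addr_ge0// ?mulrn_wge0// sumr_ge0// => ij _; have [] := hC2 ij.
move=> f D fi Di fD.
have N0 (a : nat) : (0 <= normLp p (D a))%E by exact: normLp_ge0.
set S := (\sum_(a < s'.+2) normLp p (D a))%E.
have S0 : (0 <= S)%E by apply: sume_ge0 => a _; exact: N0.
have DS (a : nat) : (a <= s'.+1)%N -> (normLp p (D a) <= S)%E.
  move=> al; rewrite /S (bigD1 (Ordinal (al : (a < s'.+2)%N)))//= leeDl//.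
  by apply: sume_ge0 => b _; exact: N0.
have qi : rint leb2 K (proj_poly om f) by exact/rint_bdmK/bdm_proj_poly.
have qti : rint leb2 K (proj_poly_total f) by exact/rint_bdmK/bdm_proj_poly_total.
have m1 : measurable_fun K (fun z => f z - proj_poly om f z).
  by apply: rint_measurable; exact: rintB qi.
have m2 : measurable_fun K (fun z => proj_poly om f z - proj_poly_total f z).
  by apply: rint_measurable; exact: rintB qti.
rewrite (_ : (fun z => _) = (fun z => (f z - proj_poly om f z) +
    (proj_poly om f z - proj_poly_total f z))); last by apply/funext => z; rewrite addrA subrK.
apply: (le_trans (normLpD hp m1 m2)).
have E1 : (normLp p (fun z => f z - proj_poly om f z)%R <= (C1 *+ 2)%:E * S)%E.
  (* The pure derivatives in [x] and [y] are the two ends of the family [D]. Each is bounded by the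
     whole sum [S], whence the factor 2. *)
  apply: (le_trans (h1 _ (D s'.+1) (D 0%N) fi (Di _ (leqnn _)) (Di _ (leq0n _)) _ _)).
  - by have := fD _ (leqnn _); rewrite subnn.
  - by have := fD _ (leq0n _); rewrite subn0.
  - rewrite mulr2n EFinD ge0_muleDl ?lee_fin// ge0_muleDr//.
    by apply: leeD; apply: lee_wpmul2l; rewrite ?lee_fin//; exact: DS.
have IS (a : nat) : (a <= s'.+1)%N -> ((intK (fun z => `|D a z|))%:E <= S)%E.
  move=> al; apply: le_trans (DS a al).
  exact: (intK_norm_le hp (rint_measurable (Di a al))).
have I0 (a : nat) : 0 <= intK (fun z => `|D a z|) by apply: Rintegral_ge0.
have E2 : (normLp p (fun z => proj_poly om f z - proj_poly_total f z)%R <=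
    (\sum_(ij : 'I_s'.+1 * 'I_s'.+1) C2 ij * intK (fun z => `|D ij.1 z|))%:E)%E.
  apply: (normLp_cst_le hp) => //.
    by apply: sumr_ge0 => ij _; rewrite mulr_ge0//; have [] := hC2 ij.
  move=> z Kz; rewrite /proj_poly /proj_poly_total -sumrB.
  rewrite (eq_bigr (fun i : 'I_s'.+1 => \sum_(j < s'.+1) (if (i + j <= s')%N then 0 else
     intK (fun z => f z * (om i z.1 * om j z.2))) * (z.1 ^+ i * z.2 ^+ j))); last first.
    move=> i _; rewrite -sumrB; apply: eq_bigr => j _; rewrite -mulrBl.
    by case: ifP; rewrite ?subrr ?subr0.
  rewrite pair_bigA /=; apply: (le_trans (ler_norm_sum _ _ _)); apply: ler_sum => -[i j] _ /=.
  have [C20 hC] := hC2 (i, j); rewrite /= in hC.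
  case: leqP => ij; first by rewrite mul0r normr0 mulr_ge0.
  rewrite normrM -[leRHS]mulr1 ler_pM//; last exact: monomial_le1.
  by apply: hC => //; [apply: Di|apply: fD]; apply: leqW; rewrite -ltnS.
apply: (le_trans (leeD E1 E2)).
have C2s : 0 <= \sum_ij C2 ij by apply: sumr_ge0 => ij _; have [] := hC2 ij.
rewrite (EFinD (C1 *+ 2)) (@ge0_muleDl _ _ (C1 *+ 2)%:E) ?lee_fin ?mulrn_wge0//.
apply: leeD => //; rewrite -!sumEFin ge0_sume_distrl; last first.
  by move=> ij _; rewrite lee_fin; have [] := hC2 ij.
apply: lee_sum => -[i j] _; rewrite EFinM lee_wpmul2l ?lee_fin//; first by have [] := hC2 (i, j).
by apply: IS; apply: leqW; rewrite -ltnS.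
Qed.

End Isotropic.

(** * Stability of the moments of polynomials *)

Section Stability.
Local Open Scope classical_set_scope.
Context {R : realType}.
Local Notation mu := (@lebesgue_measure R).
Local Notation MR := (measurableTypeR R).
Local Notation I01 := (`[0, 1]%classic : set MR).
Local Notation plane := (MR * MR)%type.
Local Notation K := (@Khat R : set plane).
Implicit Types (f g h : plane -> R).

Definition poly2 (n : nat) (c : 'I_n -> 'I_n -> R) (z : plane) : R :=
  \sum_(i < n) \sum_(j < n) c i j * (z.1 ^+ i * z.2 ^+ j).

Lemma bdm_poly2 n (c : 'I_n -> 'I_n -> R) : bdm K (poly2 c).
Proof.
apply: bdm_sum => i; apply: bdm_sum => j; apply: bdmM; first exact: bdm_cst.
exact: bdm_monomial.
Qed.

(** The one-variable argument is applied twice: the integral in [x] is a continuous nonnegative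
    function of [y] with zero integral, and then each slice is treated. Coefficients are read off
    one variable at a time. *)
Lemma poly2_sqr_eq0 n (c : 'I_n -> 'I_n -> R) :
  intK (fun z => poly2 c z * poly2 c z) = 0 -> forall i j, c i j = 0.
Proof.
pose P (j : 'I_n) (x : R) := \sum_(i < n) c i j * x ^+ i.
have sP j : smooth1 (P j).
  apply: smooth1_sum => i; apply: (@smooth1M _ (fun=> c i j)); first exact: smooth1_cst.
  exact: smooth1_exp.
have PE x y : poly2 c (x, y) = \sum_(j < n) P j x * y ^+ j.
  rewrite /poly2 exchange_big; apply: eq_bigr => j _; rewrite /P mulr_suml.
  by apply: eq_bigr => i _; rewrite mulrA.
have sX y : smooth1 (fun x => poly2 c (x, y) * poly2 c (x, y)).
  suff s : smooth1 (fun x => poly2 c (x, y)) by exact: smooth1M.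
  rewrite (_ : (fun x => _) = (fun x => \sum_(j < n) P j x * y ^+ j)); last exact/funext.
  by apply: smooth1_sum => j; apply: smooth1M (sP j) _; exact: smooth1_cst.
have rF : rint leb2 K (fun z => poly2 c z * poly2 c z).
  by apply: rint_bdmK; exact: bdmM (bdm_poly2 c) (bdm_poly2 c).
have [_ _ _ E] := fubiniK rF; rewrite E => {E}.
set phi := (fun y : R => _) => phi0.
have phiE y : phi y = \sum_(j < n) \sum_(j' < n) I1 (fun x => P j x * P j' x) * (y ^+ j * y ^+ j').
  rewrite /phi; transitivity (I1 (fun x => \sum_(j < n) \sum_(j' < n) (y ^+ j * y ^+ j') * (P j x * P j' x))).
    apply: eq_Rintegral => x _; rewrite PE mulr_suml; apply: eq_bigr => j _.
    by rewrite mulr_sumr; apply: eq_bigr => j' _; lra.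
  have r j j' : rint mu I01 (fun x => P j x * P j' x) by apply/rint_smooth1I/smooth1M.
  rewrite I1_sum; last by move=> j; apply: (rint_sum measurable_I01) => j'; exact: (rintZ measurable_I01).
  apply: eq_bigr => j _; rewrite I1_sum; last by move=> j'; exact: (rintZ measurable_I01).
  by apply: eq_bigr => j' _; rewrite I1Z// mulrC.
have cphi : continuous phi.
  rewrite (_ : phi = (fun y => \sum_(j < n) \sum_(j' < n) I1 (fun x => P j x * P j' x) * (y ^+ j * y ^+ j'))).
    apply: smooth1_continuous; apply: smooth1_sum => j; apply: smooth1_sum => j'.
    apply: (@smooth1M _ (fun=> _)); first exact: smooth1_cst.
    by apply: smooth1M; exact: smooth1_exp.
  exact/funext.
have phi_eq0 y : 0 < y < 1 -> phi y = 0.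
  apply: (continuous_ge0_I1_eq0 cphi) => // {}y _; apply: Rintegral_ge0 => // x _.
  by rewrite -expr2 sqr_ge0.
have poly2_eq0 x y : 0 < x < 1 -> 0 < y < 1 -> poly2 c (x, y) = 0.
  move=> x01 y01; have := continuous_ge0_I1_eq0 (smooth1_continuous (sX y)) _ (phi_eq0 y y01) x01.
  have h x' : 0 <= x' <= 1 -> 0 <= poly2 c (x', y) * poly2 c (x', y) by rewrite -expr2 sqr_ge0.
  by move=> /(_ h)/eqP; rewrite mulf_eq0 orbb => /eqP.
move=> i j; apply: (@sum_expr_eq0 _ n (c^~ j) 0 1) => // x x01.
apply: (@sum_expr_eq0 _ n (P^~ x) 0 1) => // y y01.
by rewrite -PE; exact: poly2_eq0.
Qed.

Variables (p : R) (hp : 1 <= p).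

(* The top monomial is excluded on both sides; [B] keeps the Gram matrix square by
   a trivial row and column in its place. *)
Lemma moment_stable n : exists2 C : R, 0 <= C & forall (c : 'I_n.+1 -> 'I_n.+1 -> R) h,
  c ord_max ord_max = 0 -> rint leb2 K h ->
  (forall i j : 'I_n.+1, (i, j) != (ord_max, ord_max) ->
     intK (fun z => poly2 c z * (z.1 ^+ i * z.2 ^+ j)) =
     intK (fun z => h z * (z.1 ^+ i * z.2 ^+ j))) ->
  (normLp p (poly2 c) <= C%:E * normLp p h)%E.
Proof.
pose I : finType := ('I_n.+1 * 'I_n.+1)%type; pose top : I := (ord_max, ord_max).
pose m (a : I) (z : plane) : R := z.1 ^+ a.1 * z.2 ^+ a.2.
pose G (a b : I) := intK (fun z => m a z * m b z).
pose B (a b : I) := if (a == top) || (b == top) then (a == b)%:R else G a b.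
have bm a : bdm K (m a) by exact: bdm_monomial.
have rm a b : rint leb2 K (fun z => m a z * m b z) by apply: rint_bdmK; exact: bdmM.
pose uc (c : I -> R) (i j : 'I_n.+1) := c (i, j).
have poly2E (c : I -> R) z : poly2 (uc c) z = \sum_a c a * m a z.
  by rewrite /poly2 pair_bigA; apply: eq_bigr => -[i j] _.
have Bc (c : I -> R) b : c top = 0 ->
    \sum_a c a * B a b = if b == top then 0 else \sum_a c a * G a b.
  move=> ct; have [->|bt] := eqVneq b top.
    by rewrite big1// => a _; rewrite /B eqxx orbT; case: eqVneq => [->|_]; rewrite ?ct ?mulr0 ?mul0r.
  apply: eq_bigr => a _; rewrite /B (negbTE bt) orbF; case: eqVneq => [->|//].
  by rewrite ct !mul0r.
have intKE (c : I -> R) b : intK (fun z => poly2 (uc c) z * m b z) = \sum_a c a * G a b.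
  transitivity (intK (fun z => \sum_a c a * (m a z * m b z))).
    congr intK; apply/funext => z; rewrite poly2E mulr_suml.
    by apply: eq_bigr => a _; rewrite mulrA.
  rewrite intK_sum; last by move=> a; exact: rintZ.
  by apply: eq_bigr => a _; rewrite intKZ.
have [N hN] : exists N : I -> I -> R, forall (c : I -> R) i,
    c i = \sum_j (\sum_i' c i' * B i' j) * N j i.
  apply: gram_dual => c hc.
  have ct : c top = 0.
    rewrite -[RHS](hc top) (bigD1 top)//= /B !eqxx/= mulr1 big1 ?addr0// => a /negbTE at_.
    by rewrite at_ orbT mulr0.
  have cG b : b != top -> \sum_a c a * G a b = 0.
    by move=> bt; rewrite -[RHS](hc b) Bc// (negbTE bt).
  (* The integral of the square is the sum over [b] of [c b] times the moment against [m b]: the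
     moment vanishes for [b] different from [top], and [c top] is [0]. *)
  suff /poly2_sqr_eq0 h : intK (fun z => poly2 (uc c) z * poly2 (uc c) z) = 0.
    by move=> [i j]; exact: h.
  transitivity (intK (fun z => \sum_b c b * (poly2 (uc c) z * m b z))).
    congr intK; apply/funext => z; rewrite {2}poly2E mulr_sumr; apply: eq_bigr => b _.
    by rewrite mulrCA.
  have r b : rint leb2 K (fun z => poly2 (uc c) z * m b z).
    by apply: rint_bdmK; exact: bdmM (bdm_poly2 _) (bm b).
  rewrite intK_sum; last by move=> b; exact: rintZ.
  rewrite big1// => b _; rewrite intKZ// intKE; have [->|bt] := eqVneq b top; first by rewrite ct mul0r.
  by rewrite cG ?mulr0.
exists (\sum_a \sum_b `|N b a|); first by apply: sumr_ge0 => a _; apply: sumr_ge0.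
move=> c h ctop hi hc; pose c' (a : I) := c a.1 a.2.
have hm b : `|intK (fun z => h z * m b z)| <= intK (fun z => `|h z|).
  rewrite -[leRHS]mul1r; apply: intK_norm_bdm => //; first by have [] := bm b.
  by move=> z Kz; exact: monomial_le1.
have ih0 : 0 <= intK (fun z => `|h z|) by exact: Rintegral_ge0.
(* Monomials are at most 1 on the square, so each moment of [h] is at most its L^1 norm; [N]
   converts moments into coefficients. *)
have c'le a : `|c' a| <= (\sum_b `|N b a|) * intK (fun z => `|h z|).
  rewrite hN mulr_suml; apply: (le_trans (ler_norm_sum _ _ _)); apply: ler_sum => b _.
  rewrite normrM mulrC ler_wpM2l// Bc//; case: eqVneq => bt; first by rewrite normr0.
  by rewrite -intKE; case: b bt => i j bt; rewrite hc//; exact: hm (i, j).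
apply: (@le_trans _ _ ((\sum_a \sum_b `|N b a|) * intK (fun z => `|h z|))%:E).
  apply: (normLp_cst_le hp); first by rewrite mulr_ge0// sumr_ge0// => a _; rewrite sumr_ge0.
    by have [] := bdm_poly2 c.
  move=> z Kz; rewrite (poly2E c') mulr_suml; apply: (le_trans (ler_norm_sum _ _ _)).
  apply: ler_sum => a _; rewrite normrM -[leRHS]mulr1 ler_pM//.
  exact: monomial_le1.
rewrite EFinM lee_wpmul2l ?lee_fin//; first by apply: sumr_ge0 => a _; apply: sumr_ge0.
exact: (intK_norm_le hp (rint_measurable hi)).
Qed.

End Stability.

Lemma continuous_comp_within (S T U : topologicalType) (A : set T) (f : T -> U) (g : S -> T) :
  {within A, continuous f} -> continuous g -> (forall x, A (g x)) -> continuous (f \o g).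
Proof.
move=> /subspace_continuousP cf cg gA x.
apply: (@cvg_comp _ _ _ g f (nbhs x) (within A (nbhs (g x)))); last exact: cf.
move=> B /cg h; apply: (@filterS _ (nbhs x)) h => y h; exact: h (gA y).
Qed.

(** * Green's formula *)

Section Slices.
Local Open Scope classical_set_scope.
Context {R : realType}.
Local Notation mu := (@lebesgue_measure R).
Local Notation MR := (measurableTypeR R).
Local Notation I01 := (`[0, 1]%classic : set MR).

(** The retraction onto [0, 1]. Composing with it extends a function continuous on the closed square
    to one continuous on the plane, with the same bound. *)
Definition clamp01 (x : R) := Num.max 0 (Num.min 1 x).

Lemma clamp01_itv x : 0 <= clamp01 x <= 1.
Proof. by rewrite /clamp01 le_max lexx/= ge_max ler01 ge_min lexx. Qed.

Lemma clamp01_id x : 0 <= x <= 1 -> clamp01 x = x.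
Proof. by move=> /andP[x0 x1]; rewrite /clamp01 (min_idPr x1) (max_idPr x0). Qed.

Lemma continuous_clamp01 : continuous clamp01.
Proof.
move=> x; apply: (@continuous_max R R (fun=> 0)); first exact: cvg_cst.
by apply: (@continuous_min R R (fun=> 1)); [exact: cvg_cst|exact: cvg_id].
Qed.

Lemma continuous_I1 (F : R * R -> R) : {within Khat, continuous F} ->
  {within `[0, 1], continuous (fun x => I1 (fun y => F (x, y)))}.
Proof.
move=> cF; pose c := clamp01; pose G x y := F (c x, c y).
have cI x : `[0, 1]%classic (c x) by rewrite /= in_itv /=; exact: clamp01_itv.
have cG1 y : continuous (G^~ y).
  apply: (continuous_comp_within cF (g := fun x => (c x, c y))); last by move=> x; split; exact: cI.
  by move=> x; apply: (@cvg_pair _ _ _ _ (nbhs (c x)) (nbhs (c y))); [exact: continuous_clamp01|exact: cvg_cst].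
have cG2 x : continuous (G x).
  apply: (continuous_comp_within cF (g := fun y => (c x, c y))); last by move=> y; split; exact: cI.
  by move=> y; apply: (@cvg_pair _ _ _ _ (nbhs (c x)) (nbhs (c y))); [exact: cvg_cst|exact: continuous_clamp01].
have cK : compact (@Khat R) by apply: compact_setX; exact: segment_compact.
have [M [_ hM]] := compact_bounded (continuous_compact cF cK).
have GM x y : `|G x y| <= M + 1.
  by apply: (hM (M + 1)); [rewrite ltrDl|exists (c x, c y) => //; split; exact: cI].
(* The parameter ranges over an open interval; ]-1, 2[ also covers the end points of [0, 1]. *)
have h := @continuity_under_integral R _ MR mu G I01 measurable_I01 (-1) 2 _ _ (fun=> M + 1) _ _.
apply: (@subspace_eq_continuous _ _ _ (fun x => I1 (G x))).
  move=> x /set_mem/=; rewrite in_itv/= => x01; apply: eq_Rintegral => y /set_mem/=; rewrite in_itv/= => y01.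
  by rewrite /G /c !clamp01_id.
apply: continuous_in_subspaceT => x /set_mem/=; rewrite in_itv/= => /andP[x0 x1].
apply: h.
- by move=> t _; apply: rint_continuous; exact: continuous_within.
- by apply: aeW => y _ t _; exact: cG1.
- exact: rint_bdmI (bdm_cst _ _).
- by move=> t _; apply: aeW => y _; exact: GM.
- by rewrite inE/= in_itv/=; lra.
Qed.

(* A relation known for compactly supported test functions acquires the boundary
   terms of [W] when tested against arbitrary smooth functions. *)
Lemma extend_test (phi W : R -> R) : rint mu I01 phi -> {within `[0, 1], continuous W} ->
  (forall b, test1 b -> I1 (fun x => phi x * b x) + I1 (fun x => W x * derive1 b x) = 0) ->
  forall q, smooth1 q ->
  I1 (fun x => phi x * q x) + I1 (fun x => W x * derive1 q x) = W 1 * q 1 - W 0 * q 0.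
Proof.
move=> phi_i cW h q sq.
have [eta [te e01 ce dce]] := cutoff_seq (lexx 0) (@ltr01 R) (lexx 1).
have sW : {within `[0, 1], continuous (fun x => W x * q x)}.
  by apply: within_continuousM => //; apply: continuous_within; exact: smooth1_continuous.
have bW := bdm_continuous cW.
have bq : bdm I01 q by exact: (bdm_smooth1 0 1).
have bdq : bdm I01 (derive1 q) by apply: (bdm_smooth1 0 1); exact: smooth1_derive1.
have cut f : rint mu I01 f -> I1 (fun x => f x * eta n x) @[n --> \oo] --> I1 f.
  move=> fi; have mf := rint_measurable fi.
  have bi : bdm I01 (fun x : R => if 0 < x < 1 then 1 else 0 : R).
    split; last by exists 1 => x _; case: ifP; rewrite ?normr1 ?normr0.
    apply: measurable_funTS; apply: measurable_fun_ifT => //.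
    by apply: measurable_and => //; apply: measurable_fun_ltr.
  have -> : I1 f = I1 (fun x => f x * (if 0 < x < 1 then 1 else 0)).
    apply: ae_I1 => //; first exact: rintM.
    have := ae_neq (0 : R); have := ae_neq (1 : R); apply: filterS2 => x x1 x0 xI.
    suff -> : 0 < x < 1 by rewrite mulr1.
    by move: xI; rewrite /= in_itv/= !le_eqVlt => /andP[/orP[/eqP/esym//|->] /orP[/eqP//|->]].
  apply: (Rintegral_dominated measurable_I01 (g := fun x => `|f x|)).
  - move=> n; apply: measurable_funM => //; by have [] := bdm_test1 (te n).
  - exact: integrable_norm.
  - move=> n x _; rewrite normrM ler_piMr// ger0_norm; by have /andP[] := e01 n x.
  - by move=> x _; apply: cvgM; [exact: cvg_cst|exact: ce].
pose f1 x := phi x * q x; pose f2 x := W x * derive1 q x.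
have f1i : rint mu I01 f1 by exact: rintM.
have f2i : rint mu I01 f2 by apply: rint_bdmI; exact: bdmM.
(* The relation tested at [eta n] times [q], expanded by the product rule. The term carrying the
   derivative of [eta n] tends to the boundary values. *)
have E n : I1 (fun x => f1 x * eta n x) + (I1 (fun x => W x * q x * derive1 (eta n) x) +
    I1 (fun x => f2 x * eta n x)) = 0.
  have [se _] := te n.
  rewrite -[RHS](h _ (test1M (te n) sq)); congr (_ + _).
    by apply: eq_Rintegral => x _; rewrite /f1 /=; lra.
  have be := bdm_test1 (te n).
  have bde : bdm I01 (derive1 (eta n)) by apply: (bdm_smooth1 0 1); exact: smooth1_derive1.
  rewrite /I1 -RintegralD//; last 2 first.
  - by apply: rint_bdmI; apply: bdmM => //; exact: bdmM.
  - exact: rintM.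
  apply: eq_Rintegral => x _; rewrite derive1M; [|by move=> y; exact: smooth1_derivable..].
  by rewrite /f2 /=; lra.
have L : I1 f1 + ((W 0 * q 0 - W 1 * q 1) + I1 f2) = 0.
  have : I1 (fun x => f1 x * eta n x) + (I1 (fun x => W x * q x * derive1 (eta n) x) +
    I1 (fun x => f2 x * eta n x)) @[n --> \oo] --> I1 f1 + ((W 0 * q 0 - W 1 * q 1) + I1 f2).
    by apply: cvgD; [exact: cut|apply: cvgD; [exact: dce|exact: cut]].
  rewrite (_ : (fun n => _) = (fun=> 0)); last by apply/funext => n; exact: E.
  by move=> /cvg_unique; apply => //; exact: cvg_cst.
rewrite -/f1 -/f2; lra.
Qed.

End Slices.

Section Green.
Local Open Scope classical_set_scope.
Context {R : realType}.
Local Notation mu := (@lebesgue_measure R).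
Local Notation MR := (measurableTypeR R).
Local Notation I01 := (`[0, 1]%classic : set MR).
Local Notation plane := (MR * MR)%type.
Local Notation K := (@Khat R : set plane).
Implicit Types (a b p q : R -> R) (f d : plane -> R) (u : R * R -> R * R).

Lemma intK_fst f a : rint leb2 K f -> bdm I01 a ->
  intK (fun z => f z * a z.1) = I1 (fun x => I1 (fun y => f (x, y)) * a x).
Proof.
move=> fi ba; rewrite -(intK_snd (rint_swap fi) ba) -intK_swap //.
by apply: rintM => //; exact: bdm_fstK.
Qed.

Definition boundary_flux (tr : face -> (R -> R) -> R) (phi : R * R -> R) : R :=
  tr Left (phi \o face_pt Left) + tr Right (phi \o face_pt Right) +
  tr Bottom (phi \o face_pt Bottom) + tr Top (phi \o face_pt Top).

Lemma continuous_fst_within (T : topologicalType) (A : set T) (u : T -> R * R) :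
  {within A, continuous u} -> {within A, continuous (fst \o u)}.
Proof. by move=> cu x; apply: cvg_comp (cu x) _; exact: cvg_fst. Qed.

Lemma continuous_snd_within (T : topologicalType) (A : set T) (u : T -> R * R) :
  {within A, continuous u} -> {within A, continuous (snd \o u)}.
Proof. by move=> cu x; apply: cvg_comp (cu x) _; exact: cvg_snd. Qed.

Lemma within_continuousMK (f g : R * R -> R) :
  {within Khat, continuous f} -> {within Khat, continuous g} ->
  {within Khat, continuous (fun z => f z * g z)}.
Proof. by move=> cf cg x; apply: cvgM; [exact: cf|exact: cg]. Qed.

Lemma within_continuous_fstK a : continuous a ->
  {within (@Khat R), continuous (fun z : R * R => a z.1)}.
Proof.
move=> ca; apply: continuous_subspaceT => z.
by apply: (@continuous_comp _ _ _ fst a); [exact: cvg_fst|exact: ca].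
Qed.

Lemma continuous_swapxy : continuous (@swapxy R : R * R -> R * R).
Proof. move=> z; apply: (@cvg_pair _ _ _ _ (nbhs z.2) (nbhs z.1) _ _ _ snd fst); [exact: cvg_snd|exact: cvg_fst]. Qed.

Lemma within_continuous_swapK (f : R * R -> R) :
  {within Khat, continuous f} -> {within Khat, continuous (f \o swapxy)}.
Proof.
move=> /subspace_continuousP cf; apply/subspace_continuousP => z Kz.
apply: (@cvg_comp _ _ _ swapxy f _ (within Khat (nbhs (swapxy z)))); last by apply: cf; exact/swap_Khat.
move=> B h; have := continuous_swapxy h; rewrite /= !nbhs_simpl /within /=.
by apply: filterS => y hy Ky; apply: hy; exact/swap_Khat.
Qed.

Lemma intK_dot_grad u p q : rint leb2 K (fst \o u) -> rint leb2 K (snd \o u) ->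
  smooth1 p -> smooth1 q ->
  intK (fun z => dot (u z) (grad (tensor p q) z)) =
  intK (fun z => (u z).1 * (derive1 p z.1 * q z.2)) +
  intK (fun z => (u z).2 * (p z.1 * derive1 q z.2)).
Proof.
move=> u1 u2 sp sq; have b r : smooth1 r -> bdm I01 r by exact: (bdm_smooth1 0 1).
rewrite -intKD; last 2 first.
- by apply: (rint_tensorM u1); apply: b => //; exact: smooth1_derive1.
- by apply: (rint_tensorM u2); apply: b => //; exact: smooth1_derive1.
congr intK; apply/funext => z; rewrite /dot /grad /=.
by rewrite dx_tensor ?dy_tensor// => x; exact: smooth1_derivable.
Qed.

(** Compact support is removed from one factor at a time by [extend_test]: [y] produces the fluxes
    through the bottom and top faces, then [x] those through the left and right ones. *)
Lemma green_continuous u d : {within Khat, continuous u} ->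
  rint leb2 K (fst \o u) -> rint leb2 K (snd \o u) -> rint leb2 K d ->
  (forall a b, test1 a -> test1 b ->
     intK (fun z => dot (u z) (grad (tensor a b) z)) = - intK (fun z => d z * tensor a b z)) ->
  forall p q, smooth1 p -> smooth1 q ->
  intK (fun z => dot (u z) (grad (tensor p q) z)) + intK (fun z => d z * tensor p q z) =
  boundary_flux (flux u) (tensor p q).
Proof.
move=> cu u1i u2i di H.
have c1 := continuous_fst_within cu; have c2 := continuous_snd_within cu.
pose u1 z := (u z).1; pose u2 z := (u z).2.
have v1 : rint leb2 K u1 by exact: u1i.
have v2 : rint leb2 K u2 by exact: u2i.
have bs r : smooth1 r -> bdm I01 r by exact: (bdm_smooth1 0 1).
have bds r : smooth1 r -> bdm I01 (derive1 r) by move=> sr; apply/bs/smooth1_derive1.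
have bdF (r : MR -> R) : bdm I01 r -> bdm K (fun z : plane => r z.1) := @bdm_fstK R r.
have bdS (r : MR -> R) : bdm I01 r -> bdm K (fun z : plane => r z.2) := @bdm_sndK R r.
have slice y (f : R * R -> R) : 0 <= y <= 1 -> {within Khat, continuous f} -> bdm I01 (fun x => f (x, y)).
  move=> y01 cf; apply: (@bdm_continuous _ 0 1); have := cf; move=> /subspace_continuousP h.
  apply/subspace_continuousP => x x01.
  apply: (@cvg_comp _ _ _ (fun x => (x, y)) f _ (within Khat (nbhs (x, y)))); last first.
    by apply: h; split=> //=; rewrite in_itv.
  move=> B hB; have : nbhs x ((fun x => (x, y)) @^-1` [set z | Khat z -> B z]).
    have c : (fun x : R => (x, y)) x' @[x' --> x] --> (x, y).
      apply: (@cvg_pair _ _ _ (nbhs x) (nbhs x) (nbhs y) _ _ _ id (fun=> y)); [exact: cvg_id|exact: cvg_cst].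
    exact: c hB.
  by apply: filterS => x' hx' x'01; apply: hx'; split=> //=; rewrite in_itv.
pose W a y := I1 (fun x => u2 (x, y) * a x).
have cW a : smooth1 a -> {within `[0, 1], continuous (W a)}.
  move=> sa; apply: (@continuous_I1 _ (fun z => u2 (swapxy z) * a (swapxy z).1)).
  apply: (within_continuous_swapK (f := fun z => u2 z * a z.1)); apply: within_continuousMK => //.
  exact/within_continuous_fstK/smooth1_continuous.
(* Extension in [y] while the first factor is still a test function; [W a 0] and [W a 1] carry the
   fluxes through the bottom and top faces. *)
have step1 a q : test1 a -> smooth1 q ->
    intK (fun z => (u1 z * derive1 a z.1 + d z * a z.1) * q z.2) +
    intK (fun z => (u2 z * a z.1) * derive1 q z.2) = W a 1 * q 1 - W a 0 * q 0.
  move=> ta sq; have [sa _] := ta.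
  have r1 : rint leb2 K (fun z => u1 z * derive1 a z.1) by apply: rintM => //; exact: (bdF _ (bds _ sa)).
  have r2 : rint leb2 K (fun z => d z * a z.1) by apply: rintM => //; exact: (bdF _ (bs _ sa)).
  have r3 : rint leb2 K (fun z => u2 z * a z.1) by apply: rintM => //; exact: (bdF _ (bs _ sa)).
  have r12 := rintD (measurable_Khat (R := R)) r1 r2.
  rewrite !intK_snd//; [|exact: bds|exact: bs].
  apply: extend_test => //; first by have [] := fubiniK r12.
    exact: (cW a sa).
  move=> b tb; have [sb _] := tb.
  rewrite -(intK_snd r12 (bs _ sb)) -(intK_snd r3 (bds _ sb)).
  have := H a b ta tb; rewrite intK_dot_grad// => E.
  transitivity (intK (fun z => u1 z * (derive1 a z.1 * b z.2)) + intK (fun z => d z * tensor a b z)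
     + intK (fun z => u2 z * (a z.1 * derive1 b z.2))); last first.
    have sum0 (x y z : R) : x + y = - z -> x + z + y = 0 by lra.
    exact: sum0 E.
  congr (_ + _); last by congr intK; apply/funext => z; rewrite mulrA.
  rewrite -intKD; [|by apply: (rint_tensorM v1); [exact: bds|exact: bs]|by apply: rint_tensorM => //; exact: bs].
  by congr intK; apply/funext => z; rewrite /tensor /=; lra.
move=> p q sp sq.
pose V x := I1 (fun y => u1 (x, y) * q y).
have cV : {within `[0, 1], continuous V}.
  apply: (@continuous_I1 _ (fun z => u1 z * q z.2)); apply: within_continuousMK => //.
  apply: (within_continuous_swapK (f := fun z => q z.1)).
  exact/within_continuous_fstK/smooth1_continuous.
pose bd x := u2 (x, 1) * q 1 - u2 (x, 0) * q 0.
have b1 : bdm I01 (fun x => u2 (x, 1)) by apply: slice => //; rewrite lexx ler01.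
have b0 : bdm I01 (fun x => u2 (x, 0)) by apply: slice => //; rewrite lexx ler01.
have bdi : bdm I01 bd.
  rewrite (_ : bd = (fun x => u2 (x, 1) * q 1) \+ (fun x => u2 (x, 0) * (- q 0))); last first.
    by apply/funext => x; rewrite /bd /= mulrN.
  by apply: bdmD; [exact: bdmM b1 (bdm_cst _ _)|exact: bdmM b0 (bdm_cst _ _)].
have Ibd a : smooth1 a -> I1 (fun x => bd x * a x) = W a 1 * q 1 - W a 0 * q 0.
  move=> sa; have r1 : rint mu I01 (fun x => u2 (x, 1) * a x) by apply: rint_bdmI; apply: bdmM b1 _; exact: bs.
  have r0 : rint mu I01 (fun x => u2 (x, 0) * a x) by apply: rint_bdmI; apply: bdmM b0 _; exact: bs.
  rewrite [W a 1 * _]mulrC [W a 0 * _]mulrC /W -!I1Z// /I1 -RintegralB//; last 2 first.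
  - exact: (rintZ measurable_I01).
  - exact: (rintZ measurable_I01).
  by apply: eq_Rintegral => x _; rewrite /bd; lra.
have rq1 : rint leb2 K (fun z => u2 z * derive1 q z.2) by apply: rintM => //; exact: (bdS _ (bds _ sq)).
have rq2 : rint leb2 K (fun z => d z * q z.2) by apply: rintM => //; exact: (bdS _ (bs _ sq)).
have rq3 : rint leb2 K (fun z => u1 z * q z.2) by apply: rintM => //; exact: (bdS _ (bs _ sq)).
have rbd : rint leb2 K (fun z => bd z.1) by apply: rint_bdmK; exact: bdF.
(* Subtracting [bd], the difference of the top and bottom fluxes weighted by [q], absorbs these
   boundary terms into the density. The relation in [x] then has right side [0], as [extend_test]
   requires. *)
pose f0 z := (u2 z * derive1 q z.2 + d z * q z.2) - bd z.1.
have rq12 := rintD (measurable_Khat (R := R)) rq1 rq2.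
have rf0 : rint leb2 K f0 by exact: rintB.
have intKbd a : smooth1 a -> intK (fun z => bd z.1 * a z.1) = I1 (fun x => bd x * a x).
  move=> sa; rewrite (intK_fst rbd (bs _ sa)); apply: eq_Rintegral => x _.
  by congr (_ * _); exact: (I1_cst (bd x)).
have E0 a : smooth1 a -> intK (fun z => f0 z * a z.1) =
    intK (fun z => u2 z * (a z.1 * derive1 q z.2)) + intK (fun z => d z * tensor a q z) -
    (W a 1 * q 1 - W a 0 * q 0).
  move=> sa; rewrite -Ibd// -intKbd// -intKD; last 2 first.
  - by apply: (rint_tensorM v2); [exact: bs|exact: bds].
  - by apply: rint_tensorM => //; exact: bs.
  rewrite -intKB; last 2 first.
  - apply: rintD => //; last by apply: rint_tensorM => //; exact: bs.
    by apply: (rint_tensorM v2); [exact: bs|exact: bds].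
  - by apply: rintM => //; exact: (bdF _ (bs _ sa)).
  by congr intK; apply/funext => z; rewrite /f0 /tensor; lra.
have := @extend_test _ (fun x => I1 (fun y => f0 (x, y))) V _ cV _ p sp.
rewrite -(intK_fst rf0 (bs _ sp)) -(intK_fst rq3 (bds _ sp)) E0//.
have [rphi _ _ _] := fubiniK rf0.
have hE : forall a, test1 a -> I1 (fun x => I1 (fun y => f0 (x, y)) * a x) +
    I1 (fun x => V x * derive1 a x) = 0.
  move=> a ta; have [sa _] := ta.
  rewrite -(intK_fst rf0 (bs _ sa)) -(intK_fst rq3 (bds _ sa)) E0//.
  have := step1 a q ta sq.
  have -> : intK (fun z => (u1 z * derive1 a z.1 + d z * a z.1) * q z.2) =
     intK (fun z => u1 z * q z.2 * derive1 a z.1) + intK (fun z => d z * tensor a q z).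
    rewrite -intKD; [|by apply: rintM => //; exact: (bdF _ (bds _ sa))|by apply: rint_tensorM => //; exact: bs].
    by congr intK; apply/funext => z; rewrite /tensor; lra.
  have -> : (fun z => u2 z * a z.1 * derive1 q z.2) = (fun z => u2 z * (a z.1 * derive1 q z.2)).
    by apply/funext => z; rewrite mulrA.
  lra.
move=> /(_ rphi hE) E; rewrite intK_dot_grad//.
have -> : intK (fun z => (u z).1 * (derive1 p z.1 * q z.2)) = intK (fun z => u1 z * q z.2 * derive1 p z.1).
  by congr intK; apply/funext => z; rewrite /u1; lra.
have fl (g : R -> R) (c e : R) (h : R -> R) : rint mu I01 g -> (forall t, h t = c * e * g t) -> 
    I1 h = c * (I1 g * e).
  move=> gi hE'; rewrite (_ : h = fun t => c * e * g t); last exact/funext.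
  by rewrite I1Z//; lra.
have rV x : 0 <= x <= 1 -> rint mu I01 (fun y => u1 (x, y) * q y).
  move=> x01; apply: rint_bdmI; apply: bdmM; last exact: bs.
  apply: (slice x (u1 \o swapxy)) => //; exact: within_continuous_swapK.
have rW y : 0 <= y <= 1 -> rint mu I01 (fun x => u2 (x, y) * p x).
  by move=> y01; apply: rint_bdmI; apply: bdmM; [exact: (slice y u2)|exact: bs].
rewrite /boundary_flux.
have -> : flux u Left (tensor p q \o face_pt Left) = -1 * (V 0 * p 0).
  apply: fl => [|t]; first by apply: rV; rewrite lexx ler01.
  by rewrite /dot /tensor /u1 /=; lra.
have -> : flux u Right (tensor p q \o face_pt Right) = 1 * (V 1 * p 1).
  apply: fl => [|t]; first by apply: rV; rewrite lexx ler01.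
  by rewrite /dot /tensor /u1 /=; lra.
have -> : flux u Bottom (tensor p q \o face_pt Bottom) = -1 * (W p 0 * q 0).
  apply: fl => [|t]; first by apply: rW; rewrite lexx ler01.
  by rewrite /dot /tensor /u2 /=; lra.
have -> : flux u Top (tensor p q \o face_pt Top) = 1 * (W p 1 * q 1).
  apply: fl => [|t]; first by apply: rW; rewrite lexx ler01.
  by rewrite /dot /tensor /u2 /=; lra.
move: E; rewrite /u2; lra.
Qed.

End Green.

(** * Polynomial fields and the range of their divergence *)

Section PolynomialFields.
Local Open Scope classical_set_scope.
Context {R : realType}.
Local Notation mu := (@lebesgue_measure R).
Local Notation MR := (measurableTypeR R).
Local Notation I01 := (`[0, 1]%classic : set MR).
Local Notation plane := (MR * MR)%type.
Local Notation K := (@Khat R : set plane).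
Implicit Types (a b p q : R -> R) (f : R * R -> R) (w : R * R -> R * R).

Definition monomial (i j : nat) : R * R -> R := fun z => z.1 ^+ i * z.2 ^+ j.

Lemma continuous_fun_sum (T : topologicalType) (I : Type) (r : seq I) (F : I -> T -> R) :
  (forall i, continuous (F i)) -> continuous (fun x => \sum_(i <- r) F i x).
Proof.
move=> cF; elim: r => [|i r ih].
  by under eq_fun do rewrite big_nil; move=> x; exact: cvg_cst.
under eq_fun do rewrite big_cons; move=> x; apply: cvgD; [exact: cF|exact: ih].
Qed.

Lemma QpolyE m n f : Qpoly m n f -> exists c : 'M[R]_(m, n),
  f = fun z => \sum_(i < m) \sum_(j < n) c i j * monomial i j z.
Proof.
move=> [c h]; exists c; apply/funext => z; rewrite h; apply: eq_bigr => i _.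
by apply: eq_bigr => j _; rewrite /monomial mulrA.
Qed.

Lemma continuous_Qpoly m n f : Qpoly m n f -> continuous f.
Proof.
move=> /QpolyE[c ->]; apply: continuous_fun_sum => i; apply: continuous_fun_sum => j z.
apply: (@cvgM _ _ _ _ (fun=> c i j)); first exact: cvg_cst.
by apply: (continuous_tensor (a := fun x => x ^+ i) (b := fun x => x ^+ j)); exact: exprn_continuous.
Qed.

Lemma bdm_Qpoly m n f : Qpoly m n f -> bdm K f.
Proof.
move=> /QpolyE[c ->]; apply: bdm_sum => i; apply: bdm_sum => j; apply: bdmM; first exact: bdm_cst.
exact: bdm_monomial.
Qed.

Lemma Qpoly_swap m n f : Qpoly m n f -> Qpoly n m (f \o swapxy).
Proof.
move=> [c h]; exists c^T => z /=; rewrite h exchange_big; apply: eq_bigr => j _.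
by apply: eq_bigr => i _; rewrite mxE /swapxy /= mulrAC.
Qed.

Lemma dy_swap f : dy f = dx (f \o swapxy) \o swapxy.
Proof. by []. Qed.

(** For [i = 0] the truncated exponent [i.-1] is harmless, since the factor [i%:R] is then [0]. *)
Lemma dx_Qpoly m n (c : 'M[R]_(m, n)) :
  dx (fun z => \sum_(i < m) \sum_(j < n) c i j * monomial i j z) =
  fun z => \sum_(i < m) \sum_(j < n) (c i j * i%:R) * monomial i.-1 j z.
Proof.
apply/funext => -[x y]; rewrite /dx /=.
pose P : {poly R} := \sum_(i < m) (\sum_(j < n) c i j * y ^+ j) *: 'X^i.
rewrite (_ : (fun t => _) = horner P); last first.
  apply/funext => t; rewrite horner_sum; apply: eq_bigr => i _.
  rewrite hornerZ hornerXn mulr_suml; apply: eq_bigr => j _.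
  by rewrite /monomial /=; lra.
rewrite -derivE raddf_sum horner_sum; apply: eq_bigr => i _.
rewrite /= derivZ derivXn hornerZ hornerMn hornerXn mulr_suml; apply: eq_bigr => j _.
by rewrite /monomial /= -mulr_natr; lra.
Qed.

Lemma is_derive_exprn (i : nat) (x : R) :
  is_derive x (1 : R) (fun x : R => x ^+ i) (i%:R * x ^+ i.-1).
Proof.
rewrite (_ : (fun x => _) = horner 'X^i); last by apply/funext => t; rewrite hornerXn.
apply: DeriveDef; first exact: derivable_horner.
by rewrite -derive1E -derivE derivXn hornerMn hornerXn mulr_natl.
Qed.

Lemma ibp_test1 a (i : nat) : test1 a ->
  I1 (fun x => x ^+ i * derive1 a x) = - (i%:R * I1 (fun x => x ^+ i.-1 * a x)).
Proof.
move=> ta; have [sa [c [e [c0 ce e1 a0]]]] := ta.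
have da x : is_derive x (1 : R) a (derive1 a x).
  by rewrite derive1E; apply: DeriveDef => //; exact: smooth1_derivable.
have dX := is_derive_exprn i.
rewrite /I1 (ibp ler01 dX _ da); last 2 first.
- exact/smooth1_continuous/(@smooth1M _ (fun=> i%:R) _ (smooth1_cst _))/smooth1_exp.
- exact/smooth1_continuous/smooth1_derive1.
rewrite !a0 ?(ltW c0) ?(ltW e1) ?orbT// !mulr0 subrr sub0r; congr (- _).
rewrite -I1Z; first by apply: eq_Rintegral => x _; rewrite mulrA.
by apply: rint_bdmI; apply: bdmM; [exact: bdm_expI|exact: bdm_test1].
Qed.

(** The exponent map [e] lets one formula serve a polynomial, with [id], and its derivative in [x],
    with [predn]. *)
Lemma intK_sum_monomial m n (c : 'M[R]_(m, n)) (e : nat -> nat) a b :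
  bdm I01 a -> bdm I01 b ->
  intK (fun z => (\sum_(i < m) \sum_(j < n) c i j * monomial (e i) j z) * tensor a b z) =
  \sum_(i < m) \sum_(j < n) c i j * (I1 (fun x => x ^+ e i * a x) * I1 (fun y => y ^+ j * b y)).
Proof.
move=> ba bb; have bx (i : nat) g : bdm I01 g -> bdm I01 (fun x => x ^+ i * g x).
  by move=> bg; apply: bdmM => //; exact: bdm_expI.
pose T (i j : nat) := tensor (fun x => x ^+ i * a x) (fun y => y ^+ j * b y).
have rT i j : rint leb2 K (T i j) by apply/rint_bdmK/bdm_tensor; exact: bx.
transitivity (intK (fun z => \sum_(i < m) \sum_(j < n) c i j * T (e i) j z)).
  congr intK; apply/funext => z; rewrite mulr_suml; apply: eq_bigr => i _.
  rewrite mulr_suml; apply: eq_bigr => j _; rewrite /T /tensor /monomial; lra.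
rewrite intK_sum; last by move=> i; apply: rint_sum => // j; exact: rintZ.
apply: eq_bigr => i _; rewrite intK_sum; last by move=> j; exact: rintZ.
by apply: eq_bigr => j _; rewrite intKZ// intK_tensor//; exact: bx.
Qed.

Lemma weak_dx_Qpoly m n f a b : Qpoly m n f -> test1 a -> test1 b ->
  intK (fun z => f z * tensor (derive1 a) b z) = - intK (fun z => dx f z * tensor a b z).
Proof.
move=> /QpolyE[c ->] ta tb; have [sa _] := ta; rewrite dx_Qpoly.
have bda : bdm I01 (derive1 a) by apply: (bdm_smooth1 0 1); exact: smooth1_derive1.
have ba := bdm_test1 ta; have bb := bdm_test1 tb.
rewrite (intK_sum_monomial c id bda bb).
have := intK_sum_monomial (\matrix_(i, j) (c i j * i%:R)) predn ba bb.
set X := intK _ => E; transitivity (- X); last first.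
  rewrite /X; congr (- intK _); apply/funext => z; congr (_ * _).
  by apply: eq_bigr => i _; apply: eq_bigr => j _; rewrite mxE.
rewrite E -sumrN; apply: eq_bigr => i _; rewrite -sumrN; apply: eq_bigr => j _.
by rewrite mxE ibp_test1//; lra.
Qed.

Lemma bdm_dx_Qpoly m n f : Qpoly m n f -> bdm K (dx f).
Proof.
move=> /QpolyE[c ->]; rewrite dx_Qpoly; apply: bdm_sum => i; apply: bdm_sum => j.
apply: bdmM; first exact: bdm_cst.
exact: bdm_monomial.
Qed.

Lemma bdm_swap f : bdm K f -> bdm K (f \o swapxy).
Proof.
move=> [mf [M fM]]; split; first exact: (measurable_swapK R mf).
by exists M => z Kz; apply: fM; exact/swap_Khat.
Qed.

Lemma weak_dy_Qpoly m n f a b : Qpoly m n f -> test1 a -> test1 b ->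
  intK (fun z => f z * tensor a (derive1 b) z) = - intK (fun z => dy f z * tensor a b z).
Proof.
move=> Qf ta tb; have Qs := Qpoly_swap Qf; have [sb _] := tb.
have bdb : bdm I01 (derive1 b) by apply: (bdm_smooth1 0 1); exact: smooth1_derive1.
have ba := bdm_test1 ta; have bb := bdm_test1 tb.
have := weak_dx_Qpoly Qs tb ta.
have r1 : rint leb2 K (fun z => (f \o swapxy) z * tensor (derive1 b) a z).
  by apply: rint_bdmK; apply: bdmM (bdm_Qpoly Qs) _; exact: bdm_tensor.
have r2 : rint leb2 K (fun z => dx (f \o swapxy) z * tensor b a z).
  by apply: rint_bdmK; apply: bdmM (bdm_dx_Qpoly Qs) _; exact: bdm_tensor.
rewrite -(intK_swap r1) -(intK_swap r2).
have E (g h : R * R -> R) (c e : R -> R) : (forall z, g (swapxy z) = h z) ->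
    intK ((fun z => g z * tensor c e z) \o swapxy) = intK (fun z => h z * tensor e c z).
  by move=> gh; congr intK; apply/funext => z /=; rewrite gh /tensor /= [c _ * _]mulrC.
by rewrite (E _ f)=> [|[]//]; rewrite (E _ (dy f))=> [|[]//].
Qed.

Lemma bdm_diverg k w : ABF k w -> bdm K (diverg w).
Proof.
move=> [Q1 Q2]; apply: bdmD; first exact: bdm_dx_Qpoly Q1.
by rewrite dy_swap; apply: bdm_swap; exact: bdm_dx_Qpoly (Qpoly_swap Q2).
Qed.

(** The classical divergence of a polynomial field is also its divergence in the sense of test
    functions, by integration by parts on monomials; so [green_continuous] applies. *)
Lemma green_ABF k w p q : ABF k w -> smooth1 p -> smooth1 q ->
  intK (fun z => dot (w z) (grad (tensor p q) z)) + intK (fun z => diverg w z * tensor p q z) =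
  boundary_flux (flux w) (tensor p q).
Proof.
move=> Aw; have [Q1 Q2] := Aw.
have r1 : rint leb2 K (fst \o w) by exact/rint_bdmK/(bdm_Qpoly Q1).
have r2 : rint leb2 K (snd \o w) by exact/rint_bdmK/(bdm_Qpoly Q2).
have rd : rint leb2 K (diverg w) by exact/rint_bdmK/(bdm_diverg Aw).
apply: green_continuous => //.
  apply: continuous_subspaceT => z.
  rewrite (_ : w = fun z => ((fst \o w) z, (snd \o w) z)); last by apply/funext => t /=; case: (w t).
  apply: (@cvg_pair _ _ _ (nbhs z) (nbhs ((fst \o w) z)) (nbhs ((snd \o w) z))).
    exact: (continuous_Qpoly Q1).
  exact: (continuous_Qpoly Q2).
move=> a b ta tb; have [sa _] := ta; have [sb _] := tb; rewrite intK_dot_grad//.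
have ba := bdm_test1 ta; have bb := bdm_test1 tb.
have := weak_dx_Qpoly Q1 ta tb; have := weak_dy_Qpoly Q2 ta tb; rewrite /tensor /= => -> ->.
have d1 : rint leb2 K (dx (fst \o w)) by exact/rint_bdmK/(bdm_dx_Qpoly Q1).
have d2 : rint leb2 K (dy (snd \o w)).
  by rewrite dy_swap; apply/rint_bdmK/bdm_swap; exact: (bdm_dx_Qpoly (Qpoly_swap Q2)).
rewrite -opprD -intKD; [|exact: rint_tensorM|exact: rint_tensorM].
by congr (- intK _); apply/funext => z; rewrite /diverg mulrDl.
Qed.

(* The space [P] of the introduction is [trunc_poly k.+1]. *)
Definition trunc_poly n : set (R * R -> R) := [set f | exists c : 'I_n.+1 -> 'I_n.+1 -> R,
  c ord_max ord_max = 0 /\ f = poly2 c].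

Lemma trunc_polyD n f g : trunc_poly n f -> trunc_poly n g -> trunc_poly n (fun z => f z + g z).
Proof.
move=> [c [c0 ->]] [e [e0 ->]]; exists (fun i j => c i j + e i j); rewrite c0 e0 addr0; split=> //.
apply/funext => z; rewrite /poly2 -big_split; apply: eq_bigr => i _.
by rewrite -big_split; apply: eq_bigr => j _ /=; rewrite mulrDl.
Qed.

Lemma trunc_polyZ n (t : R) f : trunc_poly n f -> trunc_poly n (fun z => t * f z).
Proof.
move=> [c [c0 ->]]; exists (fun i j => t * c i j); rewrite c0 mulr0; split=> //.
apply/funext => z; rewrite /poly2 mulr_sumr; apply: eq_bigr => i _.
by rewrite mulr_sumr; apply: eq_bigr => j _; rewrite mulrA.
Qed.

Lemma trunc_poly_sum n (I : Type) (r : seq I) (F : I -> R * R -> R) :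
  (forall i, trunc_poly n (F i)) -> trunc_poly n (fun z => \sum_(i <- r) F i z).
Proof.
move=> tF; elim: r => [|i r ih].
  under eq_fun do rewrite big_nil; exists (fun _ _ => 0); split=> //.
  by apply/funext => z; rewrite /poly2 !big1// => i _; rewrite !big1// => j _; rewrite mul0r.
under eq_fun do rewrite big_cons; exact: trunc_polyD.
Qed.

Lemma trunc_poly_monomial n (i j : nat) : (i <= n)%N -> (j <= n)%N -> (i, j) != (n, n) ->
  trunc_poly n (monomial i j).
Proof.
move=> i_n j_n ij; exists (fun i' j' => ((val i', val j') == (i, j))%:R); split.
  by rewrite /= eq_sym (negbTE ij).
apply/funext => z; rewrite /poly2.
rewrite (bigD1 (Ordinal (i_n : (i < n.+1)%N)))//= (bigD1 (Ordinal (j_n : (j < n.+1)%N)))//=.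
rewrite eqxx mul1r !big1 ?addr0// => [i' /eqP ii|j' /eqP jj].
  rewrite big1// => j' _; case: eqP => [[ii' _]|]; last by rewrite mul0r.
  by case: ii; apply: val_inj.
case: eqP => [[jj']|]; last by rewrite mul0r.
by case: jj; apply: val_inj.
Qed.

(** Derivation lowers the degree in [x] to at most k+1, while the degree in [y] stays at most [k];
    this excludes the top monomial. *)
Lemma trunc_poly_dx k f : Qpoly k.+3 k.+1 f -> trunc_poly k.+1 (dx f).
Proof.
move=> /QpolyE[c ->]; rewrite dx_Qpoly; apply: trunc_poly_sum => i; apply: trunc_poly_sum => j.
apply: trunc_polyZ; apply: trunc_poly_monomial.
- by case: i => -[].
- exact: ltnW.
- by apply/eqP => -[_ jk]; have := ltn_ord j; rewrite jk ltnn.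
Qed.

Lemma trunc_poly_swap n f : trunc_poly n f -> trunc_poly n (f \o swapxy).
Proof.
move=> [c [c0 ->]]; exists (fun i j => c j i); split=> //.
apply/funext => z; rewrite /poly2 /= exchange_big; apply: eq_bigr => j _.
by apply: eq_bigr => i _; rewrite /swapxy /= [z.2 ^+ _ * _]mulrC.
Qed.

Lemma trunc_poly_diverg k w : ABF k w -> trunc_poly k.+1 (diverg w).
Proof.
move=> [Q1 Q2]; apply: trunc_polyD; first exact: trunc_poly_dx.
by rewrite dy_swap; apply/trunc_poly_swap/trunc_poly_dx/Qpoly_swap.
Qed.

End PolynomialFields.

(** * Moments of the divergence of an interpolant and quasi-optimality *)

Section Interpolant.
Local Open Scope classical_set_scope.
Context {R : realType}.
Local Notation mu := (@lebesgue_measure R).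
Local Notation MR := (measurableTypeR R).
Local Notation I01 := (`[0, 1]%classic : set MR).
Local Notation plane := (MR * MR)%type.
Local Notation K := (@Khat R : set plane).
Implicit Types (f d : R * R -> R) (u w : R * R -> R * R).

Lemma derive1_exprn (i : nat) : derive1 (fun x : R => x ^+ i) = fun x => i%:R * x ^+ i.-1.
Proof. by apply/funext => x; rewrite derive1E; case: (is_derive_exprn i x). Qed.

(** The degree condition is imposed only for nonzero [t]: the derivative of a constant must belong
    even to the trivial spaces that occur for [k = 0]. *)
Lemma Qpoly_monomial (m n i j : nat) (t : R) : (t != 0 -> (i < m)%N && (j < n)%N) ->
  Qpoly m n (fun z => t * monomial i j z).
Proof.
have [-> _|t0 /(_ isT)/andP[im jn]] := eqVneq t 0.
  by exists 0 => z; rewrite mul0r big1// => i' _; rewrite big1// => j' _; rewrite mxE !mul0r.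
exists (\matrix_(i', j') if (val i' == i) && (val j' == j) then t else 0) => z.
rewrite (bigD1 (Ordinal im))//= (bigD1 (Ordinal jn))//= mxE !eqxx/= /monomial mulrA.
rewrite !big1 ?addr0// => [i' ii|j' jj].
  rewrite big1// => j' _; rewrite mxE (_ : (val i' == i) = false) ?mul0r//.
  by apply: contraNF ii => /eqP ii; apply/eqP/val_inj.
rewrite mxE eqxx/= (_ : (val j' == j) = false) ?mul0r//.
by apply: contraNF jj => /eqP jj; apply/eqP/val_inj.
Qed.

(** Gradients of these monomials are admissible in the interior conditions, so the volume terms in
    the Green identities of the field and of its interpolant agree. *)
Lemma Qvec_grad_monomial k (i j : nat) : (i <= k)%N -> (j <= k)%N ->
  Qvec k k.+1 k.+1 k (grad (@monomial R i j)).
Proof.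
move=> ik jk; have dX n x : derivable (fun x : R => x ^+ n) x 1 by exact/smooth1_derivable/smooth1_exp.
split.
- rewrite (_ : fst \o _ = fun z => i%:R * monomial i.-1 j z).
    by apply: Qpoly_monomial; case: i ik => [|i] ik; rewrite ?eqxx//= ik ltnS.
  apply/funext => z; rewrite /= (dx_tensor (fun y => y ^+ j) (dX i)) derive1_exprn.
  by rewrite /tensor /monomial mulrA.
- rewrite (_ : snd \o _ = fun z => j%:R * monomial i j.-1 z).
    by apply: Qpoly_monomial; case: j jk => [|j] jk; rewrite ?eqxx//= jk ltnS ik.
  apply/funext => z; rewrite /= (dy_tensor (fun x => x ^+ i) (dX j)) derive1_exprn.
  by rewrite /tensor /monomial mulrCA.
Qed.

(** In the first alternative of [face_moments] Green's formula is derived from the weak divergence;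
    in the second it is part of the data. *)
Lemma green_face_moments u d tr : memL1_vec u -> weak_div u d -> rint leb2 K d ->
  face_moments u d tr -> forall p q, smooth1 p -> smooth1 q ->
  intK (fun z => dot (u z) (grad (tensor p q) z)) + intK (fun z => d z * tensor p q z) =
  boundary_flux tr (tensor p q).
Proof.
move=> [u1 u2] [_ ud] di [[cu ->]|[_ h]] p q sp sq; last by apply: h; exact: smooth_tensor.
apply: green_continuous => // a b ta tb; apply: ud; exact: test_fun_tensor.
Qed.

Lemma face_monomial (F : face) k (i j : nat) : (i <= k)%N -> (j <= k)%N ->
  exists2 q : {poly R}, (size q <= k.+1)%N & monomial i j \o face_pt F = horner q.
Proof.
have szX (c : R) n : (n <= k)%N -> (size (c *: 'X^n : {poly R}) <= k.+1)%N.
  by move=> nk; apply: (leq_trans (size_scale_leq _ _)); rewrite size_polyXn ltnS.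
move=> ik jk; case: F.
- exists (0 ^+ i *: 'X^j); first exact: szX.
  by apply/funext => t; rewrite hornerZ hornerXn.
- exists (1 ^+ i *: 'X^j); first exact: szX.
  by apply/funext => t; rewrite hornerZ hornerXn.
- exists (0 ^+ j *: 'X^i); first exact: szX.
  by apply/funext => t; rewrite hornerZ hornerXn mulrC.
- exists (1 ^+ j *: 'X^i); first exact: szX.
  by apply/funext => t; rewrite hornerZ hornerXn mulrC.
Qed.

Lemma div_moments k u w d (i j : nat) : memL1_vec u -> weak_div u d -> rint leb2 K d ->
  ABF_interpolant k u d w -> (i <= k.+1)%N -> (j <= k.+1)%N -> (i, j) != (k.+1, k.+1) ->
  intK (fun z => (diverg w z - d z) * (z.1 ^+ i * z.2 ^+ j)) = 0.
Proof.
move=> uL ud di [Aw [tr utr [hface hvol hx hy]]] ik jk ij.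
(* An exponent [k.+1] falls under one of the two divergence conditions. If it occurs in [x], the
   excluded pair forces the exponent of [y] to be at most [k]. *)
have [ik'|ki] := leqP i k; last first.
  have ii : i = k.+1 by apply/eqP; rewrite eqn_leq ik.
  move: ij; rewrite ii xpair_eqE eqxx /= => jk'.
  by apply: hy; rewrite -ltnS ltn_neqAle jk'.
have [jk'|kj] := leqP j k; last first.
  have jj : j = k.+1 by apply/eqP; rewrite eqn_leq jk.
  by rewrite jj; exact: hx.
have sX n : smooth1 (fun x : R => x ^+ n) by exact: smooth1_exp.
have Gw := green_ABF Aw (sX i) (sX j).
have Gu := green_face_moments uL ud di utr (sX i) (sX j).
have E : boundary_flux (flux w) (tensor (fun x => x ^+ i) (fun x => x ^+ j)) =
         boundary_flux tr (tensor (fun x => x ^+ i) (fun x => x ^+ j)).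
  have e F : flux w F (monomial i j \o face_pt F) = tr F (monomial i j \o face_pt F).
    have [q qk ->] := face_monomial F ik' jk'.
    by apply/eqP; rewrite -subr_eq0; apply/eqP; exact: hface.
  by rewrite /boundary_flux; congr (_ + _ + _ + _); exact: e.
have [Q1 Q2] := Aw; have [u1 u2] := uL.
have V : intK (fun z => dot (w z) (grad (monomial i j) z)) =
         intK (fun z => dot (u z) (grad (monomial i j) z)).
  apply/eqP; rewrite -subr_eq0 -intKB.
  - rewrite -[X in _ == X](hvol _ (Qvec_grad_monomial ik' jk')); apply/eqP; congr intK.
    by apply/funext => z; rewrite /dot /=; lra.
  - have [g1 g2] := Qvec_grad_monomial ik' jk'.
    by apply/rint_bdmK/bdmD; [exact: bdmM (bdm_Qpoly Q1) (bdm_Qpoly g1)|exact: bdmM (bdm_Qpoly Q2) (bdm_Qpoly g2)].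
  - have [g1 g2] := Qvec_grad_monomial ik' jk'.
    by apply: rintD => //; [exact: (rintM _ u1 (bdm_Qpoly g1))|exact: (rintM _ u2 (bdm_Qpoly g2))].
have bm := bdm_monomial (R := R) i j.
have rd : rint leb2 K (fun z => d z * (z.1 ^+ i * z.2 ^+ j)) by exact: rintM.
have rw : rint leb2 K (fun z => diverg w z * (z.1 ^+ i * z.2 ^+ j)).
  by apply: rint_bdmK; exact: bdmM (bdm_diverg Aw) bm.
transitivity (intK (fun z => diverg w z * (z.1 ^+ i * z.2 ^+ j) - d z * (z.1 ^+ i * z.2 ^+ j))).
  by congr intK; apply/funext => z; rewrite mulrBl.
rewrite intKB//; have sub0 (x y z t : R) : x + y = z + t -> x = z -> y - t = 0 by lra.
by apply: sub0 V; rewrite [LHS]Gw [RHS]Gu.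
Qed.

Variables (p : R) (hp : 1 <= p).

(** The difference of [diverg w] and [q] lies in the truncated space and has the same moments as
    [d - q], so [moment_stable] bounds it. The triangle inequality adds the 1 to the constant. *)
Lemma div_error_le k : exists2 C : R, 0 <= C & forall u w d q,
  memL1_vec u -> weak_div u d -> rint leb2 K d -> ABF_interpolant k u d w ->
  trunc_poly k.+1 q ->
  (normLp p (fun z => d z - diverg w z)%R <= C%:E * normLp p (fun z => d z - q z)%R)%E.
Proof.
have [C C0 hC] := moment_stable hp k.+1; exists (1 + C); first by rewrite addr_ge0.
move=> u w d q uL ud di uw tq; have [Aw _] := uw.
have [c [c0 rE]] := trunc_polyD (trunc_poly_diverg Aw) (trunc_polyZ (-1) tq).
have bq : bdm K q by have [c' [_ ->]] := tq; exact: bdm_poly2.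
have bw := bdm_diverg Aw.
have br : bdm K (poly2 c) by exact: bdm_poly2.
have rh : rint leb2 K (fun z => d z - q z) by apply: rintB => //; exact: rint_bdmK.
have rN : (normLp p (poly2 c) <= C%:E * normLp p (fun z => d z - q z)%R)%E.
  apply: hC => // i j ij; have bm := bdm_monomial (R := R) i j.
  have ij' : (i : nat, j : nat) != (k.+1, k.+1).
    by apply: contraNneq ij => -[ii jj]; apply/eqP; congr pair; exact: val_inj.
  have := div_moments uL ud di uw (leq_ord i) (leq_ord j) ij' => M.
  apply/eqP; rewrite -subr_eq0 -intKB.
  - rewrite -[X in _ == X]M; apply/eqP; congr intK; apply/funext => z.
    by rewrite -rE; lra.
  - by apply: rint_bdmK; exact: bdmM br bm.
  - exact: rintM.
have mh := rint_measurable rh; have [mr _] := br.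
rewrite (_ : (fun z => _) = (fun z => (d z - q z) - poly2 c z)); last first.
  by apply/funext => z; rewrite -rE; lra.
apply: (le_trans (normLpB hp mh mr)).
rewrite EFinD ge0_muleDl ?lee_fin// mul1e; exact: leeD.
Qed.

End Interpolant.

Theorem theorem2p4 (R : realType) (k l : nat) (p : R)
    (hl1 : (1 <= l)%N) (hlk : (l <= k.+2)%N) (hp : 1 <= p) :
  (exists2 C : R, 0 < C &
    forall (u w : R * R -> R * R) (d : R * R -> R) (D : nat -> R * R -> R),
      memL1_vec u -> weak_div u d -> sobolev l p d ->
      ABF_interpolant k u d w ->
      (forall a : nat, (a <= l)%N -> weak_deriv a (l - a) d (D a)) ->
      (normLp p (d \- diverg w)%R
         <= C%:E * \sum_(a < l.+1) normLp p (D a))%E)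
  /\
  (forall s : nat, (1 <= s)%N -> (s <= k.+1)%N ->
    exists2 C : R, 0 < C &
    forall (u w : R * R -> R * R) (d gx gy : R * R -> R),
      memL1_vec u -> weak_div u d -> sobolev l p d ->
      ABF_interpolant k u d w ->
      weak_deriv s 0 d gx -> weak_deriv 0 s d gy ->
      (normLp p (d \- diverg w)%R
         <= C%:E * (normLp p gx + normLp p gy))%E).
Proof.
have [C C0 hC] := div_error_le hp k.
(* The derivatives on the right may have infinite norm, and then the bound is trivial because the
   constant is positive; the added 1 ensures this even if [C * C1] is [0]. In the other case
   finiteness is available for proving [y <= C1 * z]. *)
have scale (x y z : \bar R) (C1 : R) : 0 <= C1 -> (0 <= z)%E ->
    (x <= C%:E * y)%E -> ((z < +oo)%E -> (y <= C1%:E * z)%E) -> (x <= (C * C1 + 1)%:E * z)%E.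
  move=> C10 z0 xy yz; have [zoo|] := ltP z +oo%E; last first.
    by rewrite leye_eq => /eqP ->; rewrite gt0_muley ?leey// lte_fin ltr_wpDl// mulr_ge0.
  apply: (le_trans xy); apply: (@le_trans _ _ ((C * C1)%:E * z)%E).
    by rewrite EFinM -muleA lee_wpmul2l ?lee_fin//; exact: yz.
  by rewrite lee_wpmul2r// lee_fin lerDl.
split.
  case: l hl1 hlk => // s' _ hs.
  have [om [tom momE]] := @biorthogonal R s'.+1.
  have [C1 C10 h1] := normLp_approx_total hp tom momE.
  exists (C * C1 + 1); first by rewrite ltr_wpDl// mulr_ge0.
  move=> u w d D uL ud [[md dfin] _] uw hD.
  have di := rint_normLp hp md dfin.
  (* The total degree is at most s' <= k+1, which is less than the degree 2k+2 of the excluded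
     monomial. *)
  have tq : trunc_poly k.+1 (proj_poly_total om d).
    apply: trunc_poly_sum => i; apply: trunc_poly_sum => j; case: leqP => ij; last first.
      rewrite (_ : (fun z => _) = (fun z => 0 * monomial 0 0 z)).
        exact/trunc_polyZ/trunc_poly_monomial.
      by apply/funext => z; rewrite !mul0r.
    apply: trunc_polyZ; apply: trunc_poly_monomial.
    - exact: leq_trans (ltn_ord i) hs.
    - exact: leq_trans (ltn_ord j) hs.
    - apply/eqP => -[ik jk]; have := leq_ltn_trans ij hs; rewrite ik jk.
      by rewrite addSn addnS !ltnS ltnNge leq_addr.
  have N0 (a : nat) : (0 <= normLp p (D a))%E by exact: normLp_ge0.
  apply: scale (hC _ _ _ _ uL ud di uw tq) _ => //; first by apply: sume_ge0 => a _; exact: N0.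
  (* A finite sum of nonnegative norms makes each derivative an L^p function, hence an integrable
     one. *)
  move=> Dfin; have Di (a : nat) : (a <= s'.+1)%N -> rint leb2 Khat (D a).
    move=> al; apply: (rint_normLp hp); first by have [_ [mD _] _] := hD a al.
    apply: le_lt_trans Dfin; rewrite (bigD1 (Ordinal (al : (a < s'.+2)%N)))//= leeDl//.
    by apply: sume_ge0 => b _; exact: N0.
  by apply: h1 => // a al; apply: weak_deriv_tensor; exact: hD.
move=> [//|s'] _ hs.
have [om [tom momE]] := @biorthogonal R s'.+1.
have [C1 C10 h1] := normLp_approx hp tom momE.
exists (C * C1 + 1); first by rewrite ltr_wpDl// mulr_ge0.
move=> u w d gx gy uL ud [[md dfin] _] uw hx hy.
have di := rint_normLp hp md dfin.
(* Here each exponent is at most s' <= k, so neither reaches k+1. *)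
have tq : trunc_poly k.+1 (proj_poly om d).
  apply: trunc_poly_sum => i; apply: trunc_poly_sum => j.
  have ik := leq_trans (ltn_ord i) hs; have jk := leq_trans (ltn_ord j) hs.
  apply: trunc_polyZ; apply: trunc_poly_monomial; [exact: ltnW|exact: ltnW|].
  by apply/eqP => -[ik' _]; move: ik; rewrite ik' ltnn.
have x0 := normLp_ge0 p gx; have y0 := normLp_ge0 p gy.
apply: scale (hC _ _ _ _ uL ud di uw tq) _ => //; first exact: adde_ge0.
move=> xy; have [_ [mx _] _] := hx; have [_ [my _] _] := hy.
apply: h1 => //.
- by apply: (rint_normLp hp mx); apply: le_lt_trans xy; rewrite leeDl.
- by apply: (rint_normLp hp my); apply: le_lt_trans xy; rewrite leeDr.
- exact: weak_deriv_tensor.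
- exact: weak_deriv_tensor.
Qed.
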